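(* Let $0<\alpha<1$ and $k\in\mathbb R$, let $g_{\alpha,k}$ be the $C^{1,\alpha}$ metric on $\mathbb S^2\times\mathbb S^1$ constructed in the context, and let $q$ be the point with local coordinates $(r,\theta,\xi)=(0,0,0)$. Let $B_q^{g_{\alpha,k}}(t)$ denote the geodesic ball (with respect to the Riemannian distance of $g_{\alpha,k}$) centered at $q$ with radius $t$. Then $$\mathrm{Vol}_{g_{\alpha,k}}\big(B_q^{g_{\alpha,k}}(t)\big)=\frac{4\pi}{3}t^3-\frac{4\pi}{45}t^5+o(t^5)\qquad\text{as }t\to0.$$
   Context: Construction of $g_{\alpha,k}$. Let $b\in C^\infty(\mathbb R)$ with $b(x)=0$ for $x\le\frac12$, $b(x)=1$ for $x\ge1$, $0\le b\le1$, $|b'|\le10$, $|b''|\le100$. Define $\psi_\alpha:[-1,1]^2\to\mathbb R$ by $\psi_\alpha(r,\theta)=|r\theta|\,b(|\theta|/|r|^{1/\alpha})\,b(|r|/|\theta|^{1/\alpha})$ if $r\theta\ne0$ and $\psi_\alpha=0$ if $r\theta=0$. Let $\chi\in C_c^\infty(\mathbb R^2)$ with $0\le\chi\le1$, $\chi\equiv1$ on $[-1,1]^2$, $\chi\equiv0$ outside $[-2,2]^2$; put $\chi_\rho(r,\theta)=\chi(r/\rho,\theta/\rho)$. Set $$\rho_*=\min\Big\{\tfrac14,\ \tfrac1{4(1+|k|)},\ \tfrac{1}{4(1+|k|)(15+\frac{10}\alpha)\sqrt{1+\sec^2(1/2)}}\Big\}.$$ Let $p\in\mathbb S^2$ (unit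 round sphere), with local coordinates $(r,\theta)$ centered at $p$ in which $g_{\mathbb S^2}=dr^2+\cos^2r\,d\theta^2$. Let $\varphi_{\alpha,k}=1+k\chi_{\rho_*}\psi_\alpha$, extended by $1$ outside the support of $\chi_{\rho_*}$, and $g_{\alpha,k}=\varphi_{\alpha,k}^{-2}g_{\mathbb S^2}+\varphi_{\alpha,k}^2d\xi^2$, with $\xi$ the coordinate on $\mathbb S^1$. *)

(* Defs.v *)
From HB Require Import structures.
From mathcomp Require Import all_boot all_order all_algebra.
From mathcomp Require Import all_classical all_reals all_analysis.
Import Order.TTheory GRing.Theory Num.Theory.
Import numFieldNormedType.Exports.

Set Implicit Arguments.
Unset Strict Implicit.
Unset Printing Implicit Defensive.

Local Open Scope classical_set_scope.
Local Open Scope ring_scope.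

(* C^oo: all iterated directional derivatives exist and are continuous. Meant
   for finite-dimensional V. *)
Definition smooth (R : realType) (V : normedModType R) (f : V -> R) : Prop :=
  forall s : seq V, let g := foldr (fun v h => 'D_v h) f s in
    continuous g /\ forall x v, derivable g x v.

Section cutoff_data.
Context {R : realType}.
Implicit Types (b : R -> R) (chi : R * R -> R).

Definition is_profile b : Prop :=
  [/\ smooth b,
      (forall x, x <= 1 / 2 -> b x = 0) /\ (forall x, 1 <= x -> b x = 1),
      forall x, 0 <= b x <= 1,
      forall x, `|derive1 b x| <= 10 &
      forall x, `|derive1n 2 b x| <= 100].

Definition is_cutoff chi : Prop :=
  [/\ smooth chi,
      forall x, 0 <= chi x <= 1,
      forall r th, `|r| <= 1 -> `|th| <= 1 -> chi (r, th) = 1 &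
      forall r th, ~ (`|r| <= 2 /\ `|th| <= 2) -> chi (r, th) = 0].

(* The formula makes sense on all of R^2; only its values where the cut-off is
   nonzero, well inside [-1, 1]^2, are used. *)
Definition psi (alpha : R) b (r th : R) : R :=
  if r * th != 0 then
    `|r * th| * b (`|th| / `|r| `^ alpha^-1) * b (`|r| / `|th| `^ alpha^-1)
  else 0.

Definition rho_star (alpha k : R) : R :=
  Num.min (1 / 4)
   (Num.min (1 / (4 * (1 + `|k|)))
     (1 / (4 * (1 + `|k|) * (15 + 10 / alpha)
           * Num.sqrt (1 + ((cos (1 / 2))^-1) ^+ 2)))).

Definition phi_loc (alpha k : R) b chi (r th : R) : R :=
  let rho := rho_star alpha k in
  1 + k * chi (r / rho, th / rho) * psi alpha b r th.

End cutoff_data.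

(* S^2 x S^1 is realised as the product of the unit sphere of R^3 and the unit
   circle of R^2. The norm of 'rV_n is the sup norm, so the Euclidean inner
   product is introduced by hand. *)
Notation ambient R := ('rV[R]_3 * 'rV[R]_2)%type.

Section S2xS1.
Context {R : realType}.

Definition dot n (u v : 'rV[R]_n) : R := (u *m v^T) 0 0.

Definition S2xS1 : set (ambient R) :=
  [set z | dot z.1 z.1 = 1 /\ dot z.2 z.2 = 1].

(* The rows of an orthogonal matrix Q are the point p and an orthonormal frame
   of T_p S^2. In the coordinates below the round metric is
   dr^2 + cos^2 r dth^2, and (0, 0) is p; every coordinate system with these
   properties arises from some Q in O(3). *)
Definition sphere_chart (Q : 'M[R]_3) (r th : R) : 'rV[R]_3 :=
  \row_(i < 3) [:: cos r * cos th; cos r * sin th; sin r]`_i *m Q.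

Definition circle_chart (xi : R) : 'rV[R]_2 :=
  \row_(i < 2) [:: cos xi; sin xi]`_i.

Definition chart (Q : 'M[R]_3) (u : R * R * R) : ambient R :=
  (sphere_chart Q u.1.1 u.1.2, circle_chart u.2).

(* The inverse of sphere_chart on the hemisphere |r|, |th| < pi / 2 around p,
   see sphere_coordK. *)
Definition sphere_coord (Q : 'M[R]_3) (y : 'rV[R]_3) : R * R :=
  let x := y *m Q^T in (asin (x 0 2), atan (x 0 1 / x 0 0)).

Definition phi (alpha k : R) (b : R -> R) (chi : R * R -> R) (Q : 'M[R]_3)
    (y : 'rV[R]_3) : R :=
  if 0 < (y *m Q^T) 0 0 then
    phi_loc alpha k b chi (sphere_coord Q y).1 (sphere_coord Q y).2
  else 1.

(* A metric tensor on S2xS1 is given by its values on tangent vectors seen in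
   the ambient space: the round metrics are restrictions of dot. *)
Definition g_metric (alpha k : R) b chi (Q : 'M[R]_3)
    (z u v : ambient R) : R :=
  let f := phi alpha k b chi Q z.1 in
  f ^- 2 * dot u.1 v.1 + f ^+ 2 * dot u.2 v.2.

End S2xS1.

Section riemannian.
Context {R : realType} {V : normedModType R}.
Variables (M : set V) (g : V -> V -> V -> R).
Implicit Types (c : R -> V) (x y : V).

Definition C1_on (s t : R) c : Prop :=
  exists f : R -> V, [/\ forall u, derivable f u 1, continuous (derive1 f) &
                         {in `[s, t], c =1 f}].

Definition piecewise_C1 c : Prop :=
  exists2 s : seq R, itv_partition 0 1 s &
    forall i, (i < size s)%N -> C1_on (0 :: s)`_i s`_i c.

Definition curve_length c : \bar R :=
  (\int[lebesgue_measure]_(t in `[0%R, 1%R])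
     (Num.sqrt (g (c t) (derive1 c t) (derive1 c t)))%:E)%E.

Definition rdist x y : \bar R :=
  ereal_inf [set curve_length c | c in
    [set c : R -> V | [/\ piecewise_C1 c, forall t, t \in `[0, 1] -> M (c t),
                          c 0 = x & c 1 = y]]].

Definition rball x (t : R) : set V := [set y | M y /\ (rdist x y < t%:E)%E].

Definition basis3 (i : 'I_3) : R * R * R :=
  ((i == 0)%:R, (i == 1)%:R, (i == 2)%:R).

Definition gram (Phi : R * R * R -> V) (u : R * R * R) : 'M[R]_3 :=
  \matrix_(i, j) g (Phi u) ('D_(basis3 i) Phi u) ('D_(basis3 j) Phi u).

(* Riemannian volume of A, computed in a chart Phi with domain D whose image
   has a null complement in M. *)
Definition rvolume (D : set (R * R * R)) (Phi : R * R * R -> V) (A : set V) :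
    \bar R :=
  (\int[lebesgue_measure \x lebesgue_measure \x lebesgue_measure]_(u in
     D `&` Phi @^-1` A) (Num.sqrt (\det (gram Phi u)))%:E)%E.

End riemannian.

Section coordinates.
Context {R : realType}.

Definition chart_dom : set (R * R * R) :=
  `](- (pi / 2)), (pi / 2)[ `*` `](- pi), pi[ `*` `](- pi), pi[.

Lemma sphere_coordK (Q : 'M[R]_3) (r th : R) :
  Q *m Q^T = 1%:M ->
  - (pi / 2) < r < pi / 2 -> - (pi / 2) < th < pi / 2 ->
  0 < (sphere_chart Q r th *m Q^T) 0 0 /\
  sphere_coord Q (sphere_chart Q r th) = (r, th).
Proof.
move=> OO r_itv th_itv.
have cr : 0 < cos r by rewrite cos_gt0_pihalf.
have ct : 0 < cos th by rewrite cos_gt0_pihalf.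
rewrite /sphere_coord /sphere_chart -mulmxA OO mulmx1 !mxE /=.
split; first exact: mulr_gt0.
congr pair.
  by rewrite sinK// in_itv/=; case/andP: r_itv => *; rewrite !ltW.
rewrite invfM mulrACA divff ?gt_eqF// mul1r -[sin th / _]/(tan th) tanK//.
Qed.

End coordinates.

(* Main.v *)
Require Import Defs.
From HB Require Import structures.
From mathcomp Require Import all_boot all_order all_algebra.
From mathcomp Require Import all_classical all_reals all_analysis.
From mathcomp Require Import measurable_realfun.
From mathcomp Require Import ring lra.
Import Order.TTheory GRing.Theory Num.Theory.
Import numFieldNormedType.Exports.

Set Implicit Arguments.
Unset Strict Implicit.
Unset Printing Implicit Defensive.

Local Open Scope classical_set_scope.
Local Open Scope ring_scope.

(** Write N = r^2 + th^2, h = |r th| and S = N + z^2. The profile factors in psi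
   equal 1 except in the two cusps |th| < |r|^(1/alpha) and |r| < |th|^(1/alpha),
   where h = o(N) because 1/alpha > 1; hence phi = 1 + k h + o(N) near q. The
   volume density of the chart is cos r / phi, and the squared distance to q is

     G = S - (r th)^2 / 3 - (2 k / 3) h (N - z^2)

   up to o(S^2). The metric is not C^2, and this expansion is not read off from
   curvature: it is proved by two separate bounds.

   - [dist_upper]: the distance is at most the length of the coordinate ray
     from q. The square root in the length is replaced by a tangent line, after
     which the integral along the ray is elementary and yields G.
   - [dist_lower]: G satisfies the eikonal inequality |grad G|^2 <= 4 G + o(S^2)
     ([eikonal]). Hence sqrt G grows along a curve at most as fast as arc length,
     up to a factor 1 + o(t^2). As h and the square root are not differentiable,
     the argument is run with h replaced by sqrt((r th)^2 + sg^2) and G by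
     G + eta^2, for sg much smaller than eta^2, and eta then tends to 0. A first crude
     comparison keeps a short curve inside the chart.

   The ball of radius t is thus trapped between the sets {G < tau^2} with
   tau = t (1 -/+ e t^2), and the density may be replaced by any function with
   the same second-order expansion. The function [weight_model] is chosen so
   that the volume of {G < tau^2} is computed exactly ([model_volume]). After
   integration in z, the coordinates (r, m = th / |r|) turn the remaining
   integrand into an exact derivative in r, where k disappears, and the
   integral over m of a rational function remains. It gives
   (4 pi / 3) tau^3 - (4 pi / 45) tau^5. *)

(** * The conformal factor near the base point *)

Section conformal_factor.
Context {R : realType}.
Implicit Types (alpha k e r th : R) (b : R -> R) (chi : R * R -> R).

Lemma psi_bounds alpha b r th : is_profile b ->
  0 <= psi alpha b r th <= `|r * th|.
Proof.
move=> [_ _ b01 _ _]; rewrite /psi; case: ifP => _; last by rewrite lexx normr_ge0.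
set x := b _; set y := b _.
have /andP[x0 x1] : 0 <= x <= 1 by exact: b01.
have /andP[y0 y1] : 0 <= y <= 1 by exact: b01.
rewrite !mulr_ge0//= -mulrA ler_piMr// mulr_ile1//.
Qed.

(** The profile factors differ from 1 only where one of |r|, |th| is smaller
   than the power 1/alpha > 1 of the other, and there |r th| is o(r^2 + th^2). *)
Lemma psi_approx alpha b e : 0 < alpha < 1 -> is_profile b -> 0 < e ->
  exists2 d : R, 0 < d & forall r th : R, r ^+ 2 + th ^+ 2 < d ->
    `|psi alpha b r th - `|r * th| | <= e * (r ^+ 2 + th ^+ 2).
Proof.
move=> /andP[a0 a1] hb e0.
have ia : 0 < alpha^-1 - 1 by rewrite subr_gt0 invf_gt1.
pose d0 := e `^ (alpha^-1 - 1)^-1.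
have d00 : 0 < d0 by rewrite powR_gt0.
have key (x y : R) : 0 < x -> 0 < y -> x < d0 -> y < x `^ alpha^-1 -> x * y <= e * x ^+ 2.
  move=> x0 y0 xd yx.
  have : x `^ (alpha^-1 - 1) <= e.
    rewrite [leRHS](_ : e = d0 `^ (alpha^-1 - 1)).
      by apply: ge0_ler_powR; rewrite ?nnegrE ?ltW.
    by rewrite /d0 -powRrM mulVf ?gt_eqF// powRr1// ltW.
  move=> xe; rewrite expr2 mulrCA ler_wpM2l ?(ltW x0)//.
  apply: (le_trans (ltW yx)).
  rewrite (_ : alpha^-1 = (alpha^-1 - 1) + 1); last by ring.
  rewrite powRD ?(gt_eqF x0) ?implybT// powRr1 ?(ltW x0)// ler_wpM2r// ltW//.
exists (d0 ^+ 2); first by rewrite exprn_gt0.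
move=> r th rd.
have rd0 : `|r| < d0.
  rewrite -(@ltr_pXn2r _ 2)// ?nnegrE ?(ltW d00)// real_normK ?num_real//.
  by rewrite (le_lt_trans _ rd)// lerDl sqr_ge0.
have td0 : `|th| < d0.
  rewrite -(@ltr_pXn2r _ 2)// ?nnegrE ?(ltW d00)// real_normK ?num_real//.
  by rewrite (le_lt_trans _ rd)// lerDr sqr_ge0.
have e2 : 0 <= e * (r ^+ 2 + th ^+ 2) by rewrite mulr_ge0 ?(ltW e0)// addr_ge0 ?sqr_ge0.
have [rt|rt] := eqVneq (r * th) 0.
  by rewrite /psi rt eqxx /= normr0 subr0 normr0.
have r0 : 0 < `|r| by rewrite normr_gt0; apply: contraNneq rt => ->; rewrite mul0r.
have t0 : 0 < `|th| by rewrite normr_gt0; apply: contraNneq rt => ->; rewrite mulr0.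
have pr : 0 < `|r| `^ alpha^-1 by rewrite powR_gt0.
have pt : 0 < `|th| `^ alpha^-1 by rewrite powR_gt0.
have hle : `|psi alpha b r th - `|r * th| | <= `|r * th|.
  have /andP[p0 p1] := psi_bounds alpha r th hb.
  by rewrite ler0_norm ?subr_le0// opprB lerBlDr lerDl.
have [tr|tr] := ltP `|th| (`|r| `^ alpha^-1).
  apply: (le_trans hle); rewrite normrM; apply: (le_trans (key _ _ r0 t0 rd0 tr)).
  by rewrite real_normK ?num_real// ler_wpM2l ?(ltW e0)// lerDl sqr_ge0.
have [tr'|tr'] := ltP `|r| (`|th| `^ alpha^-1).
  apply: (le_trans hle); rewrite normrM mulrC; apply: (le_trans (key _ _ t0 r0 td0 tr')).
  by rewrite real_normK ?num_real// ler_wpM2l ?(ltW e0)// lerDr sqr_ge0.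
case: hb => _ [_ b1] _ _ _.
rewrite /psi rt !b1 ?ler_pdivlMr ?mul1r// !mulr1 subrr normr0//.
Qed.

Lemma rho_star_gt0 alpha k : 0 < alpha -> 0 < rho_star alpha k.
Proof.
move=> a0; rewrite /rho_star !lt_min.
have k1 : 0 < 1 + `|k| by rewrite ltr_pwDl.
have s0 : 0 < Num.sqrt (1 + (cos (1 / 2 : R))^-1 ^+ 2).
  by rewrite sqrtr_gt0 ltr_pwDl// sqr_ge0.
have i0 : 0 < 10 / alpha by rewrite divr_gt0.
by rewrite !divr_gt0// !mulr_gt0// addr_gt0.
Qed.

(** On the support of the cut-off, |r th| <= 4 rho^2 with rho <= 1/4 and
   |k| rho <= 1/4. *)
Lemma phi_loc_bounds alpha k b chi r th : 0 < alpha -> is_profile b -> is_cutoff chi ->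
  1 / 2 <= phi_loc alpha k b chi r th <= 3 / 2.
Proof.
move=> a0 hb [_ c01 _ c0]; rewrite /phi_loc.
set rho := rho_star alpha k.
have rho0 : 0 < rho by exact: rho_star_gt0.
have /andP[p0 p1] := psi_bounds alpha r th hb.
have /andP[x0 x1] := c01 (r / rho, th / rho).
suff /ler_normlP[] : `|k * chi (r / rho, th / rho) * psi alpha b r th| <= 1 / 2 by lra.
have [[rr tt]|nn] := pselect (`|r / rho| <= 2 /\ `|th / rho| <= 2); last first.
  by rewrite (c0 _ _ nn) mulr0 mul0r normr0.
have k1 : 0 < 1 + `|k| by rewrite ltr_pwDl.
rewrite !normrM (ger0_norm x0) (ger0_norm p0).
move: rr tt; rewrite !normrM normfV (gtr0_norm rho0) !ler_pdivrMr// => rr tt.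
have rho4 : rho <= 1 / 4 by rewrite /rho /rho_star ge_min lexx.
have rhok : `|k| * rho <= 1 / 4.
  have : rho <= 1 / (4 * (1 + `|k|)) by rewrite /rho /rho_star !ge_min lexx orbT.
  rewrite ler_pdivlMr ?mulr_gt0// => H; have := normr_ge0 k; lra.
have P : psi alpha b r th <= 4 * rho ^+ 2.
  apply: (le_trans p1); rewrite normrM.
  have -> : 4 * rho ^+ 2 = (2 * rho) * (2 * rho) by ring.
  by rewrite ler_pM.
have : chi (r / rho, th / rho) * psi alpha b r th <= 4 * rho ^+ 2.
  by apply: le_trans P; rewrite ler_piMl.
move=> H; rewrite -mulrA.
apply: (le_trans (ler_wpM2l (normr_ge0 k) H)).
have -> : `|k| * (4 * rho ^+ 2) = 4 * (`|k| * rho) * rho by ring.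
have := normr_ge0 k; nra.
Qed.

(** Near the origin the cut-off equals 1, and [psi_approx] applies. *)
Lemma phi_loc_approx alpha k b chi e : 0 < alpha < 1 -> is_profile b -> is_cutoff chi ->
  0 < e ->
  exists2 d : R, 0 < d & forall r th : R, r ^+ 2 + th ^+ 2 < d ->
    `|phi_loc alpha k b chi r th - (1 + k * `|r * th|)| <= e * (r ^+ 2 + th ^+ 2).
Proof.
move=> a01 hb hc e0; have /andP[a0 a1] := a01.
have k1 : 0 < 1 + `|k| by rewrite ltr_pwDl.
have [d d0 dP] := @psi_approx alpha b (e / (1 + `|k|)) a01 hb (divr_gt0 e0 k1).
have rho0 := rho_star_gt0 k a0.
exists (Num.min d (rho_star alpha k ^+ 2)); first by rewrite lt_min d0 exprn_gt0.
move=> r th; rewrite lt_min => /andP[/dP H rr].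
rewrite /phi_loc; case: hc => _ _ -> //; last 2 first.
- rewrite normrM normfV (gtr0_norm rho0) ler_pdivrMr// mul1r.
  rewrite -(@ler_pXn2r _ 2)// ?nnegrE ?(ltW rho0)// real_normK ?num_real//.
  by rewrite ltW// (le_lt_trans _ rr)// lerDl sqr_ge0.
- rewrite normrM normfV (gtr0_norm rho0) ler_pdivrMr// mul1r.
  rewrite -(@ler_pXn2r _ 2)// ?nnegrE ?(ltW rho0)// real_normK ?num_real//.
  by rewrite ltW// (le_lt_trans _ rr)// lerDr sqr_ge0.
move=> _; rewrite mulr1 opprD addrACA subrr add0r -mulrBr normrM.
apply: (le_trans (ler_wpM2l (normr_ge0 k) H)).
rewrite mulrA ler_wpM2r ?addr_ge0 ?sqr_ge0//.
by rewrite mulrCA ger_pMr// ler_pdivrMr// mul1r lerDr.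
Qed.
End conformal_factor.

(** * The eikonal inequality *)

Section orders.
Context {R : realType} (e q : R).
Implicit Types a c d x y : R.
Hypotheses (e0 : 0 <= e) (e1 : e <= 1) (q0 : 0 <= q) (qe : q <= e).

(** Orders of magnitude, relative to a size q (the square of a distance) and a
   relative error e with q <= e: [bndQ] is O(q), [bndE] is O(e q), and [bndE2]
   is O(e q^2), with an explicit constant. Since q <= e, a product of two terms
   O(q) is O(e q); an expansion is then estimated by following its syntax. *)
Definition bndQ (c x : R) := `|x| <= c * q.
Definition bndE (c x : R) := `|x| <= c * (e * q).
Definition bndE2 (c x : R) := `|x| <= c * (e * q * q).

Let q1 : q <= 1. Proof. exact: le_trans qe e1. Qed.
Let eq0 : 0 <= e * q. Proof. exact: mulr_ge0. Qed.

Lemma bndQD c d x y : bndQ c x -> bndQ d y -> bndQ (c + d) (x + y).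
Proof. by move=> a b; rewrite /bndQ mulrDl (le_trans (ler_normD _ _))// lerD. Qed.
Lemma bndED c d x y : bndE c x -> bndE d y -> bndE (c + d) (x + y).
Proof. by move=> a b; rewrite /bndE mulrDl (le_trans (ler_normD _ _))// lerD. Qed.
Lemma bndE2D c d x y : bndE2 c x -> bndE2 d y -> bndE2 (c + d) (x + y).
Proof. by move=> a b; rewrite /bndE2 mulrDl (le_trans (ler_normD _ _))// lerD. Qed.

Lemma bndQN c x : bndQ c x -> bndQ c (- x).
Proof. by rewrite /bndQ normrN. Qed.
Lemma bndEN c x : bndE c x -> bndE c (- x).
Proof. by rewrite /bndE normrN. Qed.
Lemma bndE2N c x : bndE2 c x -> bndE2 c (- x).
Proof. by rewrite /bndE2 normrN. Qed.

Lemma bndQZ a c x : bndQ c x -> bndQ (`|a| * c) (a * x).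
Proof. by move=> h; rewrite /bndQ normrM -[leRHS]mulrA ler_wpM2l. Qed.
Lemma bndEZ a c x : bndE c x -> bndE (`|a| * c) (a * x).
Proof. by move=> h; rewrite /bndE normrM -[leRHS]mulrA ler_wpM2l. Qed.
Lemma bndE2Z a c x : bndE2 c x -> bndE2 (`|a| * c) (a * x).
Proof. by move=> h; rewrite /bndE2 normrM -[leRHS]mulrA ler_wpM2l. Qed.

Lemma bndQM c d x y : bndQ c x -> bndQ d y -> bndE (`|c| * `|d|) (x * y).
Proof.
move=> a b; rewrite /bndE normrM.
have a' : `|x| <= `|c| * q by apply: (le_trans a); rewrite ler_wpM2r// ler_norm.
have b' : `|y| <= `|d| * q by apply: (le_trans b); rewrite ler_wpM2r// ler_norm.
apply: (le_trans (ler_pM _ _ a' b')) => //.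
by rewrite mulrACA ler_wpM2l ?mulr_ge0// ler_wpM2r.
Qed.

Lemma bndQE c d x y : bndQ c x -> bndE d y -> bndE2 (`|c| * `|d|) (x * y).
Proof.
move=> a b; rewrite /bndE2 normrM.
have a' : `|x| <= `|c| * q by apply: (le_trans a); rewrite ler_wpM2r// ler_norm.
have b' : `|y| <= `|d| * (e * q) by apply: (le_trans b); rewrite ler_wpM2r// ler_norm.
apply: (le_trans (ler_pM _ _ a' b')) => //.
by rewrite mulrACA [q * _]mulrC.
Qed.

Lemma bndEQ c d x y : bndE c x -> bndQ d y -> bndE2 (`|d| * `|c|) (x * y).
Proof. by move=> a b; rewrite [x * y]mulrC; exact: bndQE. Qed.

Lemma bndE_Q c x : bndE c x -> bndQ `|c| x.
Proof.
move=> a; apply: (le_trans a); apply: (@le_trans _ _ (`|c| * (e * q))).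
  by rewrite ler_wpM2r// ler_norm.
by rewrite ler_wpM2l// ler_piMl.
Qed.
Lemma bndE2_E c x : bndE2 c x -> bndE `|c| x.
Proof.
move=> a; apply: (le_trans a); apply: (@le_trans _ _ (`|c| * (e * q * q))).
  by rewrite ler_wpM2r ?mulr_ge0// ler_norm.
by rewrite ler_wpM2l// ler_piMr.
Qed.
End orders.

Section eikonal.
Context {R : realType}.
Implicit Types (k sg r th z f : R).

(** A differentiable substitute for the absolute value; sg is the smoothing scale. *)
Definition smooth_abs sg (x : R) : R := Num.sqrt (x ^+ 2 + sg ^+ 2).

(** The approximate squared distance to q, with |r th| smoothed at scale sg.
   It is symmetric in r and th, so its derivative in th is [Gsmooth_r] with
   these two arguments exchanged. *)
Definition Gsmooth k sg r th z : R :=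
  r ^+ 2 + th ^+ 2 + z ^+ 2 - (r * th) ^+ 2 / 3
  - 2 * k / 3 * smooth_abs sg (r * th) * (r ^+ 2 + th ^+ 2 - z ^+ 2).

Definition Gsmooth_r k sg r th z : R :=
  2 * r * (1 - th ^+ 2 / 3 - 2 * k / 3 * smooth_abs sg (r * th))
  - 2 * k / 3 * (r ^+ 2 + th ^+ 2 - z ^+ 2) * (r * th ^+ 2 / smooth_abs sg (r * th)).
Definition Gsmooth_z k sg r th z : R :=
  2 * z * (1 + 2 * k / 3 * smooth_abs sg (r * th)).

(** Here f, g and c stand for phi^2, phi^-2 and cos^-2 r, of which only the
   expansions up to e q are used. The coefficients 1/3 and 2 k / 3 in Gsmooth
   are those for which the terms of order q^2 cancel. The derivative of the
   smoothed absolute value leaves B = sg^2 / A, which is at most sg = O(e q),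
   and R1, R2, which are bounded by th^2 and r^2. *)
Lemma eikonal k : exists C : R, forall e q sg r th z f g c : R,
  0 <= e <= 1 -> 0 <= q <= e -> r ^+ 2 + th ^+ 2 + z ^+ 2 <= q -> 0 < sg <= e * q ->
  `|f - (1 + 2 * k * `|r * th|)| <= e * q ->
  `|g - (1 - 2 * k * `|r * th|)| <= e * q ->
  `|c - (1 + r ^+ 2)| <= e * q ->
  f * (Gsmooth_r k sg r th z ^+ 2 + c * Gsmooth_r k sg th r z ^+ 2) + g * Gsmooth_z k sg r th z ^+ 2
  <= 4 * Gsmooth k sg r th z + C * (e * q * q).
Proof.
eexists => e q sg r th z f g c /andP[e0 e1] /andP[q0 qe] Sq /andP[sg0 sgq] hf hg hc.
rewrite /Gsmooth_r /Gsmooth_z /Gsmooth [th * r]mulrC.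
set A := smooth_abs sg (r * th); set h := `|r * th|.
set ka := 2 * k / 3.
have kE : 2 * k = 3 * ka by rewrite /ka; field.
rewrite kE in hf hg.
have A0 : 0 < A by rewrite sqrtr_gt0 ltr_wpDl ?sqr_ge0// exprn_gt0.
have An := lt0r_neq0 A0.
have A2 : A ^+ 2 = h ^+ 2 + sg ^+ 2.
  by rewrite sqr_sqrtr ?addr_ge0 ?sqr_ge0// real_normK ?num_real.
have h0 : 0 <= h by exact: normr_ge0.
have hA : h <= A by nra.
have Ah : A <= h + sg by nra.
set B := sg ^+ 2 / A.
have BA : B * A = sg ^+ 2 by rewrite /B divfK.
have B0 : 0 <= B by rewrite divr_ge0 ?sqr_ge0 ?ltW.
have Bs : B <= sg.
  rewrite ler_pdivrMr// expr2 ler_wpM2l ?(ltW sg0)//; nra.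
have h2 : h ^+ 2 = r ^+ 2 * th ^+ 2 by rewrite real_normK ?num_real// exprMn.
set r2 := r ^+ 2; set t2 := th ^+ 2; set z2 := z ^+ 2.
have r20 : 0 <= r2 by exact: sqr_ge0.
have t20 : 0 <= t2 by exact: sqr_ge0.
have z20 : 0 <= z2 by exact: sqr_ge0.
have hq : h <= q.
  have : 2 * h <= r2 + t2.
    have := sqr_ge0 (`|r| - `|th|); rewrite sqrrB !real_normK ?num_real//.
    by rewrite /h normrM /r2 /t2 -mulr_natl; lra.
  rewrite -/r2 -/t2 -/z2 in Sq; lra.
have q1 : q <= 1 by lra.
set R1 := r2 * t2 ^+ 2 / A ^+ 2; set R2 := t2 * r2 ^+ 2 / A ^+ 2.
have R10 : 0 <= R1 by rewrite divr_ge0 ?sqr_ge0// mulr_ge0 ?sqr_ge0.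
have R20 : 0 <= R2 by rewrite divr_ge0 ?sqr_ge0// mulr_ge0 ?sqr_ge0.
have A20 : 0 < A ^+ 2 by rewrite exprn_gt0.
have R1q : R1 <= t2.
  rewrite ler_pdivrMr// expr2 mulrA -h2 mulrC ler_wpM2l// A2 lerDl sqr_ge0//.
have R2q : R2 <= r2.
  rewrite ler_pdivrMr// expr2 mulrA [t2 * _]mulrC -h2 mulrC ler_wpM2l// A2 lerDl sqr_ge0//.
set M := r2 + t2 - z2.
rewrite -/r2 -/t2 -/z2 in Sq.
have QL (x : R) : 0 <= x -> x <= q -> bndQ q 1 x.
  by move=> x0 xq; rewrite /bndQ ger0_norm// mul1r.
have r2b : bndQ q 1 r2 by apply: QL => //; lra.
have t2b : bndQ q 1 t2 by apply: QL => //; lra.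
have z2b : bndQ q 1 z2 by apply: QL => //; lra.
have hb : bndQ q 1 h by exact: QL.
have R1b : bndQ q 1 R1 by apply: QL => //; lra.
have R2b : bndQ q 1 R2 by apply: QL => //; lra.
have Mb : bndQ q 1 M by rewrite /bndQ mul1r /M ler_norml; apply/andP; split; lra.
have Bb : bndE e q 1 B by rewrite /bndE mul1r ger0_norm//; lra.
have db : bndE e q 1 (A - h) by rewrite /bndE mul1r ger0_norm//; lra.
have Ab : bndQ q 2 A by rewrite /bndQ ger0_norm ?(ltW A0)//; nra.
have BE : A - B = r2 * t2 / A.
  by apply: (mulIf An); rewrite mulrBl BA divfK// -h2 -expr2 A2; ring.
have BE' : B = A - r2 * t2 / A by rewrite -BE; ring.
set u1 := 3^-1 * t2 + ka * A; set u2 := 3^-1 * r2 + ka * A.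
(* By a1E and a2E below, the squares are 4 r2 + v1 + X1 and 4 t2 + v2 + X2, with
   v1, v2 of order e q and X1, X2 of order e q^2. *)
set X1 := 4 * (r2 * (u1 * u1)) + 4 * (ka * (M * B)) + 4 * (ka * (u1 * (M * (A - B))))
  + ka ^+ 2 * (M * (M * R1)).
set X2 := 4 * (t2 * (u2 * u2)) + 4 * (ka * (M * B)) + 4 * (ka * (u2 * (M * (A - B))))
  + ka ^+ 2 * (M * (M * R2)).
set X3 := 4 * (ka ^+ 2 * (z2 * (A * A))).
set v1 := - (8 * (r2 * u1)) - 4 * (ka * (M * A)).
set v2 := - (8 * (t2 * u2)) - 4 * (ka * (M * A)).
have a1E : (2 * r * (1 - t2 / 3 - ka * A) - ka * M * (r * t2 / A)) ^+ 2 = 4 * r2 + v1 + X1.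
  by rewrite /X1 /v1 /u1 BE' /R1 /r2; field.
have a2E : (2 * th * (1 - r2 / 3 - ka * A) - ka * (t2 + r2 - z2) * (th * r2 / A)) ^+ 2
  = 4 * t2 + v2 + X2.
  rewrite [t2 + r2]addrC -/M.
  by rewrite /X2 /v2 /u2 BE' /R2 /t2; field.
have a3E : (2 * z * (1 + ka * A)) ^+ 2 = 4 * z2 + 8 * (ka * (z2 * A)) + X3.
  by rewrite /X3 /z2; ring.
rewrite a1E a2E a3E.
have QM : forall c d x y, bndQ q c x -> bndQ q d y -> bndE e q (`|c| * `|d|) (x * y).
  by move=> *; apply: bndQM.
have QE : forall c d x y, bndQ q c x -> bndE e q d y -> bndE2 e q (`|c| * `|d|) (x * y).
  by move=> *; apply: bndQE.
have E_Q : forall c x, bndE e q c x -> bndQ q `|c| x by move=> *; apply: (@bndE_Q _ e).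
have E2_E : forall c x, bndE2 e q c x -> bndE e q `|c| x by move=> *; apply: bndE2_E.
have E2_Q : forall c x, bndE2 e q c x -> bndQ q `| `|c| | x by move=> ? ? /E2_E/E_Q.
have EQ : forall c d x y, bndE e q c x -> bndQ q d y -> bndE2 e q (`|d| * `|c|) (x * y).
  by move=> *; apply: bndEQ.
have u1b : bndQ q _ u1 := bndQD (bndQZ 3^-1 t2b) (bndQZ ka Ab).
have u2b := bndQD (bndQZ 3^-1 r2b) (bndQZ ka Ab).
have MAb := QM _ _ _ _ Mb Ab.
have ABb := bndQD Ab (bndQN (E_Q _ _ Bb)).
have Xb : forall (x u v : R) c, bndQ q 1 x -> bndQ q c u -> bndQ q 1 v -> bndE2 e q _ _ :=
  fun x u v c xb ub vb =>
  bndE2D (bndE2D (bndE2D (bndE2Z 4 (QE _ _ _ _ xb (QM _ _ _ _ ub ub)))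
  (bndE2Z 4 (bndE2Z ka (QE _ _ _ _ Mb Bb))))
  (bndE2Z 4 (bndE2Z ka (QE _ _ _ _ ub (QM _ _ _ _ Mb ABb)))))
  (bndE2Z (ka ^+ 2) (QE _ _ _ _ Mb (QM _ _ _ _ Mb vb))).
have X1b := Xb _ _ _ _ r2b u1b R1b; rewrite -/X1 in X1b.
have X2b := Xb _ _ _ _ t2b u2b R2b; rewrite -/X2 in X2b.
have X3b := bndE2Z 4 (bndE2Z (ka ^+ 2) (QE _ _ _ _ z2b (QM _ _ _ _ Ab Ab))); rewrite -/X3 in X3b.
have v1b := bndED (bndEN (bndEZ 8 (QM _ _ _ _ r2b u1b))) (bndEN (bndEZ 4 (bndEZ ka MAb)));
  rewrite -/v1 in v1b.
have v2b := bndED (bndEN (bndEZ 8 (QM _ _ _ _ t2b u2b))) (bndEN (bndEZ 4 (bndEZ ka MAb)));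
  rewrite -/v2 in v2b.
set f1 := f - (1 + 3 * ka * h); set g1 := g - (1 - 3 * ka * h); set c1 := c - (1 + r2).
have f1b : bndE e q 1 f1 by rewrite /bndE mul1r.
have g1b : bndE e q 1 g1 by rewrite /bndE mul1r.
have c1b : bndE e q 1 c1 by rewrite /bndE mul1r.
have a2b := bndQD (bndQD (bndQZ 4 t2b) (E_Q _ _ v2b)) (E2_Q _ _ X2b).
have Wb := bndED (bndED (bndED v1b (E2_E _ _ X1b)) (bndED v2b (E2_E _ _ X2b)))
  (bndED (QM _ _ _ _ r2b a2b) (E2_E _ _ (EQ _ _ _ _ c1b a2b))).
set W := (v1 + X1 + (v2 + X2) + _) in Wb.
have Yb := bndQD (bndQD (bndQZ 4 r2b) (bndQZ 4 t2b)) (E_Q _ _ Wb).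
have z3b := bndED (bndEZ 8 (bndEZ ka (QM _ _ _ _ z2b Ab))) (E2_E _ _ X3b).
have Zb := bndQD (bndQZ 4 z2b) (E_Q _ _ z3b).
(* The sum bounded here is the difference of the two sides; the last line
   checks that all terms of lower order cancel. *)
have T := bndE2D (bndE2D (bndE2D (bndE2D (bndE2D (bndE2D (bndE2D
  (bndE2D (bndE2D X1b X2b) X3b)
  (bndE2D (QE _ _ _ _ r2b v2b) (QE _ _ _ _ r2b (E2_E _ _ X2b))))
  (EQ _ _ _ _ c1b a2b))
  (EQ _ _ _ _ f1b Yb))
  (bndE2Z 3 (bndE2Z ka (QE _ _ _ _ hb Wb))))
  (EQ _ _ _ _ g1b Zb))
  (bndE2N (bndE2Z 3 (bndE2Z ka (QE _ _ _ _ hb z3b)))))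
  (bndE2N (bndE2Z 12 (bndE2Z ka (QE _ _ _ _ Mb db)))).
have T' := le_trans (ler_norm _) T.
rewrite -lerBlDl; apply: le_trans T'.
have -> : (r * th) ^+ 2 = r2 * t2 by rewrite exprMn.
rewrite le_eqVlt; apply/orP; left; apply/eqP.
by rewrite /W /f1 /g1 /c1 /v1 /v2 /u1 /u2 /M; field.
Qed.
End eikonal.

(** * Integrals of nonnegative functions that need not be measurable *)

Section nnintegral.
Context d (T : measurableType d) (R : realType) (mu : {measure set T -> \bar R}).
Import HBNNSimple.
Local Open Scope ereal_scope.

(** Speeds of curves and balls are not known to be measurable, so this is read
   off from the definition of the integral as a supremum over simple functions. *)
Lemma ge0_integral_mono (D E : set T) (f g : T -> \bar R) :
  D `<=` E -> (forall x, D x -> 0 <= f x) -> (forall x, E x -> 0 <= g x) ->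
  (forall x, D x -> f x <= g x) ->
  \int[mu]_(x in D) f x <= \int[mu]_(x in E) g x.
Proof.
move=> DE f0 g0 fg; rewrite !ge0_integralE//; apply: le_ereal_sup => _ [h hf <-].
exists h => // x; apply: (le_trans (hf x)); rewrite !patchE.
have [xD|xD] := boolP (x \in D).
  by rewrite mem_set ?fg//; [exact: set_mem|apply: DE; exact: set_mem].
by case: ifPn => // /set_mem/g0.
Qed.

(** The sum of a simple function below f on A and one below f on B is a simple
   function below f on C. Equality may fail for a nonmeasurable f. *)
Lemma ge0_integral_superadd (A B C : set T) (f : T -> \bar R) :
  [disjoint A & B] -> A `|` B `<=` C -> (forall x, C x -> 0 <= f x) ->
  \int[mu]_(x in A) f x + \int[mu]_(x in B) f x <= \int[mu]_(x in C) f x.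
Proof.
move=> AB ABC f0.
have fA x : A x -> 0 <= f x by move=> Ax; apply/f0/ABC; left.
have fB x : B x -> 0 <= f x by move=> Bx; apply/f0/ABC; right.
rewrite !ge0_integralE//.
set SA := [set _ | h in _]; set SB := [set _ | h in _].
have h0 : forall x, (@nnsfun0 _ T R x)%:E <= 0 by [].
have key (h1 h2 : {nnsfun T >-> R}) :
  (forall x, (h1 x)%:E <= (f \_ A) x) -> (forall x, (h2 x)%:E <= (f \_ B) x) ->
  sintegral mu h1 + sintegral mu h2 <=
    ereal_sup [set sintegral mu h | h in [set h : {nnsfun T >-> R} | forall x, (h x)%:E
      <= (f \_ C) x]].
  move=> H1 H2; rewrite -sintegralD; apply: ereal_sup_ubound.
  exists (h1 \+ h2)%R => // x; rewrite /= EFinD.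
  move: (H1 x) (H2 x); rewrite !patchE.
  have [xA|xA] := boolP (x \in A).
    have xB : x \notin B.
      apply/negP => /set_mem xB; move/disj_setPS: AB => /(_ x); apply.
      by split => //; exact: set_mem.
    have xC : x \in C by apply/mem_set/ABC; left; exact: set_mem.
    rewrite (negbTE xB) xC => a b.
    by rewrite -[leRHS]adde0 leeD.
  have [xB|xB] := boolP (x \in B).
    have xC : x \in C by apply/mem_set/ABC; right; exact: set_mem.
    by rewrite xC => a b; rewrite -[leRHS]add0e leeD.
  move=> a b; apply: (@le_trans _ _ 0); first by rewrite -[leRHS]adde0 leeD.
  by case: ifPn => // /set_mem/f0.
set I := ereal_sup [set _ | h in _] in key *.
have [->|Ioo] := eqVneq I +oo; first by rewrite leey.
have fin1 (h1 : {nnsfun T >-> R}) : (forall x, (h1 x)%:E <= (f \_ A) x) ->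
  sintegral mu h1 \is a fin_num.
  move=> H1; rewrite ge0_fin_numE ?sintegral_ge0//.
  have := key h1 nnsfun0 H1 _; rewrite (_ : sintegral mu _ + _ = sintegral mu h1); last first.
    by rewrite -[X in _ + sintegral mu X]/(cst 0%R) sintegral0 adde0.
  move=> /(_ _)/le_lt_trans; apply; last by rewrite ltey.
  move=> x; rewrite patchE; case: ifPn => // /set_mem/fB; exact.
have fB' : ereal_sup SB \is a fin_num.
  rewrite ge0_fin_numE; last first.
    apply: ereal_sup_ubound; exists nnsfun0; last exact: sintegral0.
    by move=> x /=; rewrite patchE; case: ifPn => // /set_mem/fB.
  apply: (@le_lt_trans _ _ I); last by rewrite ltey.
  apply: ge_ereal_sup => _ [h2 H2 <-].
  have := key nnsfun0 h2 _ H2.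
  rewrite (_ : sintegral mu _ + _ = sintegral mu h2); last first.
    by rewrite -[X in sintegral mu X + _]/(cst 0%R) sintegral0 add0e.
  apply => x; rewrite patchE; case: ifPn => // /set_mem/fA; exact.
rewrite -leeBrDr//; apply: ge_ereal_sup => _ [h1 H1 <-].
rewrite leeBrDr// addeC -leeBrDr ?fin1//; apply: ge_ereal_sup => _ [h2 H2 <-].
by rewrite leeBrDr ?fin1// addeC key.
Qed.
End nnintegral.

(** * Growth of a function along a piecewise differentiable curve *)

Section growth.
Context {R : realType}.
Implicit Types (f g l : R -> R) (a b t : R).
Let mu := @lebesgue_measure R.

Lemma is_derive_continuous f (x df : R) : is_derive x 1 f df -> {for x, continuous f}.
Proof.
by move=> Df; apply/differentiable_continuous/derivable1_diffP; exact: ex_derive.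
Qed.

Lemma FTC_closed f f' a b : a <= b ->
  (forall u, a <= u <= b -> is_derive u 1 f (f' u)) ->
  (forall u, a <= u <= b -> {for u, continuous f'}) ->
  (\int[mu]_(x in `[a, b]) (f' x)%:E = (f b - f a)%:E)%E.
Proof.
move=> ab df cf; have [aeb|anb] := eqVneq a b.
  by rewrite -aeb subrr set_itv1 integral_set1.
rewrite (@continuous_FTC2 _ f' f) ?lt_neqAle ?anb//.
- apply: continuous_in_subspaceT => x; rewrite inE/= in_itv/= => xab; exact: cf.
- split.
  + by move=> x; rewrite in_itv/= => /andP[ax xb]; have := df x; rewrite !ltW// => /(_ isT)[].
  + apply: cvg_at_right_filter.
    by apply: (@is_derive_continuous _ _ (f' a)); apply: df; rewrite lexx.
  + apply: cvg_at_left_filter.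
    by apply: (@is_derive_continuous _ _ (f' b)); apply: df; rewrite lexx andbT.
- move=> x; rewrite in_itv/= => /andP[ax xb]; rewrite derive1E.
  by apply: derive_val; apply: df; rewrite !ltW.
Qed.

(** |f'| <= l forces the increment of f to be at most the integral of l, even
   though l itself need not be measurable. *)
Lemma growth_piece f f' l a b : a <= b ->
  (forall u, a <= u <= b -> is_derive u 1 f (f' u)) ->
  (forall u, a <= u <= b -> {for u, continuous f'}) ->
  (forall u, a < u < b -> `|f' u| <= l u) ->
  ((f b - f a)%:E <= \int[mu]_(x in `]a, b[) (l x)%:E)%E.
Proof.
move=> ab df cf fl; rewrite -(FTC_closed ab df cf).
have cw : {within `[a, b], continuous f'}.
  by apply: continuous_in_subspaceT => x; rewrite inE/= in_itv/= => xab; exact: cf.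
have mf : measurable_fun `[a, b] f' by exact: subspace_continuous_measurable_fun.
apply: (le_trans (lee_abs _)).
apply: (le_trans (le_abse_integral _ _ _)) => //; first exact/measurable_EFinP.
rewrite integral_itv_bndoo; last first.
  apply: measurableT_comp => //; apply/measurable_EFinP.
  by apply: measurable_funS mf => //; exact: subset_itv_oo_cc.
apply: ge0_integral_mono => //.
- by move=> x; rewrite /= in_itv/= => xab; rewrite lee_fin (le_trans _ (fl _ xab)).
Qed.

(** On [a, b] the function f agrees with a C^1 function whose derivative is at
   most l in absolute value. Passing to g absorbs the arbitrary values that
   the derivative of f takes at the break points of a piecewise C^1 curve. *)
Definition C1_growth l f a b := exists g, exists g', [/\ {in `[a, b], f =1 g},
  (forall u, a <= u <= b -> is_derive u 1 g (g' u)),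
  (forall u, a <= u <= b -> {for u, continuous g'}) &
  (forall u, a < u < b -> `|g' u| <= l u)].

Lemma growth_partition l f s a b t : itv_partition a b s -> (forall u, 0 <= l u) ->
  (forall i, (i < size s)%N -> C1_growth l f (a :: s)`_i s`_i) ->
  a <= t <= b ->
  ((f t - f a)%:E <= \int[mu]_(x in `]a, b[) (l x)%:E)%E.
Proof.
move=> + l0; elim: s a => [|x s ih] a pt gr /andP[at_ tb].
  have ab := itv_partition_nil pt; rewrite -ab in tb *.
  have -> : t = a by apply/eqP; rewrite eq_le tb.
  by rewrite subrr integral_ge0// => u _; rewrite lee_fin.
have ax : a < x by case: pt => /= /andP[].
have pt' := itv_partition_cons pt.
have xb := itv_partition_le pt'.
have [g [g' [fg dg cg gl]]] := gr 0%N isT; rewrite /= in fg dg cg gl.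
have [tx|xt] := leP t x.
  rewrite !fg ?in_itv/= ?lexx ?at_ ?tx ?(ltW ax)//.
  apply: (@le_trans _ _ (\int[mu]_(u in `]a, t[) (l u)%:E)%E).
    apply: growth_piece => // u /andP[au ut].
    - by apply: dg; rewrite au (le_trans ut).
    - by apply: cg; rewrite au (le_trans ut).
    - by apply: gl; rewrite au (lt_le_trans ut).
  apply: ge0_integral_mono => //.
  - by move=> u /=; rewrite !in_itv/= => /andP[-> /lt_le_trans]; apply.
  - by move=> u _; rewrite lee_fin.
  - by move=> u _; rewrite lee_fin.
have -> : f t - f a = (f x - f a) + (f t - f x) by ring.
have H1 : ((f x - f a)%:E <= \int[mu]_(u in `]a, x[) (l u)%:E)%E.
  rewrite !fg ?in_itv/= ?lexx ?(ltW ax)//.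
  exact: growth_piece (ltW ax) dg cg gl.
have H2 : ((f t - f x)%:E <= \int[mu]_(u in `]x, b[) (l u)%:E)%E.
  by apply: ih => //; [move=> i; exact: (gr i.+1)|rewrite (ltW xt)].
rewrite EFinD; apply: (le_trans (leeD H1 H2)).
apply: ge0_integral_superadd.
- apply/disj_setPS => u /=; rewrite !in_itv/= => -[/andP[_ ux] /andP[xu _]].
  by have := lt_trans ux xu; rewrite ltxx.
- move=> u /= [|]; rewrite !in_itv/= => /andP[u1 u2]; apply/andP; split => //.
  + exact: lt_le_trans u2 xb.
  + exact: lt_trans ax u1.
- by move=> u _; rewrite lee_fin.
Qed.

End growth.

(** * Derivatives of vector-valued maps *)

Section directional.
Context {R : realType}.

(** A directional derivative only sees the restriction to a line. *)
Lemma is_derive_line (V W : normedModType R) (f : V -> W) (x v : V) (df : W) :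
  is_derive (0 : R) 1 (fun t : R => f (t *: v + x)) df -> is_derive x v f df.
Proof.
move=> [dv ev].
have E : (fun h : R => h^-1 *: (((fun t : R => f (t *: v + x)) \o shift (0 : R)) (h *: 1) -
    f ((0 : R) *: v + x))) = (fun h : R => h^-1 *: ((f \o shift x) (h *: v) - f x)).
  by apply/funext => h /=; rewrite addr0 scale0r add0r [h *: 1]mulr1.
by split; [move: dv; rewrite /derivable E|move: ev; rewrite /derive E].
Qed.

Lemma is_derive_rV (V : normedModType R) n (f : V -> 'rV[R]_n) (x v : V) (df : 'rV[R]_n) :
  (forall i, is_derive x v (fun y => f y 0 i) (df 0 i)) -> is_derive x v f df.
Proof.
move=> H.
have D : derivable f x v by apply/derivable_mxP => i j; rewrite ord1; exact: ex_derive.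
split=> //; rewrite derive_mx//; apply/rowP => j; rewrite !mxE.
exact: derive_val.
Qed.

Lemma is_derive_rV_coord (V : normedModType R) n (f : V -> 'rV[R]_n) (x v : V) (df : 'rV[R]_n) i :
  is_derive x v f df -> is_derive x v (fun y => f y 0 i) (df 0 i).
Proof.
move=> [D E]; split; first by move/derivable_mxP : D; exact.
by rewrite -E derive_mx// !mxE.
Qed.

Lemma is_derive_mulmx (V : normedModType R) n m (f : V -> 'rV[R]_n) (x v : V) (df : 'rV[R]_n)
    (Q : 'M[R]_(n, m)) :
  is_derive x v f df -> is_derive x v (fun y => f y *m Q) (df *m Q).
Proof.
move=> H; apply: is_derive_rV => j; rewrite !mxE.
rewrite (_ : (fun y => _) = \sum_(i < n) (fun y => f y 0 i * Q i j)); last first.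
  by apply/funext => y; rewrite !mxE fct_sumE.
apply: is_derive_sum => i.
rewrite (_ : (fun y => _) = Q i j \*: (fun y => f y 0 i)); last first.
  by apply/funext => y /=; rewrite mulrC.
rewrite mulrC; apply: is_deriveZ; exact: is_derive_rV_coord.
Qed.

Lemma is_derive_pair (V W1 W2 : normedModType R) (f : V -> W1) (g : V -> W2) (x v : V)
    (df : W1) (dg : W2) :
  is_derive x v f df -> is_derive x v g dg -> is_derive x v (fun y => (f y, g y)) (df, dg).
Proof.
move=> [Df Ef] [Dg Eg].
have C : h^-1 *: (((fun y => (f y, g y)) \o shift x) (h *: v) - (f x,
  g x)) @[h --> 0^'] --> (df, dg).
  rewrite -Ef -Eg; exact: cvg_pair Df Dg.
split; first by apply/cvg_ex; exists (df, dg).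
exact/cvg_lim.
Qed.

Lemma is_derive_fst (V W1 W2 : normedModType R) (f : V -> W1 * W2) (x v : V) (df : W1 * W2) :
  is_derive x v f df -> is_derive x v (fun y => (f y).1) df.1.
Proof.
move=> [D E].
have C : h^-1 *: (((fun y => (f y).1) \o shift x) (h *: v) - (f x).1) @[h --> 0^'] --> df.1.
  rewrite -E.
  exact: (cvg_comp _ fst D (@cvg_fst _ _ _ _ _)).
split; first by apply/cvg_ex; exists df.1.
exact/cvg_lim.
Qed.

Lemma is_derive_snd (V W1 W2 : normedModType R) (f : V -> W1 * W2) (x v : V) (df : W1 * W2) :
  is_derive x v f df -> is_derive x v (fun y => (f y).2) df.2.
Proof.
move=> [D E].
have C : h^-1 *: (((fun y => (f y).2) \o shift x) (h *: v) - (f x).2) @[h --> 0^'] --> df.2.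
  rewrite -E.
  exact: (cvg_comp _ snd D (@cvg_snd _ _ _ _ _)).
split; first by apply/cvg_ex; exists df.2.
exact/cvg_lim.
Qed.
End directional.

(** * The metric in the chart *)

Section chart_metric.
Context {R : realType}.
Implicit Types (Q : 'M[R]_3) (r th z a b c t : R).

Definition row3 (a b c : R) : 'rV[R]_3 := \row_(i < 3) [:: a; b; c]`_i.
Definition row2 (a b : R) : 'rV[R]_2 := \row_(i < 2) [:: a; b]`_i.

Lemma row3E (x : 'rV[R]_3) : x = row3 (x 0 0) (x 0 1) (x 0 2).
Proof.
apply/rowP => -[[|[|[|//]]] i]; rewrite !mxE /=; congr (x _ _); exact/val_inj.
Qed.

Lemma row2E (x : 'rV[R]_2) : x = row2 (x 0 0) (x 0 1).
Proof. by apply/rowP => -[[|[|//]] i]; rewrite !mxE /=; congr (x _ _); exact/val_inj. Qed.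

Lemma dot_row3 a b c a' b' c' : dot (row3 a b c) (row3 a' b' c') = a * a' + b * b' + c * c'.
Proof. by rewrite /dot !mxE !big_ord_recr big_ord0/= !mxE /= add0r. Qed.

Lemma dot_row2 a b a' b' : dot (row2 a b) (row2 a' b') = a * a' + b * b'.
Proof. by rewrite /dot !mxE !big_ord_recr big_ord0/= !mxE /= add0r. Qed.

Lemma dot_mulmx Q (x y : 'rV[R]_3) : Q *m Q^T = 1%:M -> dot (x *m Q) (y *m Q) = dot x y.
Proof. by move=> OO; rewrite /dot trmx_mul mulmxA -(mulmxA x) OO mulmx1. Qed.

Lemma dot_mulmxT Q (x y : 'rV[R]_3) : Q *m Q^T = 1%:M -> dot (x *m Q^T) (y *m Q^T) = dot x y.
Proof. by move=> OO; apply: dot_mulmx; rewrite trmxK; exact: mulmx1C. Qed.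

(** The velocity in the ambient space of a curve whose coordinates are (r, th, z)
   with coordinate velocity (a, b, c). *)
Definition chart_velocity Q (r th z a b c : R) : ambient R :=
  (row3 (- sin r * cos th * a - cos r * sin th * b)
        (- sin r * sin th * a + cos r * cos th * b) (cos r * a) *m Q,
   row2 (- sin z * c) (cos z * c)).

Lemma is_derive_chart Q (r th z : R -> R) (t a b c : R) :
  is_derive t 1 r a -> is_derive t 1 th b -> is_derive t 1 z c ->
  is_derive t 1 (fun t => chart Q (r t, th t, z t)) (chart_velocity Q (r t) (th t) (z t) a b c).
Proof.
move=> Dr Dth Dz; rewrite /chart/= /sphere_chart /circle_chart.
have Dcr : is_derive t 1 (cos \o r) (- sin (r t) * a) by exact: is_derive1_comp.
have Dsr : is_derive t 1 (sin \o r) (cos (r t) * a) by exact: is_derive1_comp.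
have Dct : is_derive t 1 (cos \o th) (- sin (th t) * b) by exact: is_derive1_comp.
have Dst : is_derive t 1 (sin \o th) (cos (th t) * b) by exact: is_derive1_comp.
have Dcz : is_derive t 1 (cos \o z) (- sin (z t) * c) by exact: is_derive1_comp.
have Dsz : is_derive t 1 (sin \o z) (cos (z t) * c) by exact: is_derive1_comp.
apply: is_derive_pair.
  apply: is_derive_mulmx; apply: is_derive_rV => -[[|[|[|//]]] i]; rewrite !mxE/=.
  - rewrite (_ : (fun _ => _) = (cos \o r) * (cos \o th)); last by apply/funext => y; rewrite !mxE.
    apply: is_derive_eq; rewrite /= /GRing.scale /=; ring.
  - rewrite (_ : (fun _ => _) = (cos \o r) * (sin \o th)); last by apply/funext => y; rewrite !mxE.
    apply: is_derive_eq; rewrite /= /GRing.scale /=; ring.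
  - rewrite (_ : (fun _ => _) = (sin \o r)) //; by apply/funext => y; rewrite !mxE.
apply: is_derive_rV => -[[|[|//]] i]; rewrite !mxE/=.
- rewrite (_ : (fun _ => _) = (cos \o z)) //; by apply/funext => y; rewrite !mxE.
- rewrite (_ : (fun _ => _) = (sin \o z)) //; by apply/funext => y; rewrite !mxE.
Qed.

Lemma dot_chart_velocity Q (r th z a b c a' b' c' : R) : Q *m Q^T = 1%:M ->
  dot (chart_velocity Q r th z a b c).1 (chart_velocity Q r th z a' b' c').1
    = a * a' + cos r ^+ 2 * (b * b') /\
  dot (chart_velocity Q r th z a b c).2 (chart_velocity Q r th z a' b' c').2 = c * c'.
Proof.
move=> OO; rewrite /chart_velocity /= dot_mulmx// dot_row3 dot_row2.
have er := sin2cos2 r; have et := sin2cos2 th; have ez := sin2cos2 z.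
split.
  transitivity ((sin r ^+ 2 * a * a' + cos r ^+ 2 * (b * b')) * (sin th ^+ 2 + cos th ^+ 2)
    + cos r ^+ 2 * (a * a')).
    rewrite [in RHS]et; have -> : sin r ^+ 2 * a * a'
      = a * a' - cos r ^+ 2 * (a * a') by rewrite er; ring.
    have es : sin th ^+ 2 = 1 - cos th ^+ 2 := et.
    have es' : sin r ^+ 2 = 1 - cos r ^+ 2 := er.
    transitivity (sin r ^+ 2 * (a * a') * (cos th ^+ 2 + sin th ^+ 2)
      + cos r ^+ 2 * (b * b') * (cos th ^+ 2 + sin th ^+ 2) + cos r ^+ 2 * (a * a')); first by ring.
    rewrite es es'; ring.
  rewrite et er; ring.
transitivity ((sin z ^+ 2 + cos z ^+ 2) * (c * c')); first by ring.
rewrite ez; ring.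
Qed.

Lemma chart_S2xS1 Q r th z : Q *m Q^T = 1%:M -> S2xS1 (chart Q (r, th, z)).
Proof.
move=> OO; rewrite /S2xS1 /= /chart /sphere_chart /circle_chart /=; split.
  rewrite dot_mulmx// -/(row3 _ _ _) dot_row3.
  transitivity (cos r ^+ 2 * (cos th ^+ 2 + sin th ^+ 2) + sin r ^+ 2); first by ring.
  by rewrite !sin2cos2; ring.
by rewrite -/(row2 _ _) dot_row2 -!expr2 cos2Dsin2.
Qed.

Lemma phi_chart (alpha k : R) (bb : R -> R) chi Q r th : Q *m Q^T = 1%:M ->
  `|r| < pi / 2 -> `|th| < pi / 2 ->
  phi alpha k bb chi Q (sphere_chart Q r th) = phi_loc alpha k bb chi r th.
Proof.
move=> OO; rewrite !ltr_norml => r2 t2.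
by have [h1 h2] := sphere_coordK OO r2 t2; rewrite /phi h1 h2.
Qed.

Lemma g_metric_chart (alpha k : R) (bb : R -> R) chi Q (r th z a b c a' b' c' : R) :
  Q *m Q^T = 1%:M -> `|r| < pi / 2 -> `|th| < pi / 2 ->
  g_metric alpha k bb chi Q (chart Q (r, th, z))
    (chart_velocity Q r th z a b c) (chart_velocity Q r th z a' b' c') =
  phi_loc alpha k bb chi r th ^- 2 * (a * a' + cos r ^+ 2 * (b * b')) +
  phi_loc alpha k bb chi r th ^+ 2 * (c * c').
Proof.
move=> OO r2 t2; rewrite /g_metric /= phi_chart//.
by have [-> ->] := dot_chart_velocity r th z a b c a' b' c' OO.
Qed.

(** In the chart the metric is diagonal with entries phi^-2, phi^-2 cos^2 r
   and phi^2, so the volume density is cos r / phi. *)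
Lemma gram_chart (alpha k : R) (bb : R -> R) chi Q (r th z : R) :
  Q *m Q^T = 1%:M -> `|r| < pi / 2 -> `|th| < pi / 2 -> 0 < phi_loc alpha k bb chi r th ->
  Num.sqrt (\det (gram (g_metric alpha k bb chi Q) (chart Q) (r, th, z))) =
  (phi_loc alpha k bb chi r th)^-1 * cos r.
Proof.
move=> OO r2 t2 f0; set f := phi_loc alpha k bb chi r th.
have cr : 0 < cos r by rewrite cos_gt0_pihalf// -ltr_norml.
have D (i : 'I_3) : 'D_(basis3 i) (chart Q) (r, th, z) =
    chart_velocity Q r th z (i == 0)%:R (i == 1)%:R (i == 2)%:R.
  apply: derive_val; apply: is_derive_line.
  have H (x : R) (y : R) : is_derive (0 : R) 1 (fun t => t * y + x) y.
    by apply: is_derive_eq; rewrite /= /GRing.scale/=; ring.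
  have := @is_derive_chart Q (fun t => t * (i == 0)%:R + r) (fun t => t * (i == 1)%:R + th)
    (fun t => t * (i == 2)%:R + z) 0 _ _ _ (H _ _) (H _ _) (H _ _).
  by rewrite !mul0r !add0r.
have -> : gram (g_metric alpha k bb chi Q) (chart Q) (r, th, z) =
    diag_mx (row3 (f ^- 2) (f ^- 2 * cos r ^+ 2) (f ^+ 2)).
  apply/matrixP => i j; rewrite !mxE !D g_metric_chart// -/f.
  by case: i => -[|[|[|//]]] i; case: j => -[|[|[|//]]] j /=; rewrite ?mulr0n ?mulr1n; ring.
rewrite det_diag !big_ord_recr big_ord0/= !mxE/= mul1r.
rewrite [X in Num.sqrt X](_ : _ = (f^-1 * cos r) ^+ 2); last by field; rewrite gt_eqF.
by rewrite sqrtr_sqr ger0_norm// mulr_ge0 ?invr_ge0 ?ltW.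
Qed.

End chart_metric.

(** * Trigonometric estimates *)

Section trig_bounds.
Context {R : realType}.
Implicit Types x : R.

Lemma sin_le_id x : `|sin x| <= `|x|.
Proof.
wlog x0 : x / 0 <= x => [H|].
  by have [/H//|/ltW x0] := leP 0 x; rewrite -(opprK x) sinN !(normrN (- x)) normrN H// oppr_ge0.
have [c _] := @MVT_segment R sin cos 0 x x0 (fun x _ => is_derive_sin x)
  (continuous_subspaceT (@continuous_sin R)).
by rewrite sin0 !subr0 => ->; rewrite normrM ler_piMl// cos_max.
Qed.

(** Mean value theorem, with cos c - 1 = - 2 sin^2 (c / 2). *)
Lemma sin_approx x : `|sin x - x| <= x ^+ 2 * `|x|.
Proof.
wlog x0 : x / 0 <= x => [H|].
  have [/H//|/ltW x0] := leP 0 x.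
  by have := H (- x); rewrite oppr_ge0 x0 => /(_ isT); rewrite sinN sqrrN normrN -opprD normrN.
have [c] := @MVT_segment R (fun x => sin x - x) (fun x => cos x - 1) 0 x x0
  (fun x _ => is_deriveB (is_derive_sin x) (is_derive_id x 1))
  (continuous_subspaceT (fun x => continuousB (@continuous_sin R x) (@cvg_id _ _))).
rewrite in_itv/= => /andP[c0 cx].
rewrite sin0 !subr0 => ->; rewrite normrM ler_wpM2r//.
have -> : cos c - 1 = - (2 * sin (c / 2) ^+ 2).
  rewrite [c in LHS](_ : c = c / 2 + c / 2); last by field.
  by rewrite cosD -!expr2 cos2sin2; ring.
rewrite normrN ger0_norm; last by apply: mulr_ge0 => //; exact: sqr_ge0.
have s2 : sin (c / 2) ^+ 2 <= (c / 2) ^+ 2.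
  have := sin_le_id (c / 2); rewrite -(@ler_pXn2r _ 2)// ?nnegrE//.
  by rewrite !real_normK ?num_real.
apply: (@le_trans _ _ (2 * (c / 2) ^+ 2)); first by rewrite ler_wpM2l.
have : c ^+ 2 <= x ^+ 2 by rewrite lerXn2r ?nnegrE.
have := sqr_ge0 c; lra.
Qed.

Lemma sin2_approx x : `|sin x ^+ 2 - x ^+ 2| <= 2 * x ^+ 2 * x ^+ 2.
Proof.
rewrite subr_sqr normrM.
have h1 := sin_approx x; have h2 := sin_le_id x.
have h3 : `|sin x + x| <= 2 * `|x| by rewrite (le_trans (ler_normD _ _))//; lra.
apply: (le_trans (ler_pM _ _ h1 h3)) => //.
have <- : `|x| ^+ 2 = x ^+ 2 by rewrite real_normK ?num_real.
by rewrite le_eqVlt; apply/orP; left; apply/eqP; ring.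
Qed.

Lemma cos2_approx x : `|cos x ^+ 2 - (1 - x ^+ 2)| <= 2 * x ^+ 2 * x ^+ 2.
Proof.
have := sin2_approx x; rewrite sin2cos2 => h.
by rewrite -normrN (le_trans _ h)// le_eqVlt; apply/orP; left; apply/eqP; congr `|_|; ring.
Qed.

Lemma cos_approx x : `|cos x - (1 - x ^+ 2 / 2)| <= x ^+ 2 * x ^+ 2.
Proof.
have -> : cos x = 1 - 2 * sin (x / 2) ^+ 2.
  rewrite [x in LHS](_ : x = x / 2 + x / 2); last by field.
  by rewrite cosD -!expr2 cos2sin2; ring.
have -> : 1 - 2 * sin (x / 2) ^+ 2 - (1 - x ^+ 2 / 2) = - 2 * (sin (x / 2) ^+ 2 - (x / 2) ^+ 2).
  by field.
rewrite normrM normrN (ger0_norm (ler0n _ 2)).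
apply: (@le_trans _ _ (2 * (2 * (x / 2) ^+ 2 * (x / 2) ^+ 2))).
  by rewrite ler_wpM2l// sin2_approx.
have -> : 2 * (2 * (x / 2) ^+ 2 * (x / 2) ^+ 2) = x ^+ 2 * x ^+ 2 / 4 by field.
have := sqr_ge0 (x ^+ 2); rewrite expr2; lra.
Qed.

Lemma sec2_approx x : x ^+ 2 <= 1 / 4 ->
  `|(cos x ^+ 2)^-1 - (1 + x ^+ 2)| <= 8 * (x ^+ 2 * x ^+ 2).
Proof.
move=> x1; have := cos2_approx x; set c := cos x ^+ 2; set y := x ^+ 2 in x1 *.
have y0 : 0 <= y by exact: sqr_ge0.
move=> /ler_normlP[h1 h2].
have c0 : 1 / 2 <= c by nra.
have c00 : 0 < c by lra.
have -> : c^-1 - (1 + y) = (1 - (1 + y) * c) / c by field; rewrite gt_eqF.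
rewrite normrM normfV (gtr0_norm c00) ler_pdivrMr//.
by rewrite ler_norml; apply/andP; split; nra.
Qed.
End trig_bounds.

(** * Powers of the conformal factor *)

Section phi_powers.
Context {R : realType}.
Implicit Types x y e K N : R.

Lemma sqr_approx x y e K N : 0 <= N -> 0 <= e <= 1 -> 0 <= K ->
  `|x - (1 + y)| <= e * N -> `|y| <= K * N ->
  `|x ^+ 2 - (1 + 2 * y)| <= 2 * (e * N) + (K + 1) ^+ 2 * (N * N).
Proof.
move=> N0 /andP[e0 e1] K0 hx hy.
have -> : x ^+ 2 - (1 + 2 * y) = 2 * (x - (1 + y)) + (x - 1) ^+ 2 by ring.
apply: (le_trans (ler_normD _ _)); rewrite normrM ger0_norm// lerD ?ler_wpM2l//.
rewrite normrX (_ : _ * (N * N) = ((K + 1) * N) ^+ 2); last by ring.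
rewrite lerXn2r ?nnegrE ?mulr_ge0 ?addr_ge0//.
have -> : x - 1 = (x - (1 + y)) + y by ring.
apply: (le_trans (ler_normD _ _)); nra.
Qed.

Lemma inv_approx x y e K N : 0 <= N -> 0 <= e <= 1 -> 0 <= K -> 1 / 2 <= x ->
  `|x - (1 + y)| <= e * N -> `|y| <= K * N ->
  `|x^-1 - (1 - y)| <= e * N + 2 * ((K + 1) ^+ 2 * (N * N)).
Proof.
move=> N0 /andP[e0 e1] K0 x2 hx hy.
have x0 : 0 < x by lra.
have -> : x^-1 - (1 - y) = - (x - (1 + y)) + (x - 1) ^+ 2 * x^-1 by field; rewrite gt_eqF.
apply: (le_trans (ler_normD _ _)); rewrite normrN lerD//.
rewrite normrM normfV (gtr0_norm x0) ler_pdivrMr//.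
have H : `|(x - 1) ^+ 2| <= (K + 1) ^+ 2 * (N * N).
  rewrite normrX (_ : _ * (N * N) = ((K + 1) * N) ^+ 2); last by ring.
  rewrite lerXn2r ?nnegrE ?mulr_ge0 ?addr_ge0//.
  have -> : x - 1 = (x - (1 + y)) + y by ring.
  apply: (le_trans (ler_normD _ _)); nra.
apply: (le_trans H).
have : 0 <= (K + 1) ^+ 2 * (N * N) by rewrite !mulr_ge0// ?sqr_ge0// addr_ge0.
nra.
Qed.

Lemma norm_mul_le_sqr (r th : R) : `|r * th| <= r ^+ 2 + th ^+ 2.
Proof.
have := sqr_ge0 (`|r| - `|th|); rewrite sqrrB !real_normK ?num_real// normrM -mulr_natl.
have := sqr_ge0 r; have := sqr_ge0 th; lra.
Qed.

(** All three follow from phi = 1 + k h + o(N), since the quadratic remainder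
   is O(N^2); N small compared with e makes it at most e N. *)
Lemma phi_power_approx alpha k b chi e : 0 < alpha < 1 -> is_profile b -> is_cutoff chi ->
  0 < e ->
  exists2 d : R, 0 < d & forall r th : R, r ^+ 2 + th ^+ 2 < d ->
   [/\ `|phi_loc alpha k b chi r th ^+ 2 - (1 + 2 * k * `|r * th|)| <= e * (r ^+ 2 + th ^+ 2),
       `|phi_loc alpha k b chi r th ^- 2 - (1 - 2 * k * `|r * th|)| <= e * (r ^+ 2 + th ^+ 2) &
       `|(phi_loc alpha k b chi r th)^-1 - (1 - k * `|r * th|)| <= e * (r ^+ 2 + th ^+ 2)].
Proof.
move=> a01 hb hc e0; have /andP[a0 _] := a01.
set K : R := `|k|; have K0 : 0 <= K by exact: normr_ge0.
set e' := Num.min 1 (e / 8).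
have e'0 : 0 < e' by rewrite lt_min ltr01 divr_gt0.
have e'1 : e' <= 1 by rewrite ge_min lexx.
have e'e : e' <= e / 8 by rewrite ge_min lexx orbT.
set L : R := (K + 1) ^+ 2; have L0 : 0 < L by rewrite exprn_gt0// ltr_wpDl.
have L1 : K + 1 <= L by rewrite /L; nra.
have [d d0 dP] := phi_loc_approx k a01 hb hc e'0.
set d' := Num.min d (Num.min 1 (e' / (4 * (L + 2) ^+ 2))).
have d'0 : 0 < d' by rewrite !lt_min d0 ltr01 divr_gt0// mulr_gt0// exprn_gt0// addr_gt0.
exists d' => // r th; set N : R := _ + _; rewrite !lt_min => /and3P[Nd N1 NL].
have N0 : 0 <= N by rewrite addr_ge0 ?sqr_ge0.
set f := phi_loc _ _ _ _ _ _.
have /andP[f1 _] := phi_loc_bounds k r th a0 hb hc.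
have H : `|f - (1 + k * `|r * th|)| <= e' * N by exact: dP.
have Hk : `|k * `|r * th| | <= K * N by rewrite normrM normr_id ler_wpM2l// norm_mul_le_sqr.
have e01 : 0 <= e' <= 1 by rewrite (ltW e'0).
have H1 := sqr_approx N0 e01 K0 H Hk.
have H2 := inv_approx N0 e01 K0 f1 H Hk.
rewrite ltr_pdivlMr ?mulr_gt0 ?exprn_gt0 ?addr_gt0// in NL.
have LN : L * N <= e' / 4.
  have : 4 * (L + 2) ^+ 2 >= 4 * L by nra.
  move=> h; have : N * (4 * L) <= N * (4 * (L + 2) ^+ 2) by rewrite ler_wpM2l.
  lra.
have LNN : L * (N * N) <= e' / 4 * N by rewrite mulrA ler_wpM2r.
have eN : e' * N <= e / 8 * N by rewrite ler_wpM2r.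
rewrite -/L in H1 H2.
have eN00 : 0 <= e' * N by rewrite mulr_ge0// ltW.
have H2' : `|f^-1 - (1 + - (k * `|r * th|))| <= 2 * e' * N by apply: (le_trans H2); lra.
split.
- by rewrite -mulrA; apply: (le_trans H1); lra.
- have Hk' : `|- (k * `|r * th|)| <= (K + 1) * N by rewrite normrN (le_trans Hk)// ler_wpM2r//
  lerDl.
  have : 0 <= e' * N by rewrite mulr_ge0// ltW.
  have -> : f ^- 2 - (1 - 2 * k * `|r * th|) =
     2 * (f^-1 - (1 + - (k * `|r * th|))) + (f^-1 - 1) ^+ 2 by rewrite -exprVn; ring.
  move=> eN0; apply: (le_trans (ler_normD _ _)).
  rewrite normrM (ger0_norm (ler0n _ 2)) normrX.
  have B : `|f^-1 - 1| <= (L + 2) * N.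
    have -> : f^-1 - 1 = (f^-1 - (1 + - (k * `|r * th|))) + - (k * `|r * th|) by ring.
    apply: (le_trans (ler_normD _ _)); rewrite normrN.
    have : 2 * e' * N <= 2 * N by rewrite ler_wpM2r//; lra.
    have : K * N <= L * N by rewrite ler_wpM2r//; lra.
    lra.
  have B2 : `|f^-1 - 1| ^+ 2 <= e' * N.
    apply: (@le_trans _ _ (((L + 2) * N) ^+ 2)).
      by rewrite lerXn2r ?nnegrE// mulr_ge0// addr_ge0// ltW.
    have -> : ((L + 2) * N) ^+ 2 = (N * (L + 2) ^+ 2) * N by ring.
    rewrite ler_wpM2r//; lra.
  lra.
- by apply: (le_trans H2'); lra.
Qed.
End phi_powers.

(** * Coordinate rays *)

Section ray.
Context {R : realType}.
Implicit Types (Q : 'M[R]_3) (r th z t : R).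

Definition ray Q (r th z t : R) : ambient R := chart Q (t * r, t * th, t * z).

Lemma is_derive_mulr_const (t x : R) : is_derive t 1 (fun s : R => s * x) x.
Proof. by apply: is_derive_eq; rewrite /= /GRing.scale/=; ring. Qed.

Lemma is_derive_ray Q r th z t :
  is_derive t 1 (ray Q r th z) (chart_velocity Q (t * r) (t * th) (t * z) r th z).
Proof.
exact: (@is_derive_chart _ Q (fun s => s * r) (fun s => s * th) (fun s => s * z) t _ _ _
  (is_derive_mulr_const _ _) (is_derive_mulr_const _ _) (is_derive_mulr_const _ _)).
Qed.

Lemma derivable_rV (V : normedModType R) n (f : V -> 'rV[R]_n) (x v : V) :
  (forall i, derivable (fun y => f y 0 i) x v) -> derivable f x v.
Proof. by move=> H; apply/derivable_mxP => i j; rewrite ord1. Qed.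

Lemma derivable_chart_velocity Q r th z t :
  derivable (fun t : R => chart_velocity Q (t * r) (t * th) (t * z) r th z) t 1.
Proof.
have D1 (x : R) : is_derive t 1 (fun s : R => s * x) x by exact: is_derive_mulr_const.
pose Cr := cos \o (fun s : R => s * r); pose Sr := sin \o (fun s : R => s * r).
pose Ct := cos \o (fun s : R => s * th); pose St := sin \o (fun s : R => s * th).
pose Cz := cos \o (fun s : R => s * z); pose Sz := sin \o (fun s : R => s * z).
have DCr : derivable Cr t 1 by apply: ex_derive.
have DSr : derivable Sr t 1 by apply: ex_derive.
have DCt : derivable Ct t 1 by apply: ex_derive.
have DSt : derivable St t 1 by apply: ex_derive.
have DCz : derivable Cz t 1 by apply: ex_derive.
have DSz : derivable Sz t 1 by apply: ex_derive.
have c (x : R) : derivable (cst x : R -> R) t 1 by exact: derivable_cst.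
rewrite /chart_velocity.
have H1 : derivable (fun t : R => row3 (- sin (t * r) * cos (t * th) * r - cos (t * r) * sin (t
  * th) * th)
        (- sin (t * r) * sin (t * th) * r + cos (t * r) * cos (t * th) * th) (cos (t * r) * r)) t 1.
  apply: derivable_rV => i; case: i => -[|[|[|n]]] j; last (exfalso; exact: (notF j)).
  - rewrite (_ : (fun _ => _) = (- Sr * Ct * cst r - Cr * St * cst th)).
      exact: derivableB (derivableM (derivableM (derivableN DSr) DCt) (c r)) (derivableM
        (derivableM DCr DSt) (c th)).
    by apply/funext => s; rewrite mxE.
  - rewrite (_ : (fun _ => _) = (- Sr * St * cst r + Cr * Ct * cst th)).
      exact: derivableD (derivableM (derivableM (derivableN DSr) DSt) (c r)) (derivableM
        (derivableM DCr DCt) (c th)).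
    by apply/funext => s; rewrite mxE.
  - rewrite (_ : (fun _ => _) = (Cr * cst r)); first exact: derivableM DCr (c r).
    by apply/funext => s; rewrite mxE.
have H2 : derivable (fun t : R => row2 (- sin (t * z) * z) (cos (t * z) * z)) t 1.
  clear H1 DCr DSr DCt DSt.
  apply: derivable_rV => i; case: i => -[|[|n]] j; last (exfalso; exact: (notF j)).
  - rewrite (_ : (fun _ => _) = (- Sz * cst z)); first exact: derivableM (derivableN DSz) (c z).
    by apply/funext => s; rewrite mxE.
  - rewrite (_ : (fun _ => _) = (Cz * cst z)); first exact: derivableM DCz (c z).
    by apply/funext => s; rewrite mxE.
apply: (@ex_derive _ _ _ _ _ _ (_, _)).
exact: (is_derive_pair (is_derive_mulmx Q (derivableP H1)) (derivableP H2)).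
Qed.

(** The ray is C^1 on the whole line, so one piece is enough. *)
Lemma ray_C1 Q r th z : piecewise_C1 (ray Q r th z).
Proof.
exists [:: 1]; first exact: itv_partition1.
move=> [|//] _; exists (ray Q r th z); split => //.
  by move=> t; apply: ex_derive; exact: is_derive_ray.
rewrite (_ : derive1 _ = fun t => chart_velocity Q (t * r) (t * th) (t * z) r th z).
  by move=> t; apply/differentiable_continuous/derivable1_diffP/derivable_chart_velocity.
by apply/funext => t; rewrite derive1E; apply: derive_val; exact: is_derive_ray.
Qed.

Lemma half_pi_ge1 : 1 <= pi / 2 :> R.
Proof. by have := pi_ge2 R; lra. Qed.

(** The right-hand side is the length of the coordinate ray. *)
Lemma rdist_le_ray alpha k b chi Q r th z :
  Q *m Q^T = 1%:M -> `|r| < 1 -> `|th| < 1 ->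
  (rdist S2xS1 (g_metric alpha k b chi Q) (chart Q (0, 0, 0)%R) (chart Q (r, th, z)) <=
   \int[lebesgue_measure]_(t in `[0%R, 1%R])
     (Num.sqrt (phi_loc alpha k b chi (t * r) (t * th) ^- 2 * (r ^+ 2 + cos (t * r) ^+ 2 * th ^+ 2)
       + phi_loc alpha k b chi (t * r) (t * th) ^+ 2 * z ^+ 2))%:E)%E.
Proof.
move=> OO r1 t1.
apply: (@le_trans _ _ (curve_length (g_metric alpha k b chi Q) (ray Q r th z))).
  apply: ereal_inf_lbound; exists (ray Q r th z) => //; split.
  - exact: ray_C1.
  - by move=> t _; exact: chart_S2xS1.
  - by rewrite /ray !mul0r.
  - by rewrite /ray !mul1r.
rewrite /curve_length; apply: ge0_integral_mono => //.
move=> t; rewrite /= in_itv/= => /andP[t0 t1'].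
rewrite derive1E (derive_val (is_derive := is_derive_ray Q r th z t)) /ray.
have le1 x : `|x| < 1 -> `|t * x| < pi / 2.
  move=> x1; apply: lt_le_trans half_pi_ge1; rewrite normrM (ger0_norm t0).
  by apply: le_lt_trans x1; rewrite ler_piMl.
by rewrite g_metric_chart ?le1// !expr2.
Qed.
End ray.

(** * Upper bound for the distance *)

Section upper_bound.
Context {R : realType}.
Implicit Types (r th z t : R).

(** The approximate squared distance to q. *)
Definition Gmodel (k r th z : R) : R :=
  r ^+ 2 + th ^+ 2 + z ^+ 2 - (r * th) ^+ 2 / 3
  - 2 * k / 3 * `|r * th| * (r ^+ 2 + th ^+ 2 - z ^+ 2).

(** The graph of the square root lies below its tangent at m^2. *)
Lemma sqrt_le_tangent (x m : R) : 0 <= x -> 0 < m -> Num.sqrt x <= (x + m ^+ 2) / (2 * m).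
Proof.
move=> x0 m0; rewrite ler_pdivlMr ?mulr_gt0// -[x in leRHS]sqr_sqrtr//.
have := sqr_ge0 (Num.sqrt x - m); nra.
Qed.

Lemma half_bound (K S e : R) : S * (2 * K) < e -> K * S <= e / 2.
Proof. by move=> H; lra. Qed.

(** The squared speed of the ray at time t, with s = t^2, r2 = r^2, t2 = th^2,
   z2 = z^2, c = cos^2 (t r), f = phi^-2 and g = phi^2. *)
Lemma speed2_upper (s r2 t2 z2 h k e c f g : R) :
  0 <= s <= 1 -> 0 <= r2 -> 0 <= t2 -> 0 <= z2 -> 0 <= h <= r2 + t2 -> 0 <= e <= 1 ->
  0 <= f -> r2 + t2 <= 1 ->
  1 - s * r2 <= c <= 1 - s * r2 + 2 * (s * r2) * (s * r2) -> 0 <= c <= 1 ->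
  f <= 1 - 2 * k * (s * h) + e * (s * (r2 + t2)) ->
  g <= 1 + 2 * k * (s * h) + e * (s * (r2 + t2)) ->
  f * (r2 + c * t2) + g * z2 <=
    (r2 + t2 + z2) + s * (- (r2 * t2) - 2 * k * h * (r2 + t2 - z2))
    + (e + (2 * `|k| + 3) * (r2 + t2)) * (r2 + t2 + z2) ^+ 2.
Proof.
move=> /andP[s0 s1] r0 t0 z0 /andP[h0 hN] /andP[e0 e1] f0 N1 /andP[hc1 hc] /andP[c0 c1] hf hg.
set N := r2 + t2 in hN N1 hf hg *.
have N0 : 0 <= N by rewrite addr_ge0.
set X := r2 + c * t2; set u := 1 - 2 * k * (s * h) + e * (s * N) in hf.
have X0 : 0 <= X by rewrite addr_ge0// mulr_ge0.
have XN : X <= N by rewrite lerD2l ler_piMl.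
have H1 : f * X <= u * X by rewrite ler_wpM2r.
have H2 : g * z2 <= (1 + 2 * k * (s * h) + e * (s * N)) * z2 by rewrite ler_wpM2r.
have K0 := normr_ge0 k.
have /andP[sh0 sh1] : 0 <= s * h <= N by rewrite mulr_ge0//= (le_trans _ hN)// ler_piMl.
have /andP[sN0 sN1] : 0 <= s * N <= N by rewrite mulr_ge0//= ler_piMl.
have /andP[es0 es1] : 0 <= e * (s * N) <= N by rewrite mulr_ge0//= (le_trans _ sN1)// ler_piMl.
have uB : `|u - 1| <= (2 * `|k| + 1) * N.
  have -> : u - 1 = - (2 * (k * (s * h))) + e * (s * N) by rewrite /u; ring.
  apply: (le_trans (ler_normD _ _)); rewrite normrN normrM (ger0_norm (ler0n _ 2)) normrM.
  rewrite (ger0_norm sh0) (ger0_norm es0).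
  have : `|k| * (s * h) <= `|k| * N by rewrite ler_wpM2l.
  lra.
have rN : r2 <= N by rewrite lerDl.
have tN : t2 <= N by rewrite lerDr.
have sr0 : 0 <= s * r2 by rewrite mulr_ge0.
have srN : s * r2 <= N by apply: le_trans rN; rewrite ler_piMl.
set p := s * r2 in sr0 srN hc1 hc.
have pt0 : 0 <= p * t2 by rewrite mulr_ge0.
have pt : p * t2 <= N * N by apply: ler_pM.
have ppt : p * (p * t2) <= N * (N * N) by apply: ler_pM.
have X1 : X <= N - p * t2 + 2 * (p * (p * t2)).
  by have := ler_wpM2r t0 hc; rewrite /X /N; lra.
have X2 : N - X <= p * t2 by have := ler_wpM2r t0 hc1; rewrite /X /N; lra.
have D : - ((u - 1) * (N - X)) <= (2 * `|k| + 1) * N * (N * N).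
  apply: (le_trans (ler_norm _)); rewrite normrN normrM; apply: ler_pM => //.
  by rewrite ger0_norm ?subr_ge0// (le_trans X2).
have uX : u * X = X + (u - 1) * N - (u - 1) * (N - X) by ring.
have NN : N * N + N * z2 <= (N + z2) ^+ 2 by have := mulr_ge0 N0 z0; have := sqr_ge0 z2; nra.
have E1 : e * (s * N) * (N + z2) <= e * (N + z2) ^+ 2.
  rewrite -mulrA ler_wpM2l//.
  have : s * N * (N + z2) <= N * (N + z2) by rewrite ler_wpM2r// addr_ge0.
  lra.
have E2 : (2 * `|k| + 3) * N * (N * N) <= (2 * `|k| + 3) * N * (N + z2) ^+ 2.
  rewrite ler_wpM2l//; first by rewrite mulr_ge0//; lra.
  have := mulr_ge0 N0 z0; lra.
have uE : (u - 1) * N = - (2 * k * (s * h)) * N + e * (s * N) * N by rewrite /u; ring.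
have pE : s * (r2 * t2) = p * t2 by rewrite /p mulrA.
clear -H1 H2 X1 D ppt uE E1 E2 pE.
have H3 : f * X <= N - p * t2 + 2 * (N * (N * N)) + (u - 1) * N + (2 * `|k| + 1) * N * (N * N).
  have uX : u * X = X + (u - 1) * N - (u - 1) * (N - X) by ring.
  lra.
have -> : N + z2 + s * (- (r2 * t2) - 2 * k * h * (N - z2)) + (e + (2 * `|k| + 3) * N) * (N
  + z2) ^+ 2 =
  N + z2 - s * (r2 * t2) - 2 * k * (s * h) * N + 2 * k * (s * h) * z2 + e * (N + z2) ^+ 2 +
  (2 * `|k| + 3) * N * (N + z2) ^+ 2 by ring.
have E3 : (2 * `|k| + 3) * N * (N * N) = (2 * `|k| + 1) * N * (N * N) + 2 * (N * (N * N)) by ring.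
have E4 : e * (s * N) * (N + z2) = e * (s * N) * N + e * (s * N) * z2 by ring.
have E5 : (1 + 2 * k * (s * h) + e * (s * N)) * z2
  = z2 + 2 * k * (s * h) * z2 + e * (s * N) * z2 by ring.
rewrite E3 in E2; rewrite E4 in E1; rewrite E5 in H2; rewrite uE in H3; rewrite pE.
clear D uE pE E3 E4 E5.
set q1 := e * (N + z2) ^+ 2 in E1 *; set q2 := (2 * `|k| + 3) * N * (N + z2) ^+ 2 in E2 *.
set q3 := e * (s * N) * N in E1 H3 *; set q4 := e * (s * N) * z2 in E1 H2 *.
set q5 := 2 * k * (s * h) * z2 in H2 *; set q6 := p * t2 in H3 *.
set q7 := 2 * k * (s * h) in H3 *.
lra.
Qed.

(** The tangent line of the square root at tau^2 bounds the length of the ray by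
   the integral of c0 + t^2 c1, that is c0 + c1 / 3. The factor 1/3 turns the
   coefficients of speed2_upper into those of G, and the value is
   (G + e S^2 + tau^2) / (2 tau), which is less than tau. *)
Lemma dist_upper alpha k b chi Q (e : R) :
  0 < alpha < 1 -> is_profile b -> is_cutoff chi -> Q *m Q^T = 1%:M -> 0 < e ->
  exists2 d : R, 0 < d & forall r th z tau : R, r ^+ 2 + th ^+ 2 + z ^+ 2 < d -> 0 < tau ->
    Gmodel k r th z + e * (r ^+ 2 + th ^+ 2 + z ^+ 2) ^+ 2 < tau ^+ 2 ->
    (rdist S2xS1 (g_metric alpha k b chi Q) (chart Q (0, 0, 0)%R) (chart Q (r, th, z)) < tau%:E)%E.
Proof.
move=> a01 hb hc OO e0; have /andP[a0 _] := a01.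
set e' := Num.min 1 (e / 2).
have e'0 : 0 < e' by rewrite lt_min ltr01 divr_gt0.
have e'1 : e' <= 1 by rewrite ge_min lexx.
have e'e : e' <= e / 2 by rewrite ge_min lexx orbT.
set K : R := 2 * `|k| + 3; have K0 : 0 < K by rewrite ltr_wpDl// mulr_ge0.
have [d' d'0 dP] := phi_power_approx k a01 hb hc e'0.
exists (Num.min d' (Num.min (1/2) (e / (2 * K)))).
  by rewrite !lt_min d'0 !divr_gt0// mulr_gt0.
move=> r th z tau; rewrite !lt_min => /and3P[Sd S1 SK] tau0 Gt.
rewrite ltr_pdivlMr ?mulr_gt0// in SK.
set r2 : R := r ^+ 2 in Sd S1 SK Gt *; set t2 : R := th ^+ 2 in Sd S1 SK Gt *.
set z2 : R := z ^+ 2 in Sd S1 SK Gt *.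
have r20 : 0 <= r2 by exact: sqr_ge0.
have t20 : 0 <= t2 by exact: sqr_ge0.
have z20 : 0 <= z2 by exact: sqr_ge0.
set h : R := `|r * th|; have h0 : 0 <= h by exact: normr_ge0.
have hN : h <= r2 + t2 by exact: norm_mul_le_sqr.
have lt1 (x : R) : x ^+ 2 < 1 / 2 -> `|x| < 1.
  move=> x1; rewrite -(@ltr_pXn2r _ 2)// ?nnegrE// real_normK ?num_real// expr1n; lra.
have rl1 : `|r| < 1 by apply: lt1; rewrite -/r2; lra.
have tl1 : `|th| < 1 by apply: lt1; rewrite -/t2; lra.
apply: (le_lt_trans (rdist_le_ray alpha k b chi z OO rl1 tl1)).
set Sq : R := r2 + t2 + z2 in Sd S1 SK Gt.
have NS : r2 + t2 <= Sq by rewrite /Sq lerDl.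
have eK : e' + (2 * `|k| + 3) * (r2 + t2) <= e.
  have H : (2 * `|k| + 3) * (r2 + t2) <= e / 2.
    apply: (@le_trans _ _ (K * Sq)); first by rewrite ler_wpM2l// ltW.
    exact: half_bound.
  rewrite [leRHS](_ : e = e / 2 + e / 2); last by field.
  exact: lerD.
set Qc : R := - (r2 * t2) - 2 * k * h * (r2 + t2 - z2).
set c0 : R := (Sq + e * Sq ^+ 2 + tau ^+ 2) / (2 * tau).
set c1 : R := Qc / (2 * tau).
have bound : forall t : R, 0 <= t <= 1 ->
   Num.sqrt (phi_loc alpha k b chi (t * r) (t * th) ^- 2 * (r2 + cos (t * r) ^+ 2 * t2) +
   phi_loc alpha k b chi (t * r) (t * th) ^+ 2 * z2) <= c0 + t ^+ 2 * c1.
  move=> t /andP[t0 t1].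
  set f := phi_loc _ _ _ _ _ _; set c := cos _ ^+ 2.
  set s := t ^+ 2.
  have s0 : 0 <= s by exact: sqr_ge0.
  have s1 : s <= 1 by rewrite /s expr_le1.
  have NE : (t * r) ^+ 2 + (t * th) ^+ 2 = s * (r2 + t2) by rewrite /s /r2 /t2; ring.
  have hE : `|t * r * (t * th)| = s * h.
    rewrite (_ : _ * _ = s * (r * th)); last by rewrite /s; ring.
    by rewrite normrM (ger0_norm s0).
  have Nd : s * (r2 + t2) < d'.
    apply: le_lt_trans Sd; apply: (@le_trans _ _ (r2 + t2)); last by rewrite /Sq; lra.
    by rewrite ler_piMl// addr_ge0.
  have := dP (t * r) (t * th); rewrite NE hE => /(_ Nd)[/ler_normlP[_ f2] /ler_normlP[_ fi2] _].
  rewrite -/f in f2 fi2.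
  have tr : (t * r) ^+ 2 = s * r2 by rewrite exprMn.
  have cB1 : 1 - s * r2 <= c.
    have := sin_le_id (t * r); rewrite -(@ler_pXn2r _ 2)// ?nnegrE// !real_normK ?num_real//.
    by rewrite tr sin2cos2 -/c; lra.
  have cB2 : c <= 1 - s * r2 + 2 * (s * r2) * (s * r2).
    by have := cos2_approx (t * r); rewrite tr -/c => /ler_normlP[_]; lra.
  have c01 : 0 <= c <= 1.
    rewrite sqr_ge0/= /c -[leRHS](cos2Dsin2 (t * r)) lerDl sqr_ge0//.
  have Hs := @speed2_upper s r2 t2 z2 h k e' c (f ^- 2) (f ^+ 2).
  have {}Hs : f ^- 2 * (r2 + c * t2) + f ^+ 2 * z2 <= Sq + s * Qc + e * Sq ^+ 2.
    apply: (le_trans (Hs _ _ _ _ _ _ _ _ _ _ _ _)) => //.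
    - by rewrite s0.
    - by rewrite h0.
    - by rewrite (ltW e'0).
    - by rewrite -exprVn sqr_ge0.
    - by rewrite /Sq in S1; lra.
    - by rewrite cB1.
    - by lra.
    - by lra.
    - rewrite lerD2l ler_wpM2r ?sqr_ge0//.
  apply: (le_trans (sqrt_le_tangent _ tau0)).
    rewrite addr_ge0// mulr_ge0 ?sqr_ge0// -?exprVn ?sqr_ge0// addr_ge0// mulr_ge0 ?sqr_ge0//.
  have -> : c0 + s * c1 = (Sq + s * Qc + e * Sq ^+ 2 + tau ^+ 2) / (2 * tau).
    by rewrite /c0 /c1; field; rewrite gt_eqF.
  by rewrite ler_pM2r ?invr_gt0 ?mulr_gt0// lerD2r.
have b0 : forall t : R, 0 <= t <= 1 -> 0 <= c0 + t ^+ 2 * c1.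
  by move=> t /bound; apply: le_trans; exact: sqrtr_ge0.
apply: (@le_lt_trans _ _ (\int[lebesgue_measure]_(t in `[0%R, 1%R]) (c0 + t ^+ 2 * c1)%:E)%E).
  apply: ge0_integral_mono => //.
pose F := fun t : R => c0 * t + c1 / 3 * t ^+ 3.
have DF (u : R) : is_derive u 1 F (c0 + u ^+ 2 * c1).
  by rewrite /F; apply: is_derive_eq; rewrite /= /GRing.scale/=; field.
have F10 : F 1 - F 0 < tau.
  rewrite /F !expr1n expr0n/= !mulr0 addr0 subr0 !mulr1.
  have -> : c0 + c1 / 3 = (Gmodel k r th z + e * Sq ^+ 2 + tau ^+ 2) / (2 * tau).
    rewrite /c0 /c1 /Gmodel /Qc -/h -/r2 -/t2 -/z2 exprMn -/r2 -/t2 /Sq.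
    by field; rewrite gt_eqF.
  rewrite ltr_pdivrMr ?mulr_gt0//; lra.
have I : (\int[lebesgue_measure]_(t in `[0%R, 1%R]) (c0 + t ^+ 2 * c1)%:E = (F 1 - F 0)%:E)%E.
  apply: (@FTC_closed _ F) => // u _; apply: cvgD; first exact: cvg_cst.
  by apply: cvgM; [exact: exprn_continuous|exact: cvg_cst].
by move: F10; rewrite -lte_fin -I.
Qed.
End upper_bound.

(** * Continuously differentiable real functions *)

Section C1_with.
Context {R : realType}.
Implicit Types (f g h : R -> R) (D : set R) (t : R).

(** f has derivative f' at the points of D, and f' is continuous there; keeping f'
   as an argument lets the rules below compute it. *)
Definition C1_with D f f' := forall t, D t -> is_derive t 1 f (f' t) /\ {for t, continuous f'}.

Lemma C1_with_continuous D f f' t : C1_with D f f' -> D t -> {for t, continuous f}.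
Proof. by move=> H Dt; have [/is_derive_continuous] := H t Dt. Qed.

Lemma C1_with_eq D f f' g g' : C1_with D f f' -> f =1 g -> f' =1 g' -> C1_with D g g'.
Proof. by move=> H /funext <- /funext <-. Qed.

Lemma C1_with_cst D (c : R) : C1_with D (cst c) (cst 0).
Proof. by move=> t _; split; [exact: is_derive_cst|exact: cvg_cst]. Qed.

Lemma C1_withD D f f' g g' : C1_with D f f' -> C1_with D g g' ->
  C1_with D (fun t => f t + g t) (fun t => f' t + g' t).
Proof.
move=> Hf Hg t Dt; have [df cf] := Hf t Dt; have [dg cg] := Hg t Dt.
by split; [exact: is_deriveD|exact: cvgD].
Qed.

Lemma C1_withB D f f' g g' : C1_with D f f' -> C1_with D g g' ->
  C1_with D (fun t => f t - g t) (fun t => f' t - g' t).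
Proof.
move=> Hf Hg t Dt; have [df cf] := Hf t Dt; have [dg cg] := Hg t Dt.
by split; [exact: is_deriveB|exact: cvgB].
Qed.

Lemma C1_withM D f f' g g' : C1_with D f f' -> C1_with D g g' ->
  C1_with D (fun t => f t * g t) (fun t => f t * g' t + g t * f' t).
Proof.
move=> Hf Hg t Dt; have [df cf] := Hf t Dt; have [dg cg] := Hg t Dt.
have c1 := C1_with_continuous Hf Dt; have c2 := C1_with_continuous Hg Dt.
split; first exact: is_deriveM.
by apply: cvgD; apply: cvgM.
Qed.

Lemma C1_with_comp D f f' h h' : C1_with D f f' ->
  (forall t, D t -> is_derive (f t) 1 h (h' (f t)) /\ {for f t, continuous h'}) ->
  C1_with D (fun t => h (f t)) (fun t => h' (f t) * f' t).
Proof.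
move=> Hf Hh t Dt; have [df cf] := Hf t Dt; have [dh ch] := Hh t Dt.
have c1 := C1_with_continuous Hf Dt.
split; first exact: (is_derive1_comp dh df).
by apply: cvgM => //; exact: continuous_comp.
Qed.

Lemma C1_withV D f f' : C1_with D f f' -> (forall t, D t -> f t != 0) ->
  C1_with D (fun t => (f t)^-1) (fun t => - (f t) ^- 2 * f' t).
Proof.
move=> Hf f0; apply: (C1_with_comp (h := fun x => x^-1) (h' := fun x => - x ^- 2) Hf) => t Dt.
have ft := f0 t Dt.
split.
  by have := is_deriveV ft (is_derive_id (f t) 1); rewrite /GRing.scale/= mulr1.
apply: cvgN; apply: cvgV; first by rewrite expf_neq0.
exact: exprn_continuous.
Qed.

Lemma C1_with_sqrt D f f' : C1_with D f f' -> (forall t, D t -> 0 < f t) ->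
  C1_with D (fun t => Num.sqrt (f t)) (fun t => (2 * Num.sqrt (f t))^-1 * f' t).
Proof.
move=> Hf f0; apply: (C1_with_comp (h := Num.sqrt) (h' := fun x => (2 * Num.sqrt x)^-1) Hf) => t Dt.
have ft := f0 t Dt.
split; first exact: is_derive1_sqrt.
apply: cvgV; first by rewrite mulf_neq0// gt_eqF// sqrtr_gt0.
by apply: cvgM; [exact: cvg_cst|exact: sqrt_continuous].
Qed.

Lemma C1_with_atan D f f' : C1_with D f f' ->
  C1_with D (fun t => atan (f t)) (fun t => (1 + f t ^+ 2)^-1 * f' t).
Proof.
move=> Hf; apply: (C1_with_comp (h := atan) (h' := fun x => (1 + x ^+ 2)^-1) Hf) => t Dt.
split; first exact: is_derive1_atan.
apply: cvgV; first by rewrite gt_eqF// ltr_pwDl// sqr_ge0.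
by apply: cvgD; [exact: cvg_cst|exact: exprn_continuous].
Qed.

Lemma C1_with_asin D f f' : C1_with D f f' -> (forall t, D t -> -1 < f t < 1) ->
  C1_with D (fun t => asin (f t)) (fun t => (Num.sqrt (1 - f t ^+ 2))^-1 * f' t).
Proof.
move=> Hf f1; apply: (C1_with_comp (h := asin) (h' :=
  fun x => (Num.sqrt (1 - x ^+ 2))^-1) Hf) => t Dt.
have ft := f1 t Dt.
have pos : 0 < 1 - f t ^+ 2 by case/andP: ft => a b; nra.
split; first exact: is_derive1_asin.
apply: cvgV; first by rewrite gt_eqF// sqrtr_gt0.
apply: continuous_comp; last exact: sqrt_continuous.
by apply: cvgB; [exact: cvg_cst|exact: exprn_continuous].
Qed.

Lemma C1_with_Gsmooth D (k sg : R) r r' th th' z z' : 0 < sg ->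
  C1_with D r r' -> C1_with D th th' -> C1_with D z z' ->
  C1_with D (fun t => Gsmooth k sg (r t) (th t) (z t))
    (fun t => Gsmooth_r k sg (r t) (th t) (z t) * r' t + Gsmooth_r k sg (th t) (r t) (z t) * th' t
       + Gsmooth_z k sg (r t) (th t) (z t) * z' t).
Proof.
move=> sg0 Hr Ht Hz.
have Hrt := C1_withM Hr Ht.
have Hr2 := C1_withM Hr Hr; have Ht2 := C1_withM Ht Ht; have Hz2 := C1_withM Hz Hz.
have Hrt2 := C1_withM Hrt Hrt.
have Hin := C1_withD Hrt2 (@C1_with_cst D (sg ^+ 2)).
have pos t : D t -> 0 < r t * th t * (r t * th t) + cst (sg ^+ 2) t.
  by move=> _; rewrite -expr2 ltr_wpDl ?sqr_ge0// exprn_gt0.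
have HA := C1_with_sqrt Hin pos.
have HN := C1_withD Hr2 Ht2.
have H := C1_withB (C1_withB (C1_withD HN Hz2) (C1_withM Hrt2 (@C1_with_cst D 3^-1)))
  (C1_withM (C1_withM (@C1_with_cst D (2 * k / 3)) HA) (C1_withB HN Hz2)).
apply: (C1_with_eq H) => t; rewrite /cst/=.
  by rewrite /Gsmooth /smooth_abs !expr2.
rewrite /Gsmooth_r /Gsmooth_z.
have -> : smooth_abs sg (th t * r t) = smooth_abs sg (r t * th t) by rewrite mulrC.
have -> : Num.sqrt (r t * th t * (r t * th t) + sg ^+ 2) = smooth_abs sg (r t * th t).
  by rewrite /smooth_abs expr2.
have A0 : smooth_abs sg (r t * th t) != 0.
  by rewrite gt_eqF// sqrtr_gt0 ltr_wpDl ?sqr_ge0// exprn_gt0.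
by field.
Qed.
End C1_with.

(** * The eikonal inequality along a velocity *)

Section eikonal_speed.
Context {R : realType}.

(** Lagrange's identity. *)
Lemma cauchy_schwarz3 (a b c x y z : R) :
  (a * x + b * y + c * z) ^+ 2 <= (a ^+ 2 + b ^+ 2 + c ^+ 2) * (x ^+ 2 + y ^+ 2 + z ^+ 2).
Proof.
have -> : (a ^+ 2 + b ^+ 2 + c ^+ 2) * (x ^+ 2 + y ^+ 2 + z ^+ 2) =
  (a * x + b * y + c * z) ^+ 2 + ((a * y - b * x) ^+ 2 + (a * z - c * x) ^+ 2
    + (b * z - c * y) ^+ 2).
  by ring.
by rewrite lerDl !addr_ge0// sqr_ge0.
Qed.

(** The correction to r^2 + th^2 + z^2 is of second order. *)
Lemma Gsmooth_perturb (k sg r th z q : R) : 0 < sg <= q -> r ^+ 2 + th ^+ 2 + z ^+ 2 <= q ->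
  `|Gsmooth k sg r th z - (r ^+ 2 + th ^+ 2 + z ^+ 2)| <= (1 + 2 * `|k|) * (q * q).
Proof.
move=> /andP[sg0 sgq] Sq.
have r0 := sqr_ge0 r; have t0 := sqr_ge0 th; have z0 := sqr_ge0 z.
have q0 : 0 <= q by lra.
set A := smooth_abs sg (r * th).
have A0 : 0 <= A by exact: sqrtr_ge0.
have hn : `|r * th| <= (r ^+ 2 + th ^+ 2) / 2.
  have := sqr_ge0 (`|r| - `|th|); rewrite sqrrB !real_normK ?num_real// normrM -mulr_natl; lra.
have Aq : A <= 3 / 2 * q.
  have : A <= `|r * th| + sg.
    have h0 := normr_ge0 (r * th).
    rewrite -(@ler_pXn2r _ 2)// ?nnegrE ?addr_ge0// ?(ltW sg0)//.
    rewrite sqr_sqrtr ?addr_ge0 ?sqr_ge0// -[X in X + _ <= _]real_normK ?num_real//.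
    have := mulr_ge0 h0 (ltW sg0); rewrite sqrrD; lra.
  lra.
set M := r ^+ 2 + th ^+ 2 - z ^+ 2.
have Mq : `|M| <= q by rewrite ler_norml; apply/andP; split; rewrite /M; lra.
have -> : Gsmooth k sg r th z - (r ^+ 2 + th ^+ 2 + z ^+ 2) =
   - ((r * th) ^+ 2 / 3) - 2 / 3 * (k * (A * M)) by rewrite /Gsmooth -/A -/M; field.
apply: (le_trans (ler_normD _ _)); rewrite !normrN.
have h2 : `|(r * th) ^+ 2 / 3| <= q * q.
  rewrite ger0_norm; last by rewrite divr_ge0 ?sqr_ge0.
  have : (r * th) ^+ 2 <= q * q.
    rewrite exprMn; apply: ler_pM => //; lra.
  have := sqr_ge0 (r * th); lra.
have h3 : `|2 / 3 * (k * (A * M))| <= 2 * `|k| * (q * q).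
  rewrite (normrM (2 / 3)) [`|2 / 3|]ger0_norm// (normrM k) (normrM A) (ger0_norm A0).
  have : A * `|M| <= 3 / 2 * q * q by apply: ler_pM.
  move=> h; have := ler_wpM2l (normr_ge0 k) h.
  have := mulr_ge0 (normr_ge0 k) (mulr_ge0 q0 q0); lra.
lra.
Qed.

(** Cauchy-Schwarz in an orthonormal frame of the metric, followed by [eikonal].
   The left-hand side of the second bound is the derivative of G along a
   velocity (r', th', z'), the last square root is the speed, and dividing by
   2 sqrt(G + eta^2) gives the derivative of sqrt(G + eta^2). The term eta^2
   keeps the square root differentiable and controls sg. *)
Lemma eikonal_speed alpha k b chi (e : R) :
  0 < alpha < 1 -> is_profile b -> is_cutoff chi -> 0 < e ->
  exists e1 d : R, [/\ 0 < e1, 0 < d & forall r th z eta sg r' th' z' : R,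
    let q := r ^+ 2 + th ^+ 2 + z ^+ 2 + eta ^+ 2 in
    let f := phi_loc alpha k b chi r th in
    q < d -> 0 < eta -> 0 < sg <= e1 * eta ^+ 2 ->
    0 < Gsmooth k sg r th z + eta ^+ 2 /\
    `|Gsmooth_r k sg r th z * r' + Gsmooth_r k sg th r z * th' + Gsmooth_z k sg r th z * z'| <=
    2 * Num.sqrt (Gsmooth k sg r th z + eta ^+ 2) * ((1 + e * q) *
      Num.sqrt (f ^- 2 * (r' ^+ 2 + cos r ^+ 2 * th' ^+ 2) + f ^+ 2 * z' ^+ 2))].
Proof.
move=> a01 hb hc e0; have /andP[a0 _] := a01.
have [C HC] := eikonal k.
set C' : R := `|C| + 1; have C'0 : 0 < C' by rewrite ltr_wpDl.
set e1 : R := Num.min 1 (e / C').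
have e10 : 0 < e1 by rewrite lt_min ltr01 divr_gt0.
have e11 : e1 <= 1 by rewrite ge_min lexx.
have e1e : C' * e1 <= e by rewrite mulrC -ler_pdivlMr// ge_min lexx orbT.
have [d' d'0 dP] := phi_power_approx k a01 hb hc e10.
set d : R := Num.min (Num.min d' (e1 / 8)) (1 / (2 * (1 + 2 * `|k|))).
have k0 := normr_ge0 k.
have d0 : 0 < d by rewrite !lt_min d'0 !divr_gt0// mulr_gt0// ltr_pwDl// mulr_ge0.
exists e1, d; split => // r th z eta sg r' th' z' q f;
  rewrite !lt_min => /andP[/andP[qd qe1] qk] eta0 /andP[sg0 sge].
have r0 := sqr_ge0 r; have t0 := sqr_ge0 th; have z0 := sqr_ge0 z.
have eta20 : 0 < eta ^+ 2 by rewrite exprn_gt0.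
have Sq : r ^+ 2 + th ^+ 2 + z ^+ 2 <= q by rewrite /q; lra.
have q0 : 0 < q by rewrite /q; lra.
have etaq : eta ^+ 2 <= q by rewrite /q; lra.
have sgq : sg <= e1 * q by rewrite (le_trans sge)// ler_pM2l.
have sgq1 : sg <= q by rewrite (le_trans sgq)// ler_piMl// ltW.
have N0 : 0 <= r ^+ 2 + th ^+ 2 by lra.
have NS : r ^+ 2 + th ^+ 2 <= q by rewrite /q; lra.
have [P1 P2 _] := dP r th (le_lt_trans NS qd).
have eN : e1 * (r ^+ 2 + th ^+ 2) <= e1 * q by rewrite ler_pM2l.
have {}P1 := le_trans P1 eN; have {}P2 := le_trans P2 eN; rewrite -/f in P1 P2.
have r4 : r ^+ 2 <= 1 / 4 by lra.
have P3 : `|(cos r ^+ 2)^-1 - (1 + r ^+ 2)| <= e1 * q.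
  apply: (le_trans (sec2_approx r4)).
  have : r ^+ 2 * r ^+ 2 <= e1 / 8 * q by apply: ler_pM => //; clear -NS t0 qe1; lra.
  clear; lra.
have qe : 0 <= q <= e1 by lra.
have e1b : 0 <= e1 <= 1 by rewrite (ltW e10).
have sgb : 0 < sg <= e1 * q by rewrite sg0.
have E := HC _ _ _ _ _ _ _ _ _ e1b qe Sq sgb P1 P2 P3.
have sgb' : 0 < sg <= q by rewrite sg0.
have Gp := Gsmooth_perturb k sgb' Sq.
have Gq : q / 2 <= Gsmooth k sg r th z + eta ^+ 2.
  move: Gp => /ler_normlP[Gp _].
  have : (1 + 2 * `|k|) * (q * q) <= q / 2.
    have k1 : 0 < 2 * (1 + 2 * `|k|) by clear -k0; lra.
    move: qk; rewrite ltr_pdivlMr// => qk.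
    have := ler_wpM2r (ltW q0) (ltW qk); clear; lra.
  rewrite /q in Gp *; clear -Gp; lra.
set G := Gsmooth k sg r th z + eta ^+ 2 in Gq *.
have G0 : 0 < G by clear -Gq q0; lra.
split=> //.
have /andP[f1 f2] := phi_loc_bounds k r th a0 hb hc; rewrite -/f in f1 f2.
have f0 : 0 < f by clear -f1; lra.
have c0 : 0 < cos r ^+ 2.
  have r1 : r ^+ 2 <= 1 by clear -r4; lra.
  have /ler_normlP[] := cos2_approx r; clear -r4 r0; nra.
have cn0 : cos r != 0 by apply: contraTneq c0 => ->; rewrite expr0n ltxx.
set a1 := Gsmooth_r k sg r th z in E *; set a2 := Gsmooth_r k sg th r z in E *.
set a3 := Gsmooth_z k sg r th z in E *.
set L := f ^- 2 * (r' ^+ 2 + cos r ^+ 2 * th' ^+ 2) + f ^+ 2 * z' ^+ 2.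
have L0 : 0 <= L.
  have fi : 0 <= f ^- 2 by rewrite -exprVn sqr_ge0.
  apply: addr_ge0; last exact: mulr_ge0 (sqr_ge0 _) (sqr_ge0 _).
  apply: (mulr_ge0 fi); apply: addr_ge0; first exact: sqr_ge0.
  exact: mulr_ge0 (sqr_ge0 _) (sqr_ge0 _).
have D2 : (a1 * r' + a2 * th' + a3 * z') ^+ 2 <= 4 * G * (1 + e * q) * L.
  have -> : a1 * r' + a2 * th' + a3 * z' =
    (f * a1) * (f^-1 * r') + (f * (a2 / cos r)) * (f^-1 * (cos r * th')) + (f^-1 * a3) * (f * z').
    by field; rewrite cn0 gt_eqF.
  apply: (le_trans (cauchy_schwarz3 _ _ _ _ _ _)).
  have -> : (f^-1 * r') ^+ 2 + (f^-1 * (cos r * th')) ^+ 2 + (f * z') ^+ 2 = L.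
    by rewrite /L; field; rewrite gt_eqF.
  rewrite ler_wpM2r//.
  have -> : (f * a1) ^+ 2 + (f * (a2 / cos r)) ^+ 2 + (f^-1 * a3) ^+ 2 =
     f ^+ 2 * (a1 ^+ 2 + (cos r ^+ 2)^-1 * a2 ^+ 2) + f ^- 2 * a3 ^+ 2.
    by field; rewrite cn0 gt_eqF.
  apply: (le_trans E).
  have : C * (e1 * q * q) <= 2 * (e * q) * G.
    have e1qq : 0 <= e1 * q * q by rewrite !mulr_ge0// ltW.
    apply: (@le_trans _ _ (C' * (e1 * q * q))).
      by rewrite ler_wpM2r// /C' (le_trans (ler_norm _))// lerDl.
    have : C' * e1 * (q * q) <= e * (q * q) by rewrite ler_wpM2r// mulr_ge0// ltW.
    have : (e * q) * (q / 2) <= (e * q) * G by rewrite ler_wpM2l// mulr_ge0// ltW.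
    lra.
  have : 0 <= e * q * G by rewrite !mulr_ge0// ltW.
  rewrite /G; clear -eta20; lra.
have eq0 : 0 <= e * q by rewrite mulr_ge0// ltW.
rewrite -(@ler_pXn2r _ 2)// ?nnegrE ?mulr_ge0 ?sqrtr_ge0 ?addr_ge0//.
rewrite real_normK ?num_real//; apply: (le_trans D2).
rewrite !exprMn !sqr_sqrtr// ?(ltW G0)//.
have -> : 2 ^+ 2 * G * ((1 + e * q) ^+ 2 * L) = 4 * G * (1 + e * q) ^+ 2 * L by ring.
rewrite ler_wpM2r// ler_wpM2l ?mulr_ge0// ?(ltW G0)//.
by rewrite expr2 ler_peMr ?addr_ge0// lerDl.
Qed.
End eikonal_speed.

(** * Curves in the ambient space *)

Section ambient_curve.
Context {R : realType}.
Implicit Types (Q : 'M[R]_3) (y : ambient R) (c gam : R -> ambient R) (t u : R).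

(** Components in the orthonormal frame given by the rows of Q. *)
Definition sphere_comp Q (i : 'I_3) y : R := (y.1 *m Q^T) 0 i.
Definition circle_comp (j : 'I_2) y : R := y.2 0 j.

Lemma derive1_is_derive (V : normedModType R) (f : R -> V) t :
  derivable f t 1 -> is_derive t 1 f (derive1 f t).
Proof. by move=> /derivableP; rewrite derive1E. Qed.

Lemma C1_with_sphere_comp Q i gam : (forall u, derivable gam u 1) -> continuous (derive1 gam) ->
  C1_with setT (fun t => sphere_comp Q i (gam t)) (fun t => sphere_comp Q i (derive1 gam t)).
Proof.
move=> dg cg t _; split.
  by apply: is_derive_rV_coord; apply: is_derive_mulmx; apply: is_derive_fst;
    exact: derive1_is_derive.
have H j : {for t, continuous (fun t => (derive1 gam t).1 0 j)}.
  apply: (@continuous_comp _ _ _ (fun t => (derive1 gam t).1) (fun M : 'rV[R]_3 => M 0 j)).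
    apply: (@continuous_comp _ _ _ (derive1 gam) fst); first exact: cg.
    exact: cvg_fst.
  exact: coord_continuous.
have K j : {for t, continuous (fun t => (derive1 gam t).1 0 j * Q^T j i)}.
  exact: cvgM (H j) (cvg_cst _).
rewrite /sphere_comp (_ : (fun t => _) = (fun t => (derive1 gam t).1 0 0 * Q^T 0 i +
    (derive1 gam t).1 0 1 * Q^T 1 i + (derive1 gam t).1 0 2 * Q^T 2 i)).
  exact: cvgD (cvgD (K 0) (K 1)) (K 2).
apply/funext => s; rewrite mxE !big_ord_recr big_ord0/= add0r.
by congr (_ + _ + _); congr (_ * _); congr (_ _ _); exact/val_inj.
Qed.

Lemma C1_with_circle_comp j gam : (forall u, derivable gam u 1) -> continuous (derive1 gam) ->
  C1_with setT (fun t => circle_comp j (gam t)) (fun t => circle_comp j (derive1 gam t)).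
Proof.
move=> dg cg t _; split.
  by apply: is_derive_rV_coord; apply: is_derive_snd; exact: derive1_is_derive.
apply: (@continuous_comp _ _ _ (fun t => (derive1 gam t).2) (fun M : 'rV[R]_2 => M 0 j)).
  apply: (@continuous_comp _ _ _ (derive1 gam) snd); first exact: cg.
  exact: cvg_snd.
exact: coord_continuous.
Qed.

Lemma dot_sphere_comp Q (p p' : ambient R) : Q *m Q^T = 1%:M ->
  dot p.1 p'.1 = sphere_comp Q 0 p * sphere_comp Q 0 p'
    + sphere_comp Q 1 p * sphere_comp Q 1 p' + sphere_comp Q 2 p * sphere_comp Q 2 p'.
Proof.
by move=> OO; rewrite -(dot_mulmxT _ _ OO) [_ *m _]row3E [X in dot _ X]row3E dot_row3.
Qed.

Lemma dot_circle_comp (p p' : ambient R) : dot p.2 p'.2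
  = circle_comp 0 p * circle_comp 0 p' + circle_comp 1 p * circle_comp 1 p'.
Proof. by rewrite [p.2]row2E [p'.2]row2E dot_row2. Qed.

Lemma S2xS1_comp Q y : Q *m Q^T = 1%:M -> S2xS1 y ->
  sphere_comp Q 0 y ^+ 2 + sphere_comp Q 1 y ^+ 2 + sphere_comp Q 2 y ^+ 2 = 1 /\
    circle_comp 0 y ^+ 2 + circle_comp 1 y ^+ 2 = 1.
Proof. by move=> OO; rewrite /S2xS1/= (dot_sphere_comp _ _ OO) dot_circle_comp !expr2. Qed.

Lemma phi_bounds alpha k b chi Q (x : 'rV[R]_3) : 0 < alpha -> is_profile b -> is_cutoff chi ->
  1 / 2 <= phi alpha k b chi Q x <= 3 / 2.
Proof.
move=> a0 hb hc; rewrite /phi; case: ifP => _; first exact: phi_loc_bounds.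
by apply/andP; split; lra.
Qed.

(** Both phi^2 and phi^-2 are at least 1/4, so the speed dominates half of each
   ambient component of the velocity. *)
Lemma speed_ge_coord alpha k b chi Q y p : 0 < alpha -> is_profile b -> is_cutoff chi ->
  Q *m Q^T = 1%:M ->
  (forall i, `|sphere_comp Q i p| / 2 <= Num.sqrt (g_metric alpha k b chi Q y p p)) /\
  (forall j, `|circle_comp j p| / 2 <= Num.sqrt (g_metric alpha k b chi Q y p p)).
Proof.
move=> a0 hb hc OO; rewrite /g_metric (dot_sphere_comp p p OO) dot_circle_comp -!expr2.
set f := phi _ _ _ _ _ _.
have /andP[f1 f2] : 1 / 2 <= f <= 3 / 2 by exact: phi_bounds.
have fi : 1 / 4 <= f ^- 2.
  rewrite -[leLHS]invrK lef_pV2 ?posrE ?exprn_gt0 ?invr_gt0//; [|lra..].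
  by rewrite invf_div divr1; nra.
have ff : 1 / 4 <= f ^+ 2 by nra.
have X i := sqr_ge0 (sphere_comp Q i p); have W j := sqr_ge0 (circle_comp j p).
set LL := f ^- 2 * _ + _.
have half (x : R) : x ^+ 2 / 4 <= LL -> `|x| / 2 <= Num.sqrt LL.
  move=> H; rewrite -(ger0_norm (divr_ge0 (normr_ge0 x) (ler0n _ 2))) -sqrtr_sqr ler_wsqrtr//.
  by rewrite expr_div_n real_normK ?num_real//; lra.
have LX : (sphere_comp Q 0 p ^+ 2 + sphere_comp Q 1 p ^+ 2 + sphere_comp Q 2 p ^+ 2) / 4
  <= f ^- 2 * (sphere_comp Q 0 p ^+ 2 + sphere_comp Q 1 p ^+ 2 + sphere_comp Q 2 p ^+ 2).
  rewrite mulrC ler_wpM2r ?addr_ge0//; lra.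
have LW : (circle_comp 0 p ^+ 2 + circle_comp 1 p ^+ 2) / 4
  <= f ^+ 2 * (circle_comp 0 p ^+ 2 + circle_comp 1 p ^+ 2).
  rewrite mulrC ler_wpM2r ?addr_ge0//; lra.
have X0 := X 0; have X1 := X 1; have X2 := X 2; have W0 := W 0; have W1 := W 1.
split=> i; apply: half; rewrite /LL.
  have [->|->|->] : [\/ i = 0, i = 1 | i = 2].
    case: i => -[|[|[|//]]] ii; [apply: Or31|apply: Or32|apply: Or33]; exact/val_inj.
  - by lra.
  - by lra.
  - by lra.
have [->|->] : i = 0 \/ i = 1.
  by case: i => -[|[|//]] ii; [left|right]; exact/val_inj.
- by lra.
- by lra.
Qed.
End ambient_curve.

(** * Growth of coordinates and of the approximate distance *)

Section lower_bound.
Context {R : realType}.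
Implicit Types (Q : 'M[R]_3) (y : ambient R) (c gam : R -> ambient R) (t u : R).

(** The round metric in the coordinates arcsin x2 and arctan (x1 / x0): for a
   tangent vector p at x, the coordinate expression dr^2 + cos^2 r dth^2
   equals the Euclidean square norm. *)
Lemma sphere_speed (x0 x1 x2 p0 p1 p2 : R) : 0 < x0 ->
  x0 ^+ 2 + x1 ^+ 2 + x2 ^+ 2 = 1 -> x0 * p0 + x1 * p1 + x2 * p2 = 0 ->
  ((Num.sqrt (1 - x2 ^+ 2))^-1 * p2) ^+ 2 + (1 - x2 ^+ 2) *
    ((1 + (x1 * x0^-1) ^+ 2)^-1 * (x1 * (- x0 ^- 2 * p0) + x0^-1 * p1)) ^+ 2 =
  p0 ^+ 2 + p1 ^+ 2 + p2 ^+ 2.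
Proof.
move=> x00 n o.
have -> : 1 - x2 ^+ 2 = x0 ^+ 2 + x1 ^+ 2 by rewrite -n; ring.
set C := x0 ^+ 2 + x1 ^+ 2.
have C0 : 0 < C by rewrite ltr_pwDl ?exprn_gt0// sqr_ge0.
rewrite exprMn exprVn sqr_sqrtr ?(ltW C0)//.
have -> : (1 + (x1 * x0^-1) ^+ 2)^-1 * (x1 * (- x0 ^- 2 * p0) + x0^-1 * p1)
  = (x0 * p1 - x1 * p0) / C.
  by rewrite /C; field; rewrite -/C !gt_eqF.
have e2 : x2 * p2 = - (x0 * p0 + x1 * p1) by apply/eqP; rewrite -addr_eq0 addrC o.
apply: (mulfI (lt0r_neq0 C0)).
have -> : C * (C^-1 * p2 ^+ 2 + C * ((x0 * p1 - x1 * p0) / C) ^+ 2)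
  = p2 ^+ 2 + (x0 * p1 - x1 * p0) ^+ 2.
  by field; rewrite gt_eqF.
have -> : (x0 * p1 - x1 * p0) ^+ 2 = C * (p0 ^+ 2 + p1 ^+ 2) - (x0 * p0 + x1 * p1) ^+ 2.
  by rewrite /C; ring.
have -> : (x0 * p0 + x1 * p1) ^+ 2 = (x2 * p2) ^+ 2 by rewrite e2 sqrrN.
transitivity ((C + x2 ^+ 2) * p2 ^+ 2 + (C * (p0 ^+ 2 + p1 ^+ 2) - (x2 * p2) ^+ 2)); last by ring.
by rewrite /C n mul1r.
Qed.

Lemma circle_speed (w0 w1 p0 p1 : R) : 0 < w0 ->
  w0 ^+ 2 + w1 ^+ 2 = 1 -> w0 * p0 + w1 * p1 = 0 ->
  ((1 + (w1 * w0^-1) ^+ 2)^-1 * (w1 * (- w0 ^- 2 * p0) + w0^-1 * p1)) ^+ 2 = p0 ^+ 2 + p1 ^+ 2.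
Proof.
move=> w00 n o.
have -> : (1 + (w1 * w0^-1) ^+ 2)^-1 * (w1 * (- w0 ^- 2 * p0) + w0^-1 * p1)
  = (w0 * p1 - w1 * p0) / (w0 ^+ 2 + w1 ^+ 2).
  by field; rewrite n oner_neq0 gt_eqF.
rewrite n divr1 -[RHS]mul1r -n.
have -> : (w0 * p1 - w1 * p0) ^+ 2 = (w0 ^+ 2 + w1 ^+ 2) * (p0 ^+ 2 + p1 ^+ 2) - (w0 * p0
  + w1 * p1) ^+ 2.
  by ring.
by rewrite o expr0n/= subr0.
Qed.

(** Differentiating |x|^2 = 1 along a curve on the sphere shows that its velocity
   is tangent. *)
Lemma tangent_of_const (f : R -> R) (df a b u : R) : a < u < b ->
  is_derive u 1 f df -> (forall v, a < v < b -> f v = 1) -> df = 0.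
Proof.
move=> /andP[au ub] Df f1.
rewrite -(derive_val (is_derive := Df)).
have -> : 'D_1 f u = 'D_1 (cst 1 : R -> R) u.
  apply: near_eq_derive; near=> v; apply: f1.
  apply/andP; split; near: v; [exact: lt_nbhsr|exact: lt_nbhsl].
exact: derive_cst.
Unshelve. all: by end_near. Qed.

(** The chart coordinates of a point of the ambient space, defined without
   reference to the chart so that they can be differentiated along curves. *)
Definition r_coord Q y : R := asin (sphere_comp Q 2 y).
Definition th_coord Q y : R := atan (sphere_comp Q 1 y * (sphere_comp Q 0 y)^-1).
Definition z_coord y : R := atan (circle_comp 1 y * (circle_comp 0 y)^-1).

Section growth_eikonal.
Variables (alpha k : R) (b : R -> R) (chi : R * R -> R) (Q : 'M[R]_3).
Hypotheses (a01 : 0 < alpha < 1) (hb : is_profile b) (hc : is_cutoff chi) (OO : Q *m Q^T = 1%:M).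
Let g := g_metric alpha k b chi Q.

Definition speed c u : R := Num.sqrt (g (c u) (derive1 c u) (derive1 c u)).

(** The sign covers both directions of each component; these functions serve to
   show that a short curve from q stays near q. *)
Lemma growth_coord c s t : C1_on s t c ->
  (forall i (sg : bool), C1_growth (speed c) (fun u =>
    (-1) ^+ sg * sphere_comp Q i (c u) / 2) s t) /\
  (forall i (sg : bool), C1_growth (speed c) (fun u => (-1) ^+ sg * circle_comp i (c u) / 2) s t).
Proof.
move=> [gam [dg cg cgam]]; have /andP[a0 _] := a01.
have near_c u : s < u < t -> derive1 c u = derive1 gam u /\ c u = gam u.
  move=> /andP[su ut]; split; last by apply: cgam; rewrite in_itv/= !ltW.
  rewrite !derive1E; apply: near_eq_derive; near=> v; apply: cgam.
  by rewrite in_itv/=; apply/andP; split; apply: ltW; near: v; [exact: lt_nbhsr|exact: lt_nbhsl].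
have key (H : ambient R -> R) (sg : bool) :
    C1_with setT (fun u => H (gam u)) (fun u => H (derive1 gam u)) ->
    (forall y p, `|H p| / 2 <= Num.sqrt (g y p p)) ->
    C1_growth (speed c) (fun u => (-1) ^+ sg * H (c u) / 2) s t.
  move=> C1 Hs.
  exists (fun u => (-1) ^+ sg * H (gam u) / 2), (fun u => (-1) ^+ sg * H (derive1 gam u) / 2).
  have C2 := C1_withM (C1_withM (@C1_with_cst R setT ((-1) ^+ sg)) C1) (@C1_with_cst R setT 2^-1).
  have {}C2 : C1_with setT (fun u => (-1) ^+ sg * H (gam u) / 2) (fun u =>
    (-1) ^+ sg * H (derive1 gam u) / 2).
    by apply: (C1_with_eq C2) => u; rewrite /cst/=; ring.
  split.
  - by move=> u us; rewrite cgam.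
  - by move=> u _; have [] := C2 u I.
  - by move=> u _; have [] := C2 u I.
  - move=> u /near_c[E1 E2]; rewrite /speed E1 E2.
    apply: le_trans (Hs _ _); rewrite normrM normrM normrX normrN1 expr1n mul1r.
    by rewrite [`|2^-1|]ger0_norm.
split=> i sg.
- apply: (key _ sg (C1_with_sphere_comp Q i dg cg)) => y p.
  by have [H _] := speed_ge_coord k y p a0 hb hc OO; exact: H.
- apply: (key _ sg (C1_with_circle_comp i dg cg)) => y p.
  by have [_ H] := speed_ge_coord k y p a0 hb hc OO; exact: H.
Unshelve. all: by end_near. Qed.

(** This is [eikonal_speed] along a curve that stays in the hemispheres where the
   coordinates are defined. The constant m bounds the factor 1 + e q. *)
Lemma growth_eikonal e : 0 < e -> exists e1 d : R, [/\ 0 < e1, 0 < d &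
  forall (m : R) c s t eta sg, 0 < m -> 0 < eta -> 0 < sg <= e1 * eta ^+ 2 ->
  C1_on s t c -> (forall u, s <= u <= t -> S2xS1 (c u)) ->
  (forall u, s <= u <= t -> [/\ 0 < sphere_comp Q 0 (c u), 0 < circle_comp 0 (c u) &
     let q := r_coord Q (c u) ^+ 2 + th_coord Q (c u) ^+ 2 + z_coord (c u) ^+ 2 + eta ^+ 2 in
     q < d /\ 1 + e * q <= m]) ->
  C1_growth (speed c) (fun u => Num.sqrt (Gsmooth k sg (r_coord Q (c u)) (th_coord Q (c u))
    (z_coord (c u)) + eta ^+ 2) / m) s t].
Proof.
move=> e0; have [e1 [d [e10 d0 H]]] := eikonal_speed k a01 hb hc e0.
exists e1, d; split => // m c s t eta sg m0 eta0 sge [gam [dg cg cgam]] Mc Hc.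
have /andP[sg0 _] := sge.
have near_c u : s < u < t -> derive1 c u = derive1 gam u /\ c u = gam u.
  move=> /andP[su ut]; split; last by apply: cgam; rewrite in_itv/= !ltW.
  rewrite !derive1E; apply: near_eq_derive; near=> v; apply: cgam.
  by rewrite in_itv/=; apply/andP; split; apply: ltW; near: v; [exact: lt_nbhsr|exact: lt_nbhsl].
pose D : set R := [set u | s <= u <= t].
have cE u : D u -> c u = gam u by move=> Du; apply: cgam; rewrite in_itv.
have sub (f f' : R -> R) : C1_with setT f f' -> C1_with D f f' by move=> C u _; exact: C.
have CX i := sub _ _ (C1_with_sphere_comp Q i dg cg);
  have CW i := sub _ _ (C1_with_circle_comp i dg cg).
have X0 u : D u -> 0 < sphere_comp Q 0 (gam u) by move=> Du; rewrite -cE//; have [] := Hc u Du.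
have W0 u : D u -> 0 < circle_comp 0 (gam u) by move=> Du; rewrite -cE//; have [] := Hc u Du.
have SX u : D u -> sphere_comp Q 0 (gam u) ^+ 2 + sphere_comp Q 1 (gam u) ^+ 2
  + sphere_comp Q 2 (gam u) ^+ 2 = 1.
  by move=> Du; have [] := S2xS1_comp OO (Mc u Du); rewrite cE.
have SW u : D u -> circle_comp 0 (gam u) ^+ 2 + circle_comp 1 (gam u) ^+ 2 = 1.
  by move=> Du; have [] := S2xS1_comp OO (Mc u Du); rewrite cE.
have X2 u : D u -> -1 < sphere_comp Q 2 (gam u) < 1.
  move=> Du; have := SX u Du; have := X0 u Du.
  set x0 := sphere_comp Q 0 _; set x1 := sphere_comp Q 1 _; set x2 := sphere_comp Q 2 _ => x00 n.
  have : x2 ^+ 2 < 1 ^+ 2.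
    have : 0 < x0 ^+ 2 by rewrite exprn_gt0.
    have := sqr_ge0 x1; rewrite expr1n; lra.
  by rewrite -ltr_norml -[x2 ^+ 2]real_normK ?num_real// ltr_pXn2r// nnegrE.
have Cr := C1_with_asin (CX 2) X2.
have Cth := C1_with_atan (C1_withM (CX 1) (C1_withV (CX 0) (fun u Du => lt0r_neq0 (X0 u Du)))).
have Cz := C1_with_atan (C1_withM (CW 1) (C1_withV (CW 0) (fun u Du => lt0r_neq0 (W0 u Du)))).
have CG := C1_withD (C1_with_Gsmooth k sg0 Cr Cth Cz) (@C1_with_cst R D (eta ^+ 2)).
have pos u : D u -> 0 < Gsmooth k sg (r_coord Q (gam u)) (th_coord Q (gam u)) (z_coord (gam u))
  + eta ^+ 2.
  move=> Du; have [_ _ [qd _]] := Hc u Du; rewrite cE// in qd.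
  by have [] := H _ _ _ _ _ 0 0 0 qd eta0 sge.
have CF := C1_withM (C1_with_sqrt CG pos) (@C1_with_cst R D m^-1).
eexists; eexists; split.
- by move=> u; rewrite in_itv/= => us; rewrite cE//.
- by move=> u Du; have [H1 _] := CF u Du; exact: H1.
- by move=> u Du; have [_ H1] := CF u Du; exact: H1.
move=> u us; have Du : D u by case/andP: us => *; rewrite /D/= !ltW.
have [dE uE] := near_c _ us.
rewrite /cst/= mulr0 add0r -/(r_coord Q (gam u)) -/(th_coord Q (gam u)) -/(z_coord (gam u)).
have [_ _ [qd qm]] := Hc u Du; rewrite uE in qd qm.
set r' := (Num.sqrt _)^-1 * _; set th' := (1 + (sphere_comp Q 1 _ * _) ^+ 2)^-1 * _.
set z' := (1 + (circle_comp 1 _ * _) ^+ 2)^-1 * _.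
have [G0] := H _ _ _ _ _ r' th' z' qd eta0 sge.
set DD := _ * r' + _ * th' + _ * z'; set G := Gsmooth _ _ _ _ _ + _ in G0 *.
set L := _ * (r' ^+ 2 + _) + _ => HD.
have sgam : speed c u = Num.sqrt L.
  have x00 := X0 u Du; have w00 := W0 u Du.
  have TX : sphere_comp Q 0 (gam u) * sphere_comp Q 0 (derive1 gam u)
    + sphere_comp Q 1 (gam u) * sphere_comp Q 1 (derive1 gam u)
     + sphere_comp Q 2 (gam u) * sphere_comp Q 2 (derive1 gam u) = 0.
    have C := C1_withD (C1_withD (C1_withM (CX 0) (CX 0)) (C1_withM (CX 1) (CX 1))) (C1_withM
      (CX 2) (CX 2)).
    have [DC _] := C u Du.
    have T := tangent_of_const us DC; apply: (mulfI (_ : 2 != 0 :> R)) => //.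
    rewrite mulr0 -[RHS]T; first by ring.
    by move=> v /andP[sv vt]; rewrite -!expr2 SX// /D/= !ltW.
  have TW : circle_comp 0 (gam u) * circle_comp 0 (derive1 gam u)
    + circle_comp 1 (gam u) * circle_comp 1 (derive1 gam u) = 0.
    have C := C1_withD (C1_withM (CW 0) (CW 0)) (C1_withM (CW 1) (CW 1)).
    have [DC _] := C u Du.
    have T := tangent_of_const us DC; apply: (mulfI (_ : 2 != 0 :> R)) => //.
    rewrite mulr0 -[RHS]T; first by ring.
    by move=> v /andP[sv vt]; rewrite -!expr2 SW// /D/= !ltW.
  have x2b := X2 u Du.
  have c2 : cos (r_coord Q (gam u)) ^+ 2 = 1 - sphere_comp Q 2 (gam u) ^+ 2.
    rewrite cos_asin; last by case/andP: x2b => *; rewrite !ltW.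
    rewrite sqr_sqrtr//.
    have -> : 1 - sphere_comp Q 2 (gam u) ^+ 2
      = sphere_comp Q 0 (gam u) ^+ 2 + sphere_comp Q 1 (gam u) ^+ 2.
      by rewrite -(SX u Du); ring.
    by rewrite addr_ge0 ?sqr_ge0.
  rewrite /speed dE uE /g /g_metric; congr Num.sqrt.
  have -> : phi alpha k b chi Q (gam u).1 = phi_loc alpha k b chi (r_coord Q (gam u)) (th_coord
    Q (gam u)).
    by rewrite /phi -/(sphere_comp Q 0 (gam u)) x00.
  rewrite (dot_sphere_comp _ _ OO) dot_circle_comp -!expr2 /L c2; congr (_ * _ + _ * _).
    by rewrite (sphere_speed x00 (SX u Du) TX).
  by rewrite (circle_speed w00 (SW u Du) TW).
rewrite sgam addr0 normrM (gtr0_norm (_ : 0 < m^-1)) ?invr_gt0// ler_pdivrMl//.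
have sG0 : 0 < Num.sqrt G by rewrite sqrtr_gt0.
rewrite normrM normfV (gtr0_norm (_ : 0 < 2 * Num.sqrt G)) ?mulr_gt0// ler_pdivrMl ?mulr_gt0//.
apply: (le_trans HD); rewrite ler_wpM2l ?mulr_ge0 ?sqrtr_ge0//.
by rewrite ler_wpM2r ?sqrtr_ge0.
Unshelve. all: by end_near. Qed.
End growth_eikonal.
End lower_bound.

(** * Curves starting at the base point *)

Section dist_lower.
Context {R : realType}.
Implicit Types (Q : 'M[R]_3) (y : ambient R) (c gam : R -> ambient R) (t u : R).

Lemma sphere_comp_chart Q r th z : Q *m Q^T = 1%:M ->
  [/\ sphere_comp Q 0 (chart Q (r, th, z)) = cos r * cos th,
      sphere_comp Q 1 (chart Q (r, th, z)) = cos r * sin th &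
      sphere_comp Q 2 (chart Q (r, th, z)) = sin r].
Proof. by move=> OO; rewrite /sphere_comp /= /sphere_chart -!mulmxA OO mulmx1 !mxE. Qed.

Lemma circle_comp_chart Q r th z : circle_comp 0 (chart Q (r, th, z)) = cos z /\
  circle_comp 1 (chart Q (r, th, z)) = sin z.
Proof. by rewrite /circle_comp /= /circle_chart !mxE. Qed.

Lemma cos_gt0_lt_pihalf (x : R) : `|x| < pi -> 0 < cos x -> `|x| < pi / 2.
Proof.
move=> xp c0; rewrite ltNge; apply/negP => px.
have : cos `|x| = cos x by case: (ger0P x) => // _; rewrite cosN.
move=> cE; move: c0; rewrite -cE -[`|x|](subrK (pi / 2)) cosDpihalf oppr_gt0 ltNge.
rewrite sin_ge0_pi//; apply/andP; split; first by rewrite subr_ge0.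
by have := pi_gt0 R; lra.
Qed.

Lemma atan_le_id (x : R) : `|atan x| <= `|x|.
Proof.
wlog x0 : x / 0 <= x => [H|].
  by have [/H//|/ltW x0] := leP 0 x; rewrite -(normrN x) -(normrN (atan x)) -atanN H// oppr_ge0.
have [c _] := @MVT_segment R atan (fun x => (1 + x ^+ 2)^-1) 0 x x0
  (fun x _ => is_derive1_atan x) (continuous_subspaceT (@continuous_atan R)).
rewrite atan0 !subr0 => ->; rewrite normrM ler_piMl//.
have p : 0 < 1 + c ^+ 2 by rewrite ltr_pwDl// sqr_ge0.
by rewrite normfV gtr0_norm// invf_le1// lerDl sqr_ge0.
Qed.

Lemma asin_le (x : R) : `|x| <= 1 / 2 -> `|asin x| <= 2 * `|x|.
Proof.
have a0 : asin 0 = 0 :> R.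
  by rewrite -[X in asin X]sin0 sinK// in_itv/= oppr_le0 andbb divr_ge0// pi_ge0.
have asinN (z : R) : -1 <= z <= 1 -> asin (- z) = - asin z.
  move=> z1; rewrite -[X in asin (- X)]asinK// -sinN sinK// in_itv/=.
  have := asin_geNpi2 z1; have := asin_lepi2 z1; lra.
wlog x0 : x / 0 <= x => [H x1|].
  have [x0|/ltW x0] := leP 0 x; first exact: H.
  rewrite -(normrN x) -(normrN (asin x)) -asinN; last by move/ler_normlP: x1 => []; lra.
  by apply: H; rewrite ?oppr_ge0 ?normrN.
rewrite (ger0_norm x0) => x1.
have b (v : R) : v \in `[0, x] -> -1 < v < 1 by rewrite in_itv/=; lra.
have cont : {within `[0, x], continuous (@asin R)}.
  by apply: continuous_in_subspaceT => v; rewrite inE/= => /b /continuous_asin.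
have [c] := @MVT_segment R asin (fun x => (Num.sqrt (1 - x ^+ 2))^-1) 0 x x0
  (fun v vx => is_derive1_asin (b v (subset_itv_oo_cc vx))) cont.
rewrite in_itv/= a0 !subr0 => /andP[c0 cx] ->.
rewrite normrM (ger0_norm x0) ler_wpM2r//.
have s : 1 / 2 <= Num.sqrt (1 - c ^+ 2).
  rewrite -[leLHS]ger0_norm// -sqrtr_sqr ler_wsqrtr//; nra.
have s0 : 0 < Num.sqrt (1 - c ^+ 2) by lra.
by rewrite normfV gtr0_norm// -[leLHS]mul1r ler_pdivrMr//; lra.
Qed.

(** Let eta tend to 0. *)
Lemma le_sqr_of_perturbation (x a B t : R) : 0 <= a -> 0 <= B -> 0 < t ->
  (forall eta, 0 < eta <= t -> x <= (a + eta) ^+ 2 + B * eta ^+ 2) -> x <= a ^+ 2.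
Proof.
move=> a0 B0 t0 H; apply/ler_addgt0Pr => e e0.
have K0 : 0 < 2 * a + t + B * t + 1 by rewrite ltr_wpDl// !addr_ge0 ?mulr_ge0// ltW.
set eta := Num.min t (e / (2 * a + t + B * t + 1)).
have eta0 : 0 < eta by rewrite lt_min t0 divr_gt0.
have etat : eta <= t by rewrite ge_min lexx.
have etae : eta * (2 * a + t + B * t + 1) <= e by rewrite -ler_pdivlMr// ge_min lexx orbT.
have := H eta; rewrite eta0 etat => /(_ isT) h; apply: (le_trans h).
have h1 : eta * eta <= eta * t by rewrite ler_pM2l.
have h2 : B * (eta * eta) <= B * (eta * t) by rewrite ler_wpM2l.
clear -etae h1 h2 eta0; rewrite sqrrD -mulr_natl !expr2.
nra.
Qed.

Variables (alpha k : R) (b : R -> R) (chi : R * R -> R) (Q : 'M[R]_3).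
Hypotheses (a01 : 0 < alpha < 1) (hb : is_profile b) (hc : is_cutoff chi) (OO : Q *m Q^T = 1%:M).
Let g := g_metric alpha k b chi Q.

(** A function whose growth is bounded by the speed varies by less than the length. *)
Lemma growth_length (F : R -> R) c (s : seq R) (l : R) : itv_partition 0 1 s ->
  (forall i, (i < size s)%N -> C1_growth (speed alpha k b chi Q c) F (0 :: s)`_i s`_i) ->
  (curve_length g c < l%:E)%E -> forall u, 0 <= u <= 1 -> F u - F 0 < l.
Proof.
move=> ps HF cl u u01; rewrite -lte_fin; apply: le_lt_trans cl.
apply: (le_trans (growth_partition ps (fun u => sqrtr_ge0 _) HF u01)).
apply: ge0_integral_mono => //; exact: subset_itv_oo_cc.
Qed.

(** Apply [growth_length] to plus and minus half of each ambient component. *)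
Lemma curve_near_q c t : piecewise_C1 c -> c 0 = chart Q (0, 0, 0) ->
  (curve_length g c < t%:E)%E -> forall u, 0 <= u <= 1 ->
  [/\ 1 - 2 * t <= sphere_comp Q 0 (c u), `|sphere_comp Q 1 (c u)|
    <= 2 * t, `|sphere_comp Q 2 (c u)| <= 2 * t,
      1 - 2 * t <= circle_comp 0 (c u) & `|circle_comp 1 (c u)| <= 2 * t].
Proof.
move=> [s ps C1] c0 cl u u01.
have GX i sg := growth_length ps (fun j js => (growth_coord k a01 hb hc OO (C1 j js)).1 i sg) cl
  u01.
have GW i sg := growth_length ps (fun j js => (growth_coord k a01 hb hc OO (C1 j js)).2 i sg) cl
  u01.
have [X0 X1 X2] := sphere_comp_chart 0 0 0 OO; have [W0 W1] := circle_comp_chart Q 0 0 0.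
rewrite ?(cos0, sin0, mul1r, mulr0) in X0 X1 X2 W0 W1.
have X0t := GX 0 true; have X0f := GX 0 false; have X1t := GX 1 true; have X1f := GX 1 false.
have X2t := GX 2 true; have X2f := GX 2 false; have W0t := GW 0 true; have W0f := GW 0 false.
have W1t := GW 1 true; have W1f := GW 1 false.
rewrite /= ?(expr1, expr0) c0 X0 in X0t X0f.
rewrite /= ?(expr1, expr0) c0 X1 in X1t X1f.
rewrite /= ?(expr1, expr0) c0 X2 in X2t X2f.
rewrite /= ?(expr1, expr0) c0 W0 in W0t W0f.
rewrite /= ?(expr1, expr0) c0 W1 in W1t W1f.
split; rewrite ?ler_norml; try (apply/andP; split); lra.
Qed.

(** Quantitative inverse of the chart near q; 48 is 3 times the square of 4. *)
Lemma coord_small y t : 0 < t <= 1 / 8 ->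
  1 - 2 * t <= sphere_comp Q 0 y -> `|sphere_comp Q 1 y| <= 2 * t ->
    `|sphere_comp Q 2 y| <= 2 * t ->
  1 - 2 * t <= circle_comp 0 y -> `|circle_comp 1 y| <= 2 * t ->
  r_coord Q y ^+ 2 + th_coord Q y ^+ 2 + z_coord y ^+ 2 <= 48 * t ^+ 2.
Proof.
move=> /andP[t0 t8] x0 x1 x2 w0 w1.
have sq (x : R) : `|x| <= 4 * t -> x ^+ 2 <= 16 * t ^+ 2.
  move=> h; rewrite -[x ^+ 2]real_normK ?num_real//.
  have -> : 16 * t ^+ 2 = (4 * t) ^+ 2 by ring.
  by rewrite lerXn2r ?nnegrE ?mulr_ge0// ltW.
have quot (x y' : R) : `|x| <= 2 * t -> 1 - 2 * t <= y' -> `|x * y'^-1| <= 4 * t.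
  move=> hx hy; have y0 : 0 < y' by lra.
  rewrite normrM normfV (gtr0_norm y0) ler_pdivrMr//; nra.
have r1 : r_coord Q y ^+ 2 <= 16 * t ^+ 2.
  apply/sq/(le_trans (asin_le _)); lra.
have t1 : th_coord Q y ^+ 2 <= 16 * t ^+ 2.
  by apply/sq/(le_trans (atan_le_id _))/quot.
have z1 : z_coord y ^+ 2 <= 16 * t ^+ 2.
  by apply/sq/(le_trans (atan_le_id _))/quot.
lra.
Qed.
End dist_lower.

(** * Lower bound for the distance *)

Section dist_lower_main.
Context {R : realType}.
Implicit Types (alpha k e : R) (b : R -> R) (chi : R * R -> R) (Q : 'M[R]_3).

(** Positivity of the first components confines th and z to (-pi/2, pi/2), where
   the coordinate functions invert the chart. *)
Lemma coord_chart Q (r th z : R) : Q *m Q^T = 1%:M -> chart_dom (r, th, z) ->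
  0 < sphere_comp Q 0 (chart Q (r, th, z)) -> 0 < circle_comp 0 (chart Q (r, th, z)) ->
  [/\ `|r| < pi / 2, `|th| < pi / 2, r_coord Q (chart Q (r, th, z)) = r,
      th_coord Q (chart Q (r, th, z)) = th & z_coord (chart Q (r, th, z)) = z].
Proof.
move=> OO [[]] /=; rewrite !in_itv/= => hr ht hz.
have [E0 E1 E2] := sphere_comp_chart r th z OO; have [F0 F1] := circle_comp_chart Q r th z.
rewrite /r_coord /th_coord /z_coord E0 E1 E2 F0 F1.
have cr : 0 < cos r by exact: cos_gt0_pihalf.
rewrite (pmulr_rgt0 _ cr) => ct cz.
have ht2 : `|th| < pi / 2 by apply: cos_gt0_lt_pihalf => //; rewrite ltr_norml.
have hz2 : `|z| < pi / 2 by apply: cos_gt0_lt_pihalf => //; rewrite ltr_norml.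
split => //; first by rewrite ltr_norml.
- by rewrite sinK// in_itv/=; case/andP: hr => *; rewrite !ltW.
- rewrite invfM mulrACA divff ?gt_eqF// mul1r -[sin th / _]/(tan th) tanK// in_itv/= -ltr_norml//.
- by rewrite -[sin z / _]/(tan z) tanK// in_itv/= -ltr_norml.
Qed.

(** A curve of length less than t stays within distance O(t) of q, so that
   sqrt(G + eta^2) / (1 + e t^2) varies by less than t along it. At q its
   value is eta / (1 + e t^2); then eta tends to 0. *)
Lemma dist_lower alpha k b chi Q (e : R) :
  0 < alpha < 1 -> is_profile b -> is_cutoff chi -> Q *m Q^T = 1%:M -> 0 < e ->
    exists2 t1 : R, 0 < t1 & forall t r th z : R,
  0 < t < t1 -> chart_dom (r, th, z) ->
  (rdist S2xS1 (g_metric alpha k b chi Q) (chart Q (0, 0, 0)%R) (chart Q (r, th, z)) < t%:E)%E ->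
  [/\ `|r| < pi / 2, `|th| < pi / 2, r ^+ 2 + th ^+ 2 + z ^+ 2 <= 48 * t ^+ 2 &
      Gmodel k r th z <= (t * (1 + e * t ^+ 2)) ^+ 2].
Proof.
(* Along the curve S + eta^2 <= 49 t^2, as S <= 48 t^2 and eta <= t. *)
move=> a01 hb hc OO e0; set e' : R := e / 49; have e'0 : 0 < e' by rewrite divr_gt0.
have [e1 [d [e10 d0 H]]] := growth_eikonal k a01 hb hc OO e'0.
set t1 : R := Num.min (1 / 8) (d / 49).
have t10 : 0 < t1 by rewrite lt_min !divr_gt0.
exists t1 => // t r th z /andP[t0]; rewrite lt_min => /andP[t8 td] Du.
move=> /ereal_inf_lt[_ [c [cC1 cM c0 c1] <-] cl].
have t2d : 49 * t ^+ 2 < d.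
  have : t ^+ 2 <= t by rewrite expr2 ler_piMl// ltW//; lra.
  lra.
have near u (u01 : 0 <= u <= 1) := curve_near_q a01 hb hc OO cC1 c0 cl u01.
have t8' : 0 < t <= 1 / 8 by rewrite t0 ltW.
have small u : 0 <= u <= 1 -> r_coord Q (c u) ^+ 2 + th_coord Q (c u) ^+ 2
  + z_coord (c u) ^+ 2 <= 48 * t ^+ 2.
  by move=> /near[*]; exact: coord_small.
have pos u : 0 <= u <= 1 -> 0 < sphere_comp Q 0 (c u) /\ 0 < circle_comp 0 (c u).
  by move=> /near[*]; split; lra.
have u1 : (0 : R) <= 1 <= (1 : R) by apply/andP; split; lra.
have u0 : (0 : R) <= 0 <= (1 : R) by apply/andP; split; lra.
have [] := pos 1 u1; rewrite c1 => X1 W1.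
have [hr ht Er Et Ez] := coord_chart OO Du X1 W1.
have S1 : r ^+ 2 + th ^+ 2 + z ^+ 2 <= 48 * t ^+ 2.
  by have := small 1 u1; rewrite c1 Er Et Ez.
split => //.
have D0 : chart_dom (0, 0, 0 : R).
  by split; [split|] => /=; rewrite in_itv/= oppr_lt0 andbb ?divr_gt0 ?pi_gt0.
have [] := pos 0 u0; rewrite c0 => X0 W0.
have [_ _ Er0 Et0 Ez0] := coord_chart OO D0 X0 W0.
have t20 : 0 < t ^+ 2 by rewrite exprn_gt0.
set m : R := 1 + e * t ^+ 2.
have m0 : 0 < m by rewrite ltr_wpDr// mulr_ge0// ltW.
apply: (@le_sqr_of_perturbation _ _ _ (2 / 3 * `|k| * e1 * (48 * t ^+ 2)) t) => //.
- by rewrite mulr_ge0// ltW.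
- by rewrite !mulr_ge0// ltW.
move=> eta /andP[eta0 etat].
have eta2 : eta ^+ 2 <= t ^+ 2 by rewrite lerXn2r// nnegrE ltW.
have eta20 : 0 < eta ^+ 2 by rewrite exprn_gt0.
set sg := e1 * eta ^+ 2.
have sg0 : 0 < sg by rewrite mulr_gt0.
have [s ps C1] := cC1.
have sub01 i u : (i < size s)%N -> (0 :: s)`_i <= u <= s`_i -> 0 <= u <= 1.
  move=> isz /andP[u0' u1'].
  have A := itv_partition_nth_ge (ltnW (isz : (i < size s)%N) : (i < (size s).+1)%N) ps.
  have B := itv_partition_nth_le (isz : (i.+1 < (size s).+1)%N) ps.
  apply/andP; split.
    apply: le_trans u0'; rewrite (set_nth_default 1)//= ltnS ltnW//.
  apply: (le_trans u1'); rewrite (set_nth_default 1)//.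
(* growth_eikonal on each piece of the curve, with m = 1 + e t^2. *)
have GG i (isz : (i < size s)%N) : C1_growth (speed alpha k b chi Q c)
    (fun u => Num.sqrt (Gsmooth k sg (r_coord Q (c u)) (th_coord Q (c u)) (z_coord (c u))
      + eta ^+ 2) / m) (0 :: s)`_i s`_i.
  apply: (H) => //.
  - by rewrite sg0 lexx.
  - exact: C1.
  - by move=> u /(sub01 _ _ isz) u01; apply: cM; rewrite in_itv.
  - move=> u /(sub01 _ _ isz) u01; have [] := pos u u01; split => //.
    have Su := small u u01; set Sv := _ + _ + _ in Su *.
    have Sq : Sv + eta ^+ 2 <= 49 * t ^+ 2 by clear -Su eta2; lra.
    split; first exact: le_lt_trans t2d.
    rewrite /m lerD2l.
    have -> : e * t ^+ 2 = e' * (49 * t ^+ 2) by rewrite /e'; field.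
    by rewrite ler_wpM2l// ltW.
have := growth_length ps GG cl u1.
rewrite c1 c0 Er Et Ez Er0 Et0 Ez0.
have -> : Gsmooth k sg 0 0 0 = 0 by rewrite /Gsmooth; ring.
rewrite add0r sqrtr_sqr (gtr0_norm eta0) -mulrBl ltr_pdivrMr// ltrBlDr => B.
have B2 : Gsmooth k sg r th z + eta ^+ 2 <= (t * m + eta) ^+ 2.
  have tm0 : 0 <= t * m + eta by rewrite addr_ge0 ?mulr_ge0// ltW.
  have [neg|pos'] := leP (Gsmooth k sg r th z + eta ^+ 2) 0;
    first by rewrite (le_trans neg)// sqr_ge0.
  rewrite -[leLHS]sqr_sqrtr ?(ltW pos')// lerXn2r ?nnegrE ?sqrtr_ge0//; exact: ltW.
set h := `|r * th|; set A := smooth_abs sg (r * th).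
have h0 : 0 <= h by exact: normr_ge0.
have hA : h <= A.
  rewrite /h -sqrtr_sqr ler_wsqrtr// lerDl sqr_ge0//.
have Ah : A <= h + sg.
  rewrite -(@ler_pXn2r _ 2)// ?nnegrE ?sqrtr_ge0 ?addr_ge0// ?(ltW sg0)//.
  rewrite sqr_sqrtr ?addr_ge0 ?sqr_ge0// -[X in X + _ <= _]real_normK ?num_real// -/h.
  have := mulr_ge0 h0 (ltW sg0); rewrite sqrrD; clear; lra.
set M := r ^+ 2 + th ^+ 2 - z ^+ 2.
have r0 := sqr_ge0 r; have t0' := sqr_ge0 th; have z0 := sqr_ge0 z.
have MS : `|M| <= 48 * t ^+ 2 by clear -S1 r0 t0' z0; rewrite /M ler_norml; apply/andP; split; lra.
have GE : Gmodel k r th z = Gsmooth k sg r th z + 2 / 3 * (k * ((A - h) * M)).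
  by rewrite /Gmodel /Gsmooth -/A -/h -/M; field.
have E : 2 / 3 * (k * ((A - h) * M)) <= 2 / 3 * `|k| * e1 * (48 * t ^+ 2) * eta ^+ 2.
  have -> : 2 / 3 * `|k| * e1 * (48 * t ^+ 2) * eta ^+ 2 = 2 / 3 * (`|k| * (sg * (48 * t ^+ 2))).
    by rewrite /sg; ring.
  rewrite ler_wpM2l//; apply: (le_trans (ler_norm _)); rewrite !normrM ler_wpM2l//.
  by apply: ler_pM => //; rewrite ger0_norm ?subr_ge0// lerBlDl.
rewrite GE; clear -B2 E eta20; lra.
Qed.
End dist_lower_main.

(** * The model density *)

Section model.
Context {R : realType}.
Implicit Types (k T r th z m n : R).

(** G = r^2 + th^2 - Gdefect + z^2 (1 + (2 k / 3) |r th|), by [Gmodel_Gplane]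
   below; [Gplane] is the part of G that does not involve z. *)
Definition Gdefect k r th : R :=
  (r * th) ^+ 2 / 3 + 2 * k / 3 * `|r * th| * (r ^+ 2 + th ^+ 2).
Definition Gplane k r th : R := r ^+ 2 + th ^+ 2 - Gdefect k r th.
(** Homogeneous of degree 0, hence constant on the rays th = m r. Its value is
   the one for which [weight_model] and cos r / phi have the same expansion
   up to o(r^2 + th^2), see [weight_approx]. *)
Definition shape_factor r th : R :=
  (th ^+ 2 / 6 - r ^+ 2 / 2) * r ^+ 2 * ((r ^+ 2 + th ^+ 2)^-1) ^+ 2.
(** On a ray th = m r of the plane, the first factor times r is the derivative
   of Gplane / (2 (1 + m^2)), and the second one is affine in Gplane. *)
Definition weight_plane k r th : R :=
  (1 - 2 * Gdefect k r th * (r ^+ 2 + th ^+ 2)^-1) * (1 + Gplane k r th * shape_factor r th).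
(** The square root cancels the length of the z-slices of {G < T}, see
   [integral_density_model_z]. *)
Definition weight_model k r th : R := Num.sqrt (1 + 2 * k / 3 * `|r * th|) * weight_plane k r th.
(** For r^2 + th^2 below this bound the corrections in G are small relative to
   its main part. *)
Definition model_radius k : R := 1 / (4 * (1 + `|k|)).

Lemma Gmodel_Gplane k r th z :
  Gmodel k r th z = Gplane k r th + z ^+ 2 * (1 + 2 * k / 3 * `|r * th|).
Proof. by rewrite /Gmodel /Gplane /Gdefect; ring. Qed.

Lemma model_radius_gt0 k : 0 < model_radius k.
Proof. by rewrite divr_gt0// mulr_gt0// ltr_pwDl. Qed.

Lemma model_radius_le k : model_radius k <= 1 / 4 /\ (1 + `|k|) * model_radius k = 1 / 4.
Proof.
have k0 := normr_ge0 k; have k1 : 0 < 1 + `|k| by rewrite ltr_pwDl.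
split; last by rewrite /model_radius; field; rewrite gt_eqF.
rewrite /model_radius ler_pdivrMr ?mulr_gt0//; lra.
Qed.

Lemma Gdefect_le k r th : `|Gdefect k r th| <= (1 + `|k|) * (r ^+ 2 + th ^+ 2) ^+ 2.
Proof.
have r0 := sqr_ge0 r; have t0 := sqr_ge0 th; have k0 := normr_ge0 k.
have h0 := normr_ge0 (r * th).
have hN := norm_mul_le_sqr r th.
set N : R := r ^+ 2 + th ^+ 2 in hN *; have N0 : 0 <= N by rewrite addr_ge0.
apply: (le_trans (ler_normD _ _)).
have h1 : `|(r * th) ^+ 2 / 3| <= N ^+ 2 / 3.
  rewrite ger0_norm ?divr_ge0 ?sqr_ge0// ler_pM2r// -[leLHS]real_normK ?num_real//.
  by rewrite lerXn2r ?nnegrE.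
have h2 : `|2 * k / 3 * `|r * th| * N| <= 2 / 3 * `|k| * N ^+ 2.
  have -> : 2 * k / 3 * `|r * th| * N = 2 / 3 * (k * (`|r * th| * N)) by field.
  rewrite (normrM (2 / 3)) (ger0_norm (_ : 0 <= 2 / 3))// -mulrA ler_wpM2l// normrM ler_wpM2l//.
  by rewrite ger0_norm ?mulr_ge0// expr2 ler_wpM2r.
have := mulr_ge0 k0 (sqr_ge0 N); have := sqr_ge0 N; lra.
Qed.

Lemma shape_factor_le r th : `|shape_factor r th| <= 1 / 2.
Proof.
have r0 := sqr_ge0 r; have t0 := sqr_ge0 th; rewrite /shape_factor.
set N : R := r ^+ 2 + th ^+ 2; have N0 : 0 <= N by rewrite addr_ge0.
have [N1|N1] := eqVneq N 0; first by rewrite N1 invr0 expr0n/= mulr0 normr0.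
have Np : 0 < N by rewrite lt_neqAle eq_sym N1.
rewrite normrM exprVn normfV ler_pdivrMr ?normr_gt0 ?expf_neq0// normrM.
rewrite (ger0_norm (sqr_ge0 N)) (ger0_norm r0).
have -> : 1 / 2 * N ^+ 2 = (1 / 2 * N) * N by ring.
apply: ler_pM => //; last by rewrite /N; lra.
by rewrite ler_norml; apply/andP; split; rewrite /N; lra.
Qed.

Lemma model_bounds k r th : r ^+ 2 + th ^+ 2 < model_radius k ->
  [/\ `|Gdefect k r th| <= (r ^+ 2 + th ^+ 2) / 4,
      3 / 4 * (r ^+ 2 + th ^+ 2) <= Gplane k r th,
      1 / 2 <= 1 + 2 * k / 3 * `|r * th| & 0 <= weight_plane k r th].
Proof.
have r0 := sqr_ge0 r; have t0 := sqr_ge0 th; have k0 := normr_ge0 k.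
have hN := norm_mul_le_sqr r th.
have HP := Gdefect_le k r th; have Hg := shape_factor_le r th; rewrite /weight_plane /Gplane.
set N : R := r ^+ 2 + th ^+ 2 in HP hN *; have N0 : 0 <= N by rewrite addr_ge0.
move=> Nd; have [d1 d2] := model_radius_le k.
have kN : (1 + `|k|) * N <= 1 / 4.
  by rewrite -d2 ler_wpM2l ?addr_ge0// ltW.
have PN : `|Gdefect k r th| <= N / 4.
  apply: (le_trans HP); rewrite expr2 mulrA mulrC ler_wpM2l//; lra.
have /andP[P1 P2] : - (N / 4) <= Gdefect k r th <= N / 4 by rewrite -ler_norml.
split => //; first lra.
  have : `|2 * k / 3 * `|r * th| | <= 1 / 2.
    have -> : 2 * k / 3 * `|r * th| = 2 / 3 * (k * `|r * th|) by field.
    rewrite (normrM (2 / 3)) (ger0_norm (_ : 0 <= 2 / 3))// normrM normr_id.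
    have : `|k| * `|r * th| <= `|k| * N by rewrite ler_wpM2l.
    lra.
  by move=> /ler_normlP[]; lra.
apply: mulr_ge0.
  have [N1|N1] := eqVneq N 0; first by rewrite N1 invr0 mulr0 subr0.
  have Np : 0 < N by rewrite lt_neqAle eq_sym N1.
  rewrite subr_ge0 ler_pdivrMr// mul1r; lra.
have : `|(N - Gdefect k r th) * shape_factor r th| <= 1 * (1 / 2).
  rewrite normrM; apply: ler_pM => //; rewrite ger0_norm; lra.
by move=> /ler_normlP[]; lra.
Qed.

Section measurability.
Context d (X : measurableType d) (f g h : X -> R).
Hypotheses (mf : measurable_fun setT f) (mg : measurable_fun setT g) (mh : measurable_fun setT h).

Lemma measurable_sqrt : measurable_fun setT (fun x => Num.sqrt (f x)).
Proof.
by apply: (measurableT_comp (f := @Num.sqrt R)) => //; apply: continuous_measurable_fun;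
  exact: sqrt_continuous.
Qed.

Lemma measurable_invN : measurable_fun setT (fun x => (f x ^+ 2 + g x ^+ 2)^-1).
Proof.
rewrite (_ : (fun x => _) = (fun x => (f x ^+ 2 + g x ^+ 2) `^ (-1))).
  apply: (measurableT_comp (measurable_powR _)).
  by apply: measurable_funD; apply: measurable_funX.
by apply/funext => x; rewrite powR_inv1// addr_ge0 ?sqr_ge0.
Qed.

Lemma measurable_normM : measurable_fun setT (fun x => `|f x * g x|).
Proof. by apply: measurableT_comp => //; exact: measurable_funM. Qed.

Lemma measurable_Gdefect k : measurable_fun setT (fun x => Gdefect k (f x) (g x)).
Proof.
apply: measurable_funD.
  by apply: measurable_funM => //; apply: measurable_funX; exact: measurable_funM.
apply: measurable_funM; last by apply: measurable_funD; apply: measurable_funX.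
by apply: measurable_funM => //; exact: measurable_normM.
Qed.

Lemma measurable_Gplane k : measurable_fun setT (fun x => Gplane k (f x) (g x)).
Proof.
apply: measurable_funB; last exact: measurable_Gdefect.
by apply: measurable_funD; apply: measurable_funX.
Qed.

Lemma measurable_shape_factor : measurable_fun setT (fun x => shape_factor (f x) (g x)).
Proof.
apply: measurable_funM; last by apply: measurable_funX; exact: measurable_invN.
apply: measurable_funM; last exact: measurable_funX.
by apply: measurable_funB; apply: measurable_funM => //; exact: measurable_funX.
Qed.

Lemma measurable_weight_plane k : measurable_fun setT (fun x => weight_plane k (f x) (g x)).
Proof.
apply: measurable_funM.
  apply: measurable_funB => //; apply: measurable_funM; last exact: measurable_invN.
  by apply: measurable_funM => //; exact: measurable_Gdefect.
apply: measurable_funD => //; apply: measurable_funM; first exact: measurable_Gplane.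
exact: measurable_shape_factor.
Qed.

Lemma measurable_Gmodel k : measurable_fun setT (fun x => Gmodel k (f x) (g x) (h x)).
Proof.
rewrite (_ : (fun x => _) = (fun x => Gplane k (f x) (g x) + h x ^+ 2 * (1
  + 2 * k / 3 * `|f x * g x|))).
  apply: measurable_funD; first exact: measurable_Gplane.
  apply: measurable_funM; first exact: measurable_funX.
  by apply: measurable_funD => //; apply: measurable_funM => //; exact: measurable_normM.
by apply/funext => x; rewrite Gmodel_Gplane.
Qed.
End measurability.

Lemma measurable_weight_model d (X : measurableType d) (f g : X -> R) k :
  measurable_fun setT f -> measurable_fun setT g ->
  measurable_fun setT (fun x => weight_model k (f x) (g x)).
Proof.
move=> mf mg; apply: measurable_funM; last exact: measurable_weight_plane.
apply: measurable_sqrt; apply: measurable_funD => //.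
by apply: measurable_funM => //; exact: measurable_normM.
Qed.
End model.

(** * Slicing the model volume *)

Section slices.
Context {R : realType}.
Implicit Types (k T r th z : R).
Local Notation mu := (@lebesgue_measure R).

Section scaling.
Variables (c : R) (c0 : 0 < c).
Let phi : measurableTypeR R -> measurableTypeR R := fun x : R => (c * x)%R.
Let mphi : measurable_fun setT phi.
Proof. exact: measurable_funM. Qed.
Let push := measure_function_pushforward__canonical__measure_function_Measure
  (@lebesgue_measure R) mphi.
Let nu := mscale (NngNum (ltW c0)) push.

Lemma lebesgue_measure_scale (A : set R) : measurable A -> mu A = nu A.
Proof.
apply: lebesgue_measure_unique => _ [[a b] _ <-].
rewrite /nu/= /mscale/= /pushforward/=.
have -> : phi @^-1` `]a, b]%classic = `](a / c), (b / c)]%classic.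
  apply/seteqP; split => x; rewrite /= !in_itv/= /phi ltr_pdivrMr// ler_pdivlMr// mulrC//.
rewrite !lebesgue_measure_itv/= !lte_fin ltr_pM2r ?invr_gt0//.
case: ifP => _; last by rewrite mule0.
by rewrite -!EFinD -EFinM; congr EFin; field; rewrite gt_eqF.
Qed.

(** The image of Lebesgue measure under x |-> c x, scaled by c, is Lebesgue
   measure again. *)
Lemma ge0_integral_scale (f : R -> \bar R) : measurable_fun setT f -> (forall x, (0 <= f x)%E) ->
  (\int[mu]_x f x = c%:E * \int[mu]_x f (c * x)%R)%E.
Proof.
move=> mf f0.
rewrite (@eq_measure_integral _ _ _ setT nu mu); last first.
  by move=> A mA _; exact: lebesgue_measure_scale.
by rewrite /nu ge0_integral_mscale//= ge0_integral_pushforward.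
Qed.
End scaling.

Lemma ge0_integral_even (f : R -> \bar R) : measurable_fun setT f -> (forall x, (0 <= f x)%E) ->
  (forall x, f (- x)%R = f x) ->
  (\int[mu]_x f x = 2%:E * \int[mu]_(x in `[0%R, +oo[) f x)%E.
Proof.
move=> mf f0 fe.
have -> : [set: R] = `]-oo, 0%R[ `|` `[0%R, +oo[.
  apply/seteqP; split => x // _; rewrite /= !in_itv/= andbT.
  by have [|] := ltP x 0; [left|right].
rewrite ge0_integral_setU//; last 2 first.
- exact: measurable_funTS.
- apply/disj_setPS => x /=; rewrite !in_itv/= andbT => -[x0 x1].
  by have := lt_le_trans x0 x1; rewrite ltxx.
rewrite mule_natl mule2n; congr (_ + _)%E.
rewrite (integral_itv_bndo_bndc); last exact: measurable_funTS.
rewrite ge0_integration_by_substitution0//.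
by apply: eq_integral => x _; rewrite fe.
Qed.

Lemma measure_sqr_lt (a D : R) : 0 < D ->
  mu [set z : R | z ^+ 2 * D < a] = (2 * Num.sqrt (a / D))%:E.
Proof.
move=> D0.
have -> : [set z : R | z ^+ 2 * D < a] = `](- Num.sqrt (a / D)), (Num.sqrt (a / D))[%classic.
  apply/seteqP; split => z /=; rewrite in_itv/= -ltr_norml -ltr_pdivlMr//.
    move=> h; have a0 : 0 < a / D by apply: le_lt_trans h; exact: sqr_ge0.
    by rewrite -(@ltr_pXn2r _ 2)// ?nnegrE ?sqrtr_ge0// real_normK ?num_real// sqr_sqrtr// ltW.
  move=> h; have s0 : 0 < Num.sqrt (a / D) by apply: le_lt_trans h; exact: normr_ge0.
  move: h; rewrite -(@ltr_pXn2r _ 2)// ?nnegrE ?sqrtr_ge0// real_normK ?num_real//.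
  by rewrite sqr_sqrtr// ltW//; move: s0; rewrite sqrtr_gt0.
rewrite lebesgue_measure_itv/= lte_fin.
have s0 := sqrtr_ge0 (a / D).
case: ifPn => [_|]; first by rewrite -EFinD; congr EFin; ring.
rewrite -leNgt => h; congr EFin; lra.
Qed.

(** The model density on the model set {G < T}, extended by 0. *)
Definition density_model k T (u : R * R * R) : R :=
  if (u.1.1 ^+ 2 + u.1.2 ^+ 2 < model_radius k) && (Gmodel k u.1.1 u.1.2 u.2 < T)
  then weight_model k u.1.1 u.1.2 else 0.

(** The integral of [density_model] over z. The slice is empty when T <= Gplane,
   and then the square root is 0. *)
Definition slice_model k T (p : R * R) : R :=
  if p.1 ^+ 2 + p.2 ^+ 2 < model_radius k
  then 2 * weight_plane k p.1 p.2 * Num.sqrt (T - Gplane k p.1 p.2) else 0.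

Lemma weight_model_ge0 k r th : r ^+ 2 + th ^+ 2 < model_radius k -> 0 <= weight_model k r th.
Proof. by move=> /model_bounds[_ _ _ w0]; rewrite mulr_ge0 ?sqrtr_ge0. Qed.

Lemma density_model_ge0 k T u : 0 <= density_model k T u.
Proof. by rewrite /density_model; case: ifP => // /andP[/weight_model_ge0]. Qed.

Lemma slice_model_ge0 k T p : 0 <= slice_model k T p.
Proof.
rewrite /slice_model; case: ifP => // /model_bounds[_ _ _ w0].
exact: mulr_ge0 (mulr_ge0 (ler0n _ 2) w0) (sqrtr_ge0 _).
Qed.

Lemma measurable_ltN d (X : measurableType d) (f g : X -> R) (a : R) :
  measurable_fun setT f -> measurable_fun setT g ->
  measurable_fun setT (fun x => f x ^+ 2 + g x ^+ 2 < a).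
Proof.
move=> mf mg; apply: measurable_fun_ltr => //.
by apply: measurable_funD; exact: measurable_funX.
Qed.

Lemma measurable_density_model k T : measurable_fun setT (density_model k T).
Proof.
have m1 : measurable_fun setT (fun u : R * R * R => u.1.1).
  exact: (measurableT_comp measurable_fst measurable_fst).
have m2 : measurable_fun setT (fun u : R * R * R => u.1.2).
  exact: (measurableT_comp measurable_snd measurable_fst).
have m3 : measurable_fun setT (fun u : R * R * R => u.2) by exact: measurable_snd.
apply: measurable_fun_ifT => //; last exact: measurable_weight_model.
apply: measurable_and; first exact: measurable_ltN.
by apply: measurable_fun_ltr => //; exact: measurable_Gmodel.
Qed.

Lemma measurable_slice_model d (X : measurableType d) (f g : X -> R) k T :
  measurable_fun setT f -> measurable_fun setT g ->
  measurable_fun setT (fun x => slice_model k T (f x, g x)).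
Proof.
move=> mf mg; apply: measurable_fun_ifT => //; first exact: measurable_ltN.
apply: measurable_funM; first by apply: measurable_funM => //; exact: measurable_weight_plane.
by apply: measurable_sqrt; apply: measurable_funB => //; exact: measurable_Gplane.
Qed.

Lemma integral_density_model_z k T r th :
  (\int[mu]_z (density_model k T (r, th, z))%:E = (slice_model k T (r, th))%:E)%E.
Proof.
rewrite /density_model /slice_model /=; case: ifPn => [Nd|_] /=; last by rewrite integral0.
have [_ _ D2 w0] := model_bounds Nd.
have D0 : 0 < 1 + 2 * k / 3 * `|r * th| by lra.
set D := 1 + _ in D0.
pose S : set R := [set z | z ^+ 2 * D < T - Gplane k r th].
have mS : measurable S.
  have : measurable_fun setT (fun z : R => z ^+ 2 * D < T - Gplane k r th).
    by apply: measurable_fun_ltr => //; apply: measurable_funM => //; exact: measurable_funX.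
  by move=> /(_ measurableT [set true] I); rewrite setTI; congr measurable; apply/seteqP;
    split => z.
transitivity (\int[mu]_z ((weight_model k r th)%:E * (\1_S z)%:E))%E.
  apply: eq_integral => z _; rewrite indicE Gmodel_Gplane -/D -ltrBrDl.
  have -> : (z \in S) = (z ^+ 2 * D < T - Gplane k r th) by apply/idP/idP => [/set_mem|/mem_set].
  by case: ifP => _; rewrite -EFinM ?mulr1 ?mulr0.
rewrite ge0_integralZl_EFin//; last 2 first.
- by apply/measurable_EFinP; exact: measurable_indic.
- exact: weight_model_ge0.
rewrite integral_indic// setIT [X in (_ * X)%E](measure_sqr_lt _ D0) -EFinM; congr EFin.
rewrite /weight_model -/D.
have -> : Num.sqrt (T - Gplane k r th) = Num.sqrt D * Num.sqrt ((T - Gplane k r th) / D).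
  by rewrite -sqrtrM ?(ltW D0)// mulrC divfK// gt_eqF.
ring.
Qed.

(** Tonelli's theorem is applied to the product of the plane with the line, so
   the plane measure must be known to be sigma-finite. *)
Lemma sigma_finite_plane : sigma_finite setT (mu \x mu)%E.
Proof.
have /sigma_finiteP[F [TF ndF Foo]] := @sigma_finiteT _ _ _ mu.
exists (fun n => F n `*` F n).
  rewrite -setXTT TF predeqE => -[x y]; split.
    move=> [/= [n _ Fnx] [l _ Fly]]; exists (maxn n l) => //; split.
    - by move: x Fnx; exact/subsetPset/ndF/leq_maxl.
    - by move: y Fly; exact/subsetPset/ndF/leq_maxr.
  by move=> [n _ []/= ? ?]; split; exists n.
move=> l; have [? ?] := Foo l.
split; first exact: measurableX.
by rewrite product_measure1E// lte_mul_pinfty// ge0_fin_numE.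
Qed.

(* The product measure is packed by hand as a sigma-finite measure. *)
Let plane : {sigma_finite_measure set (measurableTypeR R * measurableTypeR R)%type -> \bar R} :=
  HB.pack (mu \x mu)%E (Measure_isSigmaFinite.Build _ _ _ (mu \x mu)%E sigma_finite_plane).

Lemma integral_density_model k T :
  (\int[(mu \x mu \x mu)%E]_u (density_model k T u)%:E
    = \int[mu]_r \int[mu]_th (slice_model k T (r, th))%:E)%E.
Proof.
have mF : measurable_fun setT (fun u : R * R * R => (density_model k T u)%:E).
  by apply/measurable_EFinP; exact: measurable_density_model.
have F0 (u : R * R * R) : (0 <= (density_model k T u)%:E)%E by rewrite lee_fin density_model_ge0.
apply: (eq_trans (fubini_tonelli1 (m1 := plane) (m2 := mu) _ mF F0)); rewrite /fubini_F.
have mJ : measurable_fun setT (fun p : R * R => (slice_model k T p)%:E).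
  apply/measurable_EFinP; rewrite (_ : slice_model k T = fun p => slice_model k T (p.1, p.2)).
    by apply: measurable_slice_model; [exact: measurable_fst|exact: measurable_snd].
  by apply/funext => -[].
have J0 (p : R * R) : (0 <= (slice_model k T p)%:E)%E by rewrite lee_fin slice_model_ge0.
apply: (eq_trans _ (fubini_tonelli1 (m1 := mu) (m2 := mu) _ mJ J0)).
by apply: eq_integral => -[r th] _; rewrite integral_density_model_z.
Qed.

(** [slice_model] in the coordinates (r, m) with th = |r| m, including the
   Jacobian |r|. *)
Definition cone_model k T (p : R * R) : R := slice_model k T (p.1, `|p.1| * p.2) * `|p.1|.

Lemma measurable_cone_model k T : measurable_fun setT (cone_model k T).
Proof.
have mn : measurable_fun setT (fun p : R * R => `|p.1|).
  by apply: measurableT_comp => //; exact: measurable_fst.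
apply: measurable_funM => //; apply: measurable_slice_model; first exact: measurable_fst.
by apply: measurable_funM => //; exact: measurable_snd.
Qed.

Lemma cone_model_ge0 k T p : 0 <= cone_model k T p.
Proof. by rewrite mulr_ge0// slice_model_ge0. Qed.

(** For each r other than 0, substitute th = |r| m in the inner integral; then
   exchange the integrals. *)
Lemma integral_slice_model k T :
  (\int[mu]_r \int[mu]_th (slice_model k T (r, th))%:E
    = \int[mu]_m \int[mu]_r (cone_model k T (r, m))%:E)%E.
Proof.
have mK : measurable_fun setT (fun p : R * R => (cone_model k T p)%:E).
  by apply/measurable_EFinP; exact: measurable_cone_model.
have K0 (p : R * R) : (0 <= (cone_model k T p)%:E)%E by rewrite lee_fin cone_model_ge0.
have mJ : measurable_fun setT (fun p : R * R => (slice_model k T p)%:E).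
  apply/measurable_EFinP; rewrite (_ : slice_model k T = fun p => slice_model k T (p.1, p.2)).
    by apply: measurable_slice_model; [exact: measurable_fst|exact: measurable_snd].
  by apply/funext => -[].
have J0 (p : R * R) : (0 <= (slice_model k T p)%:E)%E by rewrite lee_fin slice_model_ge0.
apply: (eq_trans _ (fubini_tonelli (m1 := mu) (m2 := mu) _ mK K0)).
apply: ge0_ae_eq_integral => //.
- exact: (measurable_fun_fubini_tonelli_F (m2 := mu) _ mJ J0).
- exact: (measurable_fun_fubini_tonelli_F (m2 := mu) _ mK K0).
- by move=> r _; apply: integral_ge0 => th _; exact: J0.
- by move=> r _; apply: integral_ge0 => m _; exact: K0.
exists [set 0]; split => //; first exact: lebesgue_measure_set1.
move=> r /=; apply: contra_notP => /eqP r0 _.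
have nr0 : 0 < `|r| by rewrite normr_gt0.
rewrite (ge0_integral_scale nr0); last 2 first.
- by apply/measurable_EFinP; exact: measurable_slice_model.
- by move=> th; exact: J0.
rewrite -ge0_integralZl_EFin//.
- by apply: eq_integral => m _; rewrite -EFinM mulrC.
- apply/measurable_EFinP; apply: measurable_slice_model => //.
Qed.
End slices.

(** * Integration along rays of the (r, th)-plane *)

Section radial.
Context {R : realType}.
Implicit Types (k T r m : R).
Local Notation mu := (@lebesgue_measure R).

Definition cone_coef k m : R := m ^+ 2 / 3 + 2 * k / 3 * `|m| * (1 + m ^+ 2).
(** [Gplane] at (r, r m), a polynomial in r for fixed m; [cone_G'] is its
   derivative and [cone_shape] is the value of [shape_factor] there. *)
Definition cone_G k m r : R := (1 + m ^+ 2) * r ^+ 2 - cone_coef k m * r ^+ 4.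
Definition cone_G' k m r : R := 2 * (1 + m ^+ 2) * r - 4 * cone_coef k m * r ^+ 3.
Definition cone_shape m : R := (m ^+ 2 / 6 - 1 / 2) / (1 + m ^+ 2) ^+ 2.

Lemma one_sqr_gt0 m : 0 < 1 + m ^+ 2. Proof. by rewrite ltr_pwDl// sqr_ge0. Qed.

Lemma Gplane_cone k m r : 0 <= r -> Gplane k r (r * m) = cone_G k m r.
Proof.
move=> r0; rewrite /Gplane /Gdefect /cone_G /cone_coef.
have -> : `|r * (r * m)| = r ^+ 2 * `|m| by rewrite mulrA -expr2 normrM (ger0_norm (sqr_ge0 r)).
by field.
Qed.

(** On a ray the integrand is a function of [cone_G] times its derivative, which
   is what [weight_plane] is made for. *)
Lemma cone_modelE k T m r : 0 <= r -> cone_model k T (r, m) =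
  if r ^+ 2 * (1 + m ^+ 2) < model_radius k then
    2 / (1 + m ^+ 2) / 2 * (cone_G' k m r * (1
      + cone_G k m r * cone_shape m) * Num.sqrt (T - cone_G k m r))
  else 0.
Proof.
move=> r0; have s0 := one_sqr_gt0 m.
rewrite /cone_model /slice_model /= (ger0_norm r0).
have -> : r ^+ 2 + (r * m) ^+ 2 = r ^+ 2 * (1 + m ^+ 2) by ring.
case: ifP => _; last by rewrite mul0r.
rewrite /weight_plane Gplane_cone//.
have [->|rn] := eqVneq r 0.
  by rewrite /cone_G' mulr0 !expr0n/= !mulr0 subr0 !mul0r mulr0.
have P : 2 * Gdefect k r (r * m) * (r ^+ 2 + (r * m) ^+ 2)^-1
  = 2 * cone_coef k m / (1 + m ^+ 2) * r ^+ 2.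
  rewrite /Gdefect /cone_coef.
  have -> : `|r * (r * m)| = r ^+ 2 * `|m| by rewrite mulrA -expr2 normrM (ger0_norm (sqr_ge0 r)).
  have -> : r ^+ 2 + (r * m) ^+ 2 = r ^+ 2 * (1 + m ^+ 2) by ring.
  by field; rewrite rn gt_eqF.
have G : shape_factor r (r * m) = cone_shape m.
  rewrite /shape_factor /cone_shape.
  have -> : r ^+ 2 + (r * m) ^+ 2 = r ^+ 2 * (1 + m ^+ 2) by ring.
  by field; rewrite rn gt_eqF.
by rewrite P G /cone_G'; field; rewrite gt_eqF.
Qed.

Lemma cone_model_even k T m r : cone_model k T (- r, m) = cone_model k T (r, m).
Proof.
rewrite /cone_model /= normrN; congr (_ * _).
by rewrite /slice_model /= /weight_plane /Gplane /shape_factor /Gdefect !mulNr !sqrrN !normrN.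
Qed.

Lemma cone_coef_le k m : `|cone_coef k m| * model_radius k <= (1 + m ^+ 2) ^+ 2 / 4.
Proof.
have := Gdefect_le k 1 m; rewrite /Gdefect expr1n mul1r => H.
have -> : (1 + m ^+ 2) ^+ 2 / 4 = (1 + `|k|) * (1 + m ^+ 2) ^+ 2 * model_radius k.
  have [_ E] := model_radius_le k; transitivity ((1 + `|k|) * model_radius k * (1
    + m ^+ 2) ^+ 2); last by ring.
  by rewrite E; field.
by rewrite ler_wpM2r// ltW// model_radius_gt0.
Qed.

(** Hence {G < T} meets each ray in an interval starting at 0, within the
   region r^2 + th^2 < model_radius. *)
Lemma cone_G_mono k m (x y : R) : 0 <= x -> x < y -> y ^+ 2 * (1 + m ^+ 2) <= model_radius k ->
  cone_G k m x < cone_G k m y.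
Proof.
move=> x0 xy yd; have s0 := one_sqr_gt0 m; have B := cone_coef_le k m.
set s := 1 + m ^+ 2 in s0 B yd *; set c := cone_coef k m in B *.
have y0 : 0 < y by exact: le_lt_trans xy.
have y2 : x ^+ 2 < y ^+ 2 by rewrite ltr_pXn2r// nnegrE// ltW.
have cy : `|c| * y ^+ 2 <= s / 4.
  rewrite -(ler_pM2r s0) -mulrA; apply: (@le_trans _ _ (`|c| * model_radius k));
    first by rewrite ler_wpM2l.
  by apply: (le_trans B); rewrite expr2 mulrAC.
have cx : c * (x ^+ 2 + y ^+ 2) < s.
  apply: (le_lt_trans (ler_norm _)); rewrite normrM (ger0_norm (addr_ge0 (sqr_ge0 _) (sqr_ge0 _))).
  have := ler_wpM2l (normr_ge0 c) (ltW y2); lra.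
rewrite -subr_gt0 /cone_G -/s -/c.
have -> : s * y ^+ 2 - c * y ^+ 4 - (s * x ^+ 2 - c * x ^+ 4)
  = (y ^+ 2 - x ^+ 2) * (s - c * (x ^+ 2 + y ^+ 2)).
  by ring.
by rewrite mulr_gt0// subr_gt0.
Qed.

(** Intermediate value theorem, between r = 0 and the boundary of the region. *)
Lemma cone_radius k T m : 0 < T <= model_radius k / 2 ->
  exists2 rs, 0 < rs & rs ^+ 2 * (1 + m ^+ 2) < model_radius k /\ cone_G k m rs = T.
Proof.
move=> /andP[T0 Td]; have s0 := one_sqr_gt0 m; have B := cone_coef_le k m;
  have d0 := model_radius_gt0 k.
set s := 1 + m ^+ 2 in s0 B *.
set rd := Num.sqrt (model_radius k / s).
have rd0 : 0 < rd by rewrite sqrtr_gt0 divr_gt0.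
have rd2 : rd ^+ 2 = model_radius k / s by rewrite sqr_sqrtr// ltW// divr_gt0.
have Ad : T < cone_G k m rd.
  have rd4 : rd ^+ 4 = (model_radius k / s) ^+ 2 by rewrite -rd2; ring.
  rewrite /cone_G -/s rd4 rd2.
  have -> : s * (model_radius k / s) = model_radius k by rewrite mulrC divfK// gt_eqF.
  have : cone_coef k m * (model_radius k / s) ^+ 2 <= model_radius k / 4.
    apply: (@le_trans _ _ (`|cone_coef k m| * model_radius k * (model_radius k / s ^+ 2))).
      rewrite [leRHS](_ : _ = `|cone_coef k m| * (model_radius k / s) ^+ 2); last by field;
        rewrite gt_eqF.
      by rewrite ler_wpM2r ?sqr_ge0// ler_norm.
    apply: (@le_trans _ _ (s ^+ 2 / 4 * (model_radius k / s ^+ 2))).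
      by rewrite ler_wpM2r// divr_ge0 ?sqr_ge0// ltW.
    by rewrite le_eqVlt; apply/orP; left; apply/eqP; field; rewrite gt_eqF.
  lra.
have cA : {within `[0, rd], continuous (cone_G k m)}.
  apply: continuous_subspaceT => x; apply: cvgB; (apply: cvgM; first exact: cvg_cst);
    exact: exprn_continuous.
have A0 : cone_G k m 0 = 0 by rewrite /cone_G !expr0n/= !mulr0 subr0.
have := @IVT _ (cone_G k m) 0 rd T (ltW rd0) cA.
rewrite A0 minEle maxEle (ltW (lt_trans T0 Ad)) (ltW T0) (ltW Ad) => /(_ isT)[rs].
rewrite in_itv/= => /andP[rs0 rsd] rsT.
have rsn : rs != 0 by apply: contraTneq T0 => r0; rewrite -rsT r0 A0 ltxx.
exists rs; first by rewrite lt_neqAle eq_sym rsn.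
split=> //; rewrite -ltr_pdivlMr// -rd2 ltr_pXn2r ?nnegrE ?(ltW rd0)//.
rewrite lt_neqAle rsd andbT; apply: contraTneq Ad => <-; by rewrite rsT ltxx.
Qed.

(** With v = T - cone_G the integrand is - v' sqrt v (1 + (T - v) cone_shape),
   whose primitive is a combination of v^(3/2) and v^(5/2). Since v vanishes
   at rs, only the value T of v at 0 enters, and k drops out. *)
Lemma integral_cone k T m rs : 0 < T -> 0 < rs -> cone_G k m rs = T ->
  (forall r, 0 < r < rs -> cone_G k m r < T) ->
  (\int[mu]_(r in `[0%R, rs]) (cone_G' k m r * (1
    + cone_G k m r * cone_shape m) * Num.sqrt (T - cone_G k m r))%:E
   = (2 / 3 * T * Num.sqrt T + 4 / 15 * cone_shape m * T ^+ 2 * Num.sqrt T)%:E)%E.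
Proof.
move=> T0 rs0 AT Alt; set g := cone_shape m.
have cX n x : {for x, continuous (fun r : R => r ^+ n)} by exact: exprn_continuous.
have cA : continuous (cone_G k m).
  by move=> x; apply: cvgB; (apply: cvgM; first exact: cvg_cst); exact: exprn_continuous.
have cA' : continuous (cone_G' k m).
  move=> x; apply: cvgB; (apply: cvgM; first exact: cvg_cst); first exact: cvg_id.
  exact: exprn_continuous.
have cv : continuous (fun r => T - cone_G k m r) by move=> x; apply: cvgB;
  [exact: cvg_cst|exact: cA].
have cs : continuous (fun r => Num.sqrt (T - cone_G k m r)).
  by move=> x; apply: (continuous_comp (cv x)); exact: sqrt_continuous.
pose F r := - (2 / 3 * (1 + g * T)) * ((T - cone_G k m r) * Num.sqrt (T - cone_G k m r)) +
   2 / 5 * g * ((T - cone_G k m r) * (T - cone_G k m r) * Num.sqrt (T - cone_G k m r)).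
have cF : continuous F.
  move=> x; apply: cvgD; (apply: cvgM; first exact: cvg_cst); apply: cvgM; try exact: cs;
    try exact: cv.
  by apply: cvgM; exact: cv.
pose D : set R := [set r | 0 < r < rs].
have CA : C1_with D (fun r => T - cone_G k m r) (fun r => - cone_G' k m r).
  move=> r _; split; last by apply: cvgN; exact: cA'.
  apply: is_derive_eq; rewrite /cone_G' /GRing.scale/=; ring.
have pos r : D r -> 0 < T - cone_G k m r by move=> /Alt; rewrite subr_gt0.
have CS := C1_with_sqrt CA pos.
have CF := C1_withD (C1_withM (@C1_with_cst R D (- (2 / 3 * (1 + g * T)))) (C1_withM CA CS))
   (C1_withM (@C1_with_cst R D (2 / 5 * g)) (C1_withM (C1_withM CA CA) CS)).
rewrite (@continuous_FTC2 _ _ F)//.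
- by rewrite /F AT subrr !mul0r !mulr0 addr0 /cone_G !expr0n/= !mulr0 !subr0 -EFinD; congr EFin;
  field.
- apply: continuous_subspaceT => x; apply: cvgM; last exact: cs.
  apply: cvgM; first exact: cA'.
  by apply: cvgD; [exact: cvg_cst|apply: cvgM; [exact: cA|exact: cvg_cst]].
- split.
  + by move=> r; rewrite in_itv/= => Dr; have [H _] := CF r Dr; exact: ex_derive.
  + by apply: cvg_at_right_filter; exact: cF.
  + by apply: cvg_at_left_filter; exact: cF.
- move=> r; rewrite in_itv/= => Dr; have [H _] := CF r Dr.
  rewrite derive1E (derive_val (is_derive := H)) /cst/=.
  have p := pos r Dr; set v := T - cone_G k m r in p *.
  have s0 : 0 < Num.sqrt v by rewrite sqrtr_gt0.
  have -> : cone_G k m r = T - v by rewrite /v; ring.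
  have vE : v = Num.sqrt v ^+ 2 by rewrite sqr_sqrtr// ltW.
  set s := Num.sqrt v in s0 vE *; rewrite vE.
  by field; rewrite gt_eqF.
Qed.

Lemma integral_cone_model_r k T m : 0 < T <= model_radius k / 2 ->
  (\int[mu]_r (cone_model k T (r, m))%:E =
   ((1 + m ^+ 2)^-1 * (4 / 3 * T * Num.sqrt T + 8 / 15 * cone_shape m * T ^+ 2 * Num.sqrt T))%:E)%E.
Proof.
move=> TT; have [rs rs0 [rsd rsT]] := cone_radius m TT; have /andP[T0 Td] := TT.
have s0 := one_sqr_gt0 m.
have mK : measurable_fun setT (fun r : R => (cone_model k T (r, m))%:E).
  apply/measurable_EFinP; apply: (measurableT_comp (measurable_cone_model k T)).
  by apply: measurable_fun_pair.
rewrite ge0_integral_even//; last 2 first.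
- by move=> r; rewrite lee_fin cone_model_ge0.
- by move=> r; rewrite cone_model_even.
have small r : 0 < r < rs -> cone_G k m r < T.
  by move=> /andP[r0 rrs]; rewrite -rsT; apply: cone_G_mono => //; exact: ltW.
pose body r := cone_G' k m r * (1 + cone_G k m r * cone_shape m) * Num.sqrt (T - cone_G k m r).
have E : (\int[mu]_(r in `[0%R, +oo[) (cone_model k T (r, m))%:E
  = \int[mu]_(r in `[0%R, rs]) ((1 + m ^+ 2)^-1%:E * (body r)%:E))%E.
  rewrite integral_mkcond [RHS]integral_mkcond; apply: eq_integral => r _.
  rewrite !patchE !mem_setE !in_itv/= andbT.
  have [r0|r0] := leP 0 r => //=.
  rewrite cone_modelE// -/(body r).
  have [rrs|rrs] := leP r rs.
    have -> : r ^+ 2 * (1 + m ^+ 2) < model_radius k.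
      by apply: le_lt_trans rsd; rewrite ler_pM2r// lerXn2r ?nnegrE// ltW.
    by rewrite -EFinM; congr EFin; field; rewrite gt_eqF.
  case: ifPn => // rd.
  have : T <= cone_G k m r by rewrite -rsT ltW//; apply: cone_G_mono => //; exact: ltW.
  by rewrite -subr_le0 => /ler0_sqrtr H; rewrite /body H !mulr0.
rewrite E ge0_integralZl_EFin//; last 3 first.
- move=> r; rewrite /= in_itv/= => /andP[r0 rrs].
  have rd : r ^+ 2 * (1 + m ^+ 2) < model_radius k.
    by apply: le_lt_trans rsd; rewrite ler_pM2r// lerXn2r ?nnegrE// ltW.
  have := cone_model_ge0 k T (r, m); rewrite cone_modelE// rd -/(body r) lee_fin.
  by rewrite pmulr_rge0// !divr_gt0.
- apply/measurable_EFinP; apply: measurable_funTS.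
  have mX n : measurable_fun setT (fun r : R => r ^+ n) by exact: measurable_funX.
  have mA : measurable_fun setT (cone_G k m) by apply: measurable_funB; apply: measurable_funM.
  apply: measurable_funM.
    apply: measurable_funM; first by apply: measurable_funB; apply: measurable_funM.
    by apply: measurable_funD => //; apply: measurable_funM.
  by apply: measurable_sqrt; apply: measurable_funB.
- by rewrite invr_ge0 ltW.
rewrite [X in (_ * (_ * X))%E](integral_cone T0 rs0 rsT small) -!EFinM; congr EFin.
by field; rewrite gt_eqF.
Qed.
End radial.

(** * Integration over the slopes, and the model volume *)

Section angular.
Context {R : realType}.
Implicit Types (k T r m : R).
Local Notation mu := (@lebesgue_measure R).

Lemma cone_shape_ge m : - (1 / 2) <= cone_shape m.
Proof.
have s0 := one_sqr_gt0 m; rewrite /cone_shape ler_pdivlMr ?exprn_gt0//.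
have := sqr_ge0 m; set x := m ^+ 2; move=> x0; nra.
Qed.

(** With m = tan t, the measure dm / (1 + m^2) becomes dt and cone_shape becomes
   a polynomial in cos^2 t. *)
Definition angular_primitive (a b t : R) : R :=
  a * t - b / 6 * (sin t * cos t * (cos t * cos t) + sin t * cos t + t).

Lemma is_derive_angular_primitive (a b t : R) : is_derive t 1 (angular_primitive a b)
  (a - b / 6 * (4 * (cos t ^+ 2) ^+ 2 - cos t ^+ 2)).
Proof.
have C1 : C1_with setT (@sin R) (@cos R) by move=> x _; split;
  [exact: is_derive_sin|exact: continuous_cos].
have C2 : C1_with setT (@cos R) (fun x => - sin x).
  by move=> x _; split; [exact: is_derive_cos|apply: cvgN; exact: continuous_sin].
have C3 : C1_with setT (@idfun R) (cst 1) by move=> x _; split;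
  [exact: is_derive_id|exact: cvg_cst].
have Csc := C1_withM C1 C2.
have C := C1_withB (C1_withM (@C1_with_cst R setT a) C3)
  (C1_withM (@C1_with_cst R setT (b / 6)) (C1_withD (C1_withD (C1_withM Csc (C1_withM C2 C2))
    Csc) C3)).
have [D _] := C t I; apply: (is_derive_eq D); rewrite /cst /idfun /=.
have e : sin t ^+ 2 = 1 - cos t ^+ 2 by exact: sin2cos2.
transitivity (a - b / 6 * (cos t ^+ 2 * cos t ^+ 2 - 3 * sin t ^+ 2 * cos t ^+ 2
  + cos t ^+ 2 - sin t ^+ 2 + 1)); first by ring.
by rewrite e; ring.
Qed.

(** The substitution m = tan t; the integral of cone_shape over the line
   against dm / (1 + m^2) is - pi / 6. *)
Lemma integral_angular (a b : R) : 0 <= b -> b / 2 <= a ->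
  (\int[mu]_m ((1 + m ^+ 2)^-1 * (a + b * cone_shape m))%:E = ((a - b / 6) * pi)%:E)%E.
Proof.
move=> b0 ba; pose f m := (1 + m ^+ 2)^-1 * (a + b * cone_shape m).
have f0 m : 0 <= f m.
  rewrite mulr_ge0 ?invr_ge0 ?(ltW (one_sqr_gt0 m))//.
  have := ler_wpM2l b0 (cone_shape_ge m); lra.
have cX n : continuous (fun m : R => m ^+ n) by exact: exprn_continuous.
have c1 : continuous (fun m : R => 1 + m ^+ 2) by move=> x; apply: cvgD; [exact: cvg_cst|exact: cX].
have ci : continuous (fun m : R => (1 + m ^+ 2)^-1).
  by move=> x; apply: cvgV; [rewrite gt_eqF// one_sqr_gt0|exact: c1].
have cg : continuous (@cone_shape R).
  move=> x; apply: cvgM.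
    by apply: cvgB; [apply: cvgM; [exact: cX|exact: cvg_cst]|exact: cvg_cst].
  apply: cvgV; first by rewrite expf_neq0// gt_eqF// one_sqr_gt0.
  exact: (@continuous_comp _ _ _ (fun m : R => 1 + m ^+ 2) (fun y : R =>
    y ^+ 2) x (c1 x) (cX 2%N _)).
have cf : continuous f.
  by move=> x; apply: cvgM; [exact: ci|apply: cvgD; [exact: cvg_cst|apply: cvgM;
    [exact: cvg_cst|exact: cg]]].
have fe : f =1 f \o -%R by move=> m; rewrite /f /cone_shape/= !sqrrN.
rewrite [LHS](ge0_symfun_integralT f0 cf fe) -set_itvcy.
pose F m := angular_primitive a b (atan m).
have dF m : is_derive m 1 F (f m).
  apply: (is_derive_eq (is_derive1_comp (is_derive_angular_primitive a b (atan m))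
    (is_derive1_atan m))).
  rewrite cos_atan exprVn sqr_sqrtr ?(ltW (one_sqr_gt0 m))// /f /cone_shape.
  by field; rewrite gt_eqF// one_sqr_gt0.
rewrite (@ge0_continuous_FTC2y _ f F 0 ((a - b / 6) * (pi / 2)))//.
- rewrite /F /angular_primitive atan0 sin0 !mul0r !addr0 !mulr0 subr0 sube0 -EFinM; congr EFin.
  by field.
- exact: continuous_subspaceT.
- have -> : (a - b / 6) * (pi / 2) = angular_primitive a b (pi / 2).
    by rewrite /angular_primitive cos_pihalf; ring.
  exact: (cvg_comp (@atan R) (angular_primitive a b) (@cvgy_atan R)
    (is_derive_continuous (is_derive_angular_primitive a b (pi / 2)))).
- by apply: cvg_at_right_filter; exact: is_derive_continuous (dF 0).
- by move=> x _; rewrite derive1E; have [] := dF x.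
Qed.

(** Slicing in z, then along rays, then over slopes. The coefficients are
   4 pi / 3 = (4/3) pi and 4 pi / 45 = (8/15) (pi / 6). *)
Lemma model_volume k T : 0 < T <= model_radius k / 2 ->
  (\int[(mu \x mu \x mu)%E]_u (density_model k T u)%:E =
   (4 * pi / 3 * (T * Num.sqrt T) - 4 * pi / 45 * (T ^+ 2 * Num.sqrt T))%:E)%E.
Proof.
move=> TT; rewrite integral_density_model integral_slice_model.
have /andP[T0 Td] := TT.
have s0 : 0 <= T * Num.sqrt T by rewrite mulr_ge0 ?sqrtr_ge0// ltW.
have T1 : T <= 1 by have [d1 _] := model_radius_le k; have d0 := model_radius_gt0 k; lra.
pose a := 4 / 3 * (T * Num.sqrt T); pose b := 8 / 15 * (T ^+ 2 * Num.sqrt T).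
have b0 : 0 <= b.
  by apply: mulr_ge0 => //; apply: mulr_ge0; [exact: sqr_ge0|exact: sqrtr_ge0].
have ba : b / 2 <= a.
  have : T ^+ 2 * Num.sqrt T <= T * Num.sqrt T by rewrite expr2 -mulrA ler_piMl.
  rewrite /a /b; lra.
transitivity (\int[mu]_m ((1 + m ^+ 2)^-1 * (a + b * cone_shape m))%:E)%E.
  by apply: eq_integral => m _; rewrite integral_cone_model_r//; congr EFin; rewrite /a /b; ring.
by rewrite integral_angular//; congr EFin; rewrite /a /b; field.
Qed.
End angular.

(** * Comparison of the density with its model *)

Section weight.
Context {R : realType}.

Lemma sqrt1D_approx (x : R) : -1 <= x -> `|Num.sqrt (1 + x) - (1 + x / 2)| <= x ^+ 2.
Proof.
move=> x1; have x0 : 0 <= 1 + x by lra.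
set s := Num.sqrt (1 + x); have s0 : 0 <= s by exact: sqrtr_ge0.
have sE : x = s ^+ 2 - 1 by rewrite sqr_sqrtr//; ring.
have -> : s - (1 + x / 2) = - ((s - 1) ^+ 2 / 2) by rewrite {1}sE; field.
rewrite normrN ger0_norm ?divr_ge0 ?sqr_ge0//.
have -> : x ^+ 2 = (s - 1) ^+ 2 * (s + 1) ^+ 2 by rewrite sE; ring.
rewrite ler_wpM2l ?sqr_ge0//; nra.
Qed.

(** Here f and c stand for phi^-1 and cos r. The terms of order N are - k h - r^2 / 2
   in f c and k h / 3 - X + y0 in the model, with X and y0 as in the proof; they
   agree by the choice of shape_factor. All other terms are products of two
   terms O(N), or error terms. *)
Lemma weight_approx (k : R) : exists C : R, forall e r th f c : R,
  0 <= e <= 1 -> r ^+ 2 + th ^+ 2 <= e -> r ^+ 2 + th ^+ 2 < model_radius k ->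
  `|f - (1 - k * `|r * th|)| <= e * (r ^+ 2 + th ^+ 2) ->
  `|c - (1 - r ^+ 2 / 2)| <= e * (r ^+ 2 + th ^+ 2) ->
  `|f * c - weight_model k r th| <= C * (e * (r ^+ 2 + th ^+ 2)).
Proof.
eexists => e r th f c /andP[e0 e1] Ne Nd hf hc.
have [HP HA HD Hw] := model_bounds Nd; have Hg := shape_factor_le r th.
have hN := norm_mul_le_sqr r th; have h0 := normr_ge0 (r * th).
have r20 := sqr_ge0 r; have t20 := sqr_ge0 th.
have HP2 := Gdefect_le k r th.
set N : R := r ^+ 2 + th ^+ 2 in hf hc Ne Nd HP HP2 HA hN *.
set h := `|r * th| in hf hN h0 HD *.
have N0 : 0 <= N by rewrite addr_ge0.
set P := Gdefect k r th in HP HP2 *; set ga := shape_factor r th in Hg.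
(* With these, weight_plane is (1 - X) (1 + y0 - P ga), and P ga is of order e N. *)
set X := 2 * P * N^-1; set y0 := N * ga.
have QL (x : R) : 0 <= x -> x <= N -> bndQ N 1 x.
  by move=> x0 xN; rewrite /bndQ ger0_norm// mul1r.
have hb : bndQ N 1 h by exact: QL.
have rb : bndQ N 1 (r ^+ 2) by apply: QL => //; rewrite /N lerDl.
have fb : bndE e N 1 (f - (1 - k * h)) by rewrite /bndE mul1r.
have cb : bndE e N 1 (c - (1 - r ^+ 2 / 2)) by rewrite /bndE mul1r.
have yb : bndQ N 1 y0.
  by rewrite /bndQ mul1r /y0 normrM (ger0_norm N0) ler_piMr//; lra.
have Pgb : bndE e N (1 + `|k|) (P * ga).
  rewrite /bndE normrM; apply: (@le_trans _ _ (`|P| * 1)); first by rewrite ler_wpM2l//; lra.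
  rewrite mulr1; apply: (le_trans HP2); rewrite ler_wpM2l ?addr_ge0// expr2 ler_wpM2r//.
have Xb : bndQ N (2 * (1 + `|k|)) X.
  rewrite /bndQ /X; have [N1|N1] := eqVneq N 0; first by rewrite N1 invr0 mulr0 normr0 mulr0.
  have Np : 0 < N by rewrite lt_neqAle eq_sym N1.
  rewrite normrM normfV (ger0_norm N0) ler_pdivrMr// normrM (ger0_norm (ler0n _ 2)) -!mulrA.
  by rewrite ler_wpM2l// -expr2.
set ka := 2 * k / 3 in HD *; set s1 := Num.sqrt (1 + ka * h) - (1 + ka * h / 2).
have QM c1 d x y : bndQ N c1 x -> bndQ N d y -> bndE e N (`|c1| * `|d|) (x * y).
  by move=> *; apply: bndQM.
have E_Q c1 x : bndE e N c1 x -> bndQ N `|c1| x by move=> *; apply: (@bndE_Q _ e).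
have QE c1 d x y : bndQ N c1 x -> bndE e N d y -> bndE2 e N (`|c1| * `|d|) (x * y).
  by move=> *; apply: bndQE.
have E2_E c1 x : bndE2 e N c1 x -> bndE e N `|c1| x by move=> *; apply: bndE2_E.
have s1b : bndE e N (`| `|ka| * 1 | * `| `|ka| * 1 |) s1.
  have := QM _ _ _ _ (bndQZ ka hb) (bndQZ ka hb); apply: le_trans.
  rewrite -expr2 [leRHS]ger0_norm ?sqr_ge0//.
  by apply: sqrt1D_approx; lra.
set f1 := f - (1 - k * h) in fb; set c1 := c - (1 - r ^+ 2 / 2) in cb.
have Fb := bndQD (bndQN (bndQZ k hb)) (E_Q _ _ fb).
have Gb := bndQD (bndQN (bndQZ 2^-1 rb)) (E_Q _ _ cb).
have Hb := bndQD (bndQZ 2^-1 (bndQZ ka hb)) (E_Q _ _ s1b).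
have Yb := bndQD yb (bndQN (E_Q _ _ Pgb)).
have XYb := QM _ _ _ _ Xb Yb.
have T := bndED (bndED (bndED (bndED (bndED (bndED fb cb) (bndEN s1b)) Pgb)
   (bndED (QM _ _ _ _ Fb Gb) (QM _ _ _ _ Hb Xb)))
   (bndED (bndEN (QM _ _ _ _ Hb Yb)) XYb)) (E2_E _ _ (QE _ _ _ _ Hb XYb)).
apply: (le_trans _ T); rewrite le_eqVlt; apply/orP; left; apply/eqP; congr (`| _ |).
have E0 : X - y0 = 4 / 3 * (k * h) + r ^+ 2 / 2.
  have [N1|N1] := eqVneq N 0.
    have r0 : r ^+ 2 = 0 by clear -N1 r20 t20; move: N1; rewrite /N; lra.
    have h00 : h = 0 by clear -N1 hN h0; lra.
    by rewrite /X /y0 N1 invr0 mulr0 mul0r h00 r0 subr0 !mulr0 mul0r addr0.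
  rewrite /X /y0 /P /ga /Gdefect /shape_factor -/N -/h.
  have -> : th ^+ 2 = N - r ^+ 2 by rewrite /N; ring.
  by rewrite exprMn (_ : th ^+ 2 = N - r ^+ 2) ?/N; [field|ring].
have -> : weight_model k r th = (1 + (2^-1 * (ka * h) + s1)) * ((1 - X) * (1 + (y0 - P * ga))).
  rewrite /weight_model /weight_plane -/h -/ka -/P -/ga -/N /s1 /y0 /X /Gplane -/N -/P.
  by congr (_ * ((1 - _) * _)); ring.
have -> : f = 1 - k * h + f1 by rewrite /f1; ring.
have -> : c = 1 - r ^+ 2 / 2 + c1 by rewrite /c1; ring.
have -> : X = y0 + (4 / 3 * (k * h) + r ^+ 2 / 2) by rewrite -E0; ring.
by rewrite /ka; field.
Qed.
End weight.

(** * Comparison of the balls with the model sets *)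

Section volume.
Context {R : realType}.
Variables (alpha k : R) (b : R -> R) (chi : R * R -> R) (Q : 'M[R]_3).
Hypotheses (a01 : 0 < alpha < 1) (hb : is_profile b) (hc : is_cutoff chi) (OO : Q *m Q^T = 1%:M).

Local Notation g := (g_metric alpha k b chi Q).
Local Notation mu := (@lebesgue_measure R).
Local Notation density := (fun u => Num.sqrt (\det (gram g (chart Q) u))).

Definition volpoly (t : R) : R := 4 * pi / 3 * t ^+ 3 - 4 * pi / 45 * t ^+ 5.
Definition ball_volume (t : R) : \bar R :=
  rvolume g chart_dom (chart Q) (rball S2xS1 g (chart Q (0, 0, 0)) t).

(** Since the model density is at least 1/2 near the origin, the absolute error of
   [weight_approx] is also a relative error. *)
Lemma density_approx (e : R) : 0 < e -> exists2 d : R, 0 < d &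
  forall r th z : R, r ^+ 2 + th ^+ 2 < d ->
    `|density (r, th, z) - weight_model k r th| <= e * (r ^+ 2 + th ^+ 2) * weight_model k r th.
Proof.
move=> e0; have [C HC] := weight_approx k.
(* Then C e1 <= min(e, 1) / 12, and the model density is at least 7/12 - 1/12. *)
set e1 : R := Num.min 1 (Num.min e 1 / (12 * (`|C| + 1))).
have C0 : 0 < `|C| + 1 by rewrite ltr_wpDl.
have e10 : 0 < e1 by rewrite lt_min ltr01 divr_gt0 ?lt_min ?e0 ?ltr01// mulr_gt0.
have e11 : e1 <= 1 by rewrite ge_min lexx.
have Ce : (`|C| + 1) * e1 <= Num.min e 1 / 12.
  apply: (@le_trans _ _ ((`|C| + 1) * (Num.min e 1 / (12 * (`|C| + 1))))).
    by rewrite ler_wpM2l ?(ltW C0)// /e1 ge_min lexx orbT.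
  by rewrite le_eqVlt; apply/orP; left; apply/eqP; field; rewrite gt_eqF.
clearbody e1; have [dp dp0 Hp] := phi_power_approx k a01 hb hc e10.
exists (Num.min dp (Num.min e1 (Num.min (model_radius k) (1 / 10)))).
  by rewrite !lt_min dp0 e10 model_radius_gt0 divr_gt0.
move=> r th z; rewrite !lt_min => /and4P[N1 N2 N3 N4].
have [_ _ Hf] := Hp _ _ N1.
have r0 := sqr_ge0 r; have t0 := sqr_ge0 th.
have N0 : 0 <= r ^+ 2 + th ^+ 2 by rewrite addr_ge0.
have a0 : 0 < alpha by case/andP: a01.
have /andP[f1 f2] := phi_loc_bounds k r th a0 hb hc.
have f0 : 0 < phi_loc alpha k b chi r th by lra.
have lt1 (x : R) : x ^+ 2 < 1 -> `|x| < pi / 2.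
  move=> x1; apply: (@lt_le_trans _ _ 1); last exact: half_pi_ge1.
  by rewrite -[ltRHS]sqrtr1 -sqrtr_sqr ltr_sqrt.
rewrite gram_chart//; [|by apply: lt1; lra|by apply: lt1; lra].
have hcos0 : `|cos r - (1 - r ^+ 2 / 2)| <= r ^+ 2 * r ^+ 2 by exact: cos_approx.
have hcos : `|cos r - (1 - r ^+ 2 / 2)| <= e1 * (r ^+ 2 + th ^+ 2).
  by apply: (le_trans hcos0); apply: ler_pM => //; lra.
have e101 : 0 <= e1 <= 1 by rewrite e11 ltW.
have := HC e1 r th _ _ e101 (ltW N2) N3 Hf hcos.
set F := (phi_loc _ _ _ _ _ _)^-1; set w := weight_model k r th; move=> H.
have F1 : 2 / 3 <= F.
  by rewrite /F -[leLHS]invf_div lef_pV2 ?posrE//; lra.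
have c1 : 7 / 8 <= cos r.
  move: hcos0 => /ler_normlP[]; have := ler_wpM2l r0 (_ : r ^+ 2 <= 1 / 10); lra.
have Fc : 7 / 12 <= F * cos r.
  have -> : 7 / 12 = 2 / 3 * (7 / 8) :> R by field.
  by apply: ler_pM.
have m1 : Num.min e 1 <= 1 by rewrite ge_min lexx orbT.
have me : Num.min e 1 <= e by rewrite ge_min lexx.
have H1 : C * (e1 * (r ^+ 2 + th ^+ 2)) <= Num.min e 1 / 12 * (r ^+ 2 + th ^+ 2).
  rewrite mulrA ler_wpM2r//; apply: le_trans Ce; rewrite ler_wpM2r ?(ltW e10)//.
  by have := ler_norm C; lra.
have H2 : Num.min e 1 / 12 * (r ^+ 2 + th ^+ 2) <= 1 / 12 * 1 by apply: ler_pM => //;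
  [rewrite divr_ge0// le_min ltW//=|by rewrite ler_pM2r|lra].
have w1 : 1 / 2 <= w.
  have := le_trans H (le_trans H1 H2); rewrite ler_distl => /andP[_]; lra.
apply: (le_trans (le_trans H H1)).
apply: (@le_trans _ _ (e * (r ^+ 2 + th ^+ 2) * (1 / 2))).
  rewrite [leRHS]mulrAC ler_wpM2r//; lra.
by rewrite ler_wpM2l// mulr_ge0// ltW.
Qed.

Lemma integral_density_model_sqr (t : R) : 0 < t -> t ^+ 2 <= model_radius k / 2 ->
  (\int[(mu \x mu \x mu)%E]_u (density_model k (t ^+ 2) u)%:E = (volpoly t)%:E)%E.
Proof.
move=> t0 td; rewrite model_volume ?exprn_gt0// sqrtr_sqr gtr0_norm//.
by rewrite /volpoly -exprM -!exprSr.
Qed.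

(** By [dist_lower] the ball lies in the model set of radius t (1 + e t^2), and
   there r^2 + th^2 <= 48 t^2. *)
Lemma ball_volume_upper (e : R) : 0 < e < 1 -> exists2 d : R, 0 < d &
  forall t : R, 0 < t < d ->
    (ball_volume t <= ((1 + e * t ^+ 2) * volpoly (t * (1 + e * t ^+ 2)))%:E)%E.
Proof.
move=> /andP[e0 e1].
have e2 : 0 < e / 2 by rewrite divr_gt0.
(* 48 is the constant in the bound of S by t^2. *)
have e48 : 0 < e / 48 by rewrite divr_gt0.
have [d1 d10 H1] := dist_lower k a01 hb hc OO e2.
have [d2 d20 H2] := density_approx e48.
have D0 := model_radius_gt0 k.
set d3 := Num.min d2 (Num.min (model_radius k) 1).
have d30 : 0 < d3 by rewrite !lt_min d20 D0 ltr01.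
have [d3a [d3b d3c]] : d3 <= d2 /\ d3 <= model_radius k /\ d3 <= 1.
  by rewrite /d3 !ge_min !lexx ?orbT.
clearbody d3; exists (Num.min d1 (d3 / 48)); first by rewrite lt_min d10 divr_gt0.
move=> t /andP[t0]; rewrite lt_min => /andP[td1 td3].
have tt : t ^+ 2 <= t by rewrite expr2 ler_piMl ?ltW//; lra.
have t2 : 0 < t ^+ 2 by rewrite exprn_gt0.
have et : 0 < e * t ^+ 2 by rewrite mulr_gt0.
have et1 : e * t ^+ 2 <= 1 * (1 / 48) by apply: ler_pM; lra.
rewrite EFinM -integral_density_model_sqr; first last.
- rewrite exprMn; apply: (@le_trans _ _ (t ^+ 2 * 2)); last lra.
  by rewrite ler_wpM2l ?(ltW t2)// expr2; nra.
- by rewrite mulr_gt0//; lra.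
rewrite -ge0_integralZl_EFin//; first last.
- lra.
- by apply/measurable_EFinP; exact: measurable_density_model.
- by move=> u _; rewrite lee_fin density_model_ge0.
rewrite /ball_volume /rvolume; apply: ge0_integral_mono => //.
- by move=> u _; rewrite mule_ge0// lee_fin ?density_model_ge0//; lra.
move=> [[r th] z] [uD [_ /= uB]].
have t01 : 0 < t < d1 by rewrite t0.
have [_ _ S48 GT] := H1 t r th z t01 uD uB.
have z0 := sqr_ge0 z.
have N48 : r ^+ 2 + th ^+ 2 <= 48 * t ^+ 2 by lra.
have Nd : r ^+ 2 + th ^+ 2 < d3 by lra.
have Ndm := lt_le_trans Nd d3b.
have GT' : Gmodel k r th z < (t * (1 + e * t ^+ 2)) ^+ 2.
  apply: (le_lt_trans GT); rewrite ltr_pXn2r ?nnegrE//.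
  - by rewrite ltr_pM2l//; lra.
  - by apply: mulr_ge0; [exact: ltW|lra].
  - by apply: mulr_ge0; [exact: ltW|lra].
rewrite /density_model/= Ndm GT'/= -EFinM lee_fin.
have w0 := weight_model_ge0 Ndm.
have := H2 r th z (lt_le_trans Nd d3a); rewrite ler_distl => /andP[_ H].
apply: (le_trans H); rewrite mulrDl mul1r lerD2l ler_wpM2r//.
have := ler_wpM2l (ltW e48) N48; lra.
Qed.

(** By [dist_upper] the model set of radius t (1 - e t^2) lies in the ball: there
   S < 2 t^2, and the gap between T and t^2, which is at least
   (3/2) e t^4, absorbs the error (e / 8) S^2. *)
Lemma ball_volume_lower (e : R) : 0 < e < 1 -> exists2 d : R, 0 < d &
  forall t : R, 0 < t < d ->
    (((1 - e * t ^+ 2) * volpoly (t * (1 - e * t ^+ 2)))%:E <= ball_volume t)%E.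
Proof.
move=> /andP[e0 e1].
have e8 : 0 < e / 8 by rewrite divr_gt0.
have e2 : 0 < e / 2 by rewrite divr_gt0.
have [d1 d10 H1] := dist_upper k a01 hb hc OO e8.
have [d2 d20 H2] := density_approx e2.
have D0 := model_radius_gt0 k.
set d3 := Num.min d1 (Num.min d2 (Num.min (model_radius k) 1)).
have d30 : 0 < d3 by rewrite !lt_min d10 d20 D0 ltr01.
have [d3a [d3b [d3c d3d]]] : d3 <= d1 /\ d3 <= d2 /\ d3 <= model_radius k /\ d3 <= 1.
  by rewrite /d3 !ge_min !lexx ?orbT.
clearbody d3; exists (d3 / 48); first by rewrite divr_gt0.
move=> t /andP[t0 td3].
have tt : t ^+ 2 <= t by rewrite expr2 ler_piMl ?ltW//; lra.
have t2 : 0 < t ^+ 2 by rewrite exprn_gt0.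
have et : 0 < e * t ^+ 2 by rewrite mulr_gt0.
have et1 : e * t ^+ 2 <= 1 * (1 / 48) by apply: ler_pM; lra.
set T := (t * (1 - e * t ^+ 2)) ^+ 2.
have TE : T = t ^+ 2 * (1 - e * t ^+ 2) ^+ 2 by rewrite /T exprMn.
have Tle : T <= t ^+ 2 - 3 / 2 * e * (t ^+ 2) ^+ 2.
  have -> : T = t ^+ 2 - 2 * e * (t ^+ 2) ^+ 2 + e * t ^+ 2 * (e * (t ^+ 2) ^+ 2).
    by rewrite TE; ring.
  have E4 : 0 <= e * (t ^+ 2) ^+ 2 by rewrite mulr_ge0 ?sqr_ge0// ltW.
  have := ler_wpM2r E4 et1; lra.
have Tt : T <= t ^+ 2.
  have E4 : 0 <= e * (t ^+ 2) ^+ 2 by rewrite mulr_ge0 ?sqr_ge0// ltW.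
  lra.
rewrite EFinM -integral_density_model_sqr; first last.
- rewrite -/T; lra.
- by rewrite mulr_gt0//; lra.
rewrite -/T -ge0_integralZl_EFin//; first last.
- lra.
- by apply/measurable_EFinP; exact: measurable_density_model.
- by move=> u _; rewrite lee_fin density_model_ge0.
pose Om := [set u : R * R * R |
  (u.1.1 ^+ 2 + u.1.2 ^+ 2 < model_radius k) && (Gmodel k u.1.1 u.1.2 u.2 < T)].
have -> : (\int[(mu \x mu \x mu)%E]_u ((1 - e * t ^+ 2)%:E * (density_model k T u)%:E) =
   \int[(mu \x mu \x mu)%E]_(u in Om) ((1 - e * t ^+ 2)%:E * (density_model k T u)%:E))%E.
  rewrite [RHS]integral_mkcond; congr integral; apply/funext => u.
  rewrite patchE; case: ifPn => //; rewrite notin_setE /Om/= => /negP/negbTE H.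
  by rewrite /density_model H mule0.
rewrite /ball_volume /rvolume; apply: ge0_integral_mono => //.
- move=> [[r th] z] /andP[/= Nd GT].
  have r0 := sqr_ge0 r; have th0 := sqr_ge0 th; have z0 := sqr_ge0 z.
  have [_ A1 K1 _] := model_bounds Nd.
  have S2 : r ^+ 2 + th ^+ 2 + z ^+ 2 < 2 * t ^+ 2.
    move: GT; rewrite Gmodel_Gplane; have := ler_wpM2l z0 K1; lra.
  have t1 : 2 * t ^+ 2 <= 1 by lra.
  have pi1 : 1 <= pi / 2 :> R := half_pi_ge1.
  have lt1 (x : R) : x ^+ 2 < 1 -> `|x| < 1.
    by move=> x1; rewrite -[ltRHS]sqrtr1 -sqrtr_sqr ltr_sqrt.
  have r1 : `|r| < 1 by apply: lt1; lra.
  have th1 : `|th| < 1 by apply: lt1; lra.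
  have z1 : `|z| < 1 by apply: lt1; lra.
  split.
    have pi2 : pi / 2 <= pi :> R by lra.
    by rewrite /chart_dom/=; split; first split;
      rewrite /= in_itv/= -ltr_norml ?(lt_le_trans _ pi1)// (lt_le_trans _ (le_trans pi1 pi2)).
  split => /=.
    exact: chart_S2xS1.
  apply: H1 => //; first lra.
  have S0 : 0 <= r ^+ 2 + th ^+ 2 + z ^+ 2 by rewrite !addr_ge0.
  have Sq : (r ^+ 2 + th ^+ 2 + z ^+ 2) ^+ 2 <= (2 * t ^+ 2) ^+ 2.
    by rewrite lerXn2r ?nnegrE ?(ltW S2)// mulr_ge0// ltW.
  have E4 : 0 < e * (t ^+ 2) ^+ 2 by rewrite mulr_gt0 ?exprn_gt0.
  have := ler_wpM2l (ltW e8) Sq.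
  have -> : e / 8 * (2 * t ^+ 2) ^+ 2 = e * (t ^+ 2) ^+ 2 / 2 by field.
  lra.
- by move=> u _; rewrite mule_ge0// lee_fin ?density_model_ge0//; lra.
move=> [[r th] z] /andP[/= Nd GT].
have r0 := sqr_ge0 r; have th0 := sqr_ge0 th; have z0 := sqr_ge0 z.
have [_ A1 K1 _] := model_bounds Nd.
have S2 : r ^+ 2 + th ^+ 2 < 2 * t ^+ 2.
  move: GT; rewrite Gmodel_Gplane; have := ler_wpM2l z0 K1; lra.
rewrite /density_model/= Nd GT/= -EFinM lee_fin.
have w0 := weight_model_ge0 Nd.
have Nd2 : r ^+ 2 + th ^+ 2 < d2 by lra.
have := H2 r th z Nd2; rewrite ler_distl => /andP[H _]; apply: le_trans H.
have := ler_wpM2l (ltW e2) (ltW S2) => H3.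
have -> : weight_model k r th - e / 2 * (r ^+ 2 + th ^+ 2) * weight_model k r th =
  (1 - e / 2 * (r ^+ 2 + th ^+ 2)) * weight_model k r th by ring.
rewrite ler_wpM2r//; lra.
Qed.

End volume.

(** * The expansion *)

Section expansion.
Context {R : realType}.

Lemma volpoly_upper (x t : R) : 0 <= t -> 0 <= x -> x <= 1 ->
  (1 + x) * volpoly (t * (1 + x)) <= volpoly t + 20 * pi * x * t ^+ 3.
Proof.
move=> t0 x0 x1; rewrite /volpoly; have p0 : 0 <= pi :> R by exact: pi_ge0.
have t3 : 0 <= t ^+ 3 by exact: exprn_ge0.
have t5 : 0 <= t ^+ 5 by exact: exprn_ge0.
have e4 : (1 + x) ^+ 4 <= 1 + 15 * x.
  have xx : 0 <= x * (1 - x) by rewrite mulr_ge0// subr_ge0.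
  have xxx : 0 <= x ^+ 2 * (1 - x) by rewrite mulr_ge0 ?subr_ge0// sqr_ge0.
  have x4 : 0 <= x ^+ 3 * (1 - x) by rewrite mulr_ge0 ?subr_ge0// exprn_ge0.
  have -> : (1 + x) ^+ 4 = 1 + 15 * x - (11 * (x * (1 - x)) + 5 * (x ^+ 2 * (1 - x))
    + x ^+ 3 * (1 - x)) by ring.
  lra.
have e6 : 1 <= (1 + x) ^+ 6 by rewrite exprn_ege1// lerDl.
have -> : (1 + x) * (4 * pi / 3 * (t * (1 + x)) ^+ 3 - 4 * pi / 45 * (t * (1 + x)) ^+ 5) =
  4 * pi / 3 * t ^+ 3 * (1 + x) ^+ 4 - 4 * pi / 45 * t ^+ 5 * (1 + x) ^+ 6.
  by field.
have := ler_wpM2l (mulr_ge0 p0 t3) e4; have := ler_wpM2l (mulr_ge0 p0 t5) e6; lra.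
Qed.

Lemma volpoly_lower (x t : R) : 0 <= t -> 0 <= x -> x <= 1 ->
  volpoly t - 20 * pi * x * t ^+ 3 <= (1 - x) * volpoly (t * (1 - x)).
Proof.
move=> t0 x0 x1; rewrite /volpoly; have p0 : 0 <= pi :> R by exact: pi_ge0.
have t3 : 0 <= t ^+ 3 by exact: exprn_ge0.
have t5 : 0 <= t ^+ 5 by exact: exprn_ge0.
have e4 : 1 - 15 * x <= (1 - x) ^+ 4.
  have -> : (1 - x) ^+ 4 = 1 - 4 * x + x ^+ 2 * ((x - 2) ^+ 2 + 2) by ring.
  have := mulr_ge0 (sqr_ge0 x) (addr_ge0 (sqr_ge0 (x - 2)) (ler0n R 2)); lra.
have e6 : (1 - x) ^+ 6 <= 1 by rewrite exprn_ile1// ?subr_ge0// gerBl.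
have -> : (1 - x) * (4 * pi / 3 * (t * (1 - x)) ^+ 3 - 4 * pi / 45 * (t * (1 - x)) ^+ 5) =
  4 * pi / 3 * t ^+ 3 * (1 - x) ^+ 4 - 4 * pi / 45 * t ^+ 5 * (1 - x) ^+ 6.
  by field.
have := ler_wpM2l (mulr_ge0 p0 t3) e4; have := ler_wpM2l (mulr_ge0 p0 t5) e6; lra.
Qed.
End expansion.

Theorem mainTheorem8 (R : realType) (alpha k : R)
    (b : R -> R) (chi : R * R -> R) (Q : 'M[R]_3)
    (halpha : 0 < alpha < 1) (hb : is_profile b) (hchi : is_cutoff chi)
    (hO : Q *m Q^T = 1%:M) :
  let g := g_metric alpha k b chi Q in
  let q : ambient R := chart Q (0, 0, 0) in
  let Vol := rvolume g chart_dom (chart Q) in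
  (fun t : R => fine (Vol (rball S2xS1 g q t))
                - (4 * pi / 3 * t ^+ 3 - 4 * pi / 45 * t ^+ 5))
    =o_ (0^'+) (fun t : R => t ^+ 5).
Proof.
move=> g q Vol; apply/eqoP => eps eps0.
have p0 : 0 < pi :> R by exact: pi_gt0.
(* Both bounds differ from the polynomial by at most 20 pi e t^5. *)
set e : R := Num.min (1 / 2) (eps / (20 * pi)).
have e0 : 0 < e by rewrite lt_min !divr_gt0// mulr_gt0.
have e1 : e < 1 by rewrite gt_min; apply/orP; left; lra.
have e01 : 0 < e < 1 by rewrite e0.
have ee : 20 * pi * e <= eps.
  by rewrite mulrC -ler_pdivlMr ?mulr_gt0// /e ge_min lexx orbT.
have [d1 d10 U] := ball_volume_upper k halpha hb hchi hO e01.
have [d2 d20 L] := ball_volume_lower k halpha hb hchi hO e01.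
near=> t.
have t0 : 0 < t by near: t; exact: nbhs_right_gt.
have td1 : t < d1 by near: t; exact: nbhs_right_lt.
have td2 : t < d2 by near: t; exact: nbhs_right_lt.
have t1 : t < 1 by near: t; exact: nbhs_right_lt.
have t21 : t ^+ 2 <= 1 by rewrite exprn_ile1// ltW.
have t2 : 0 <= t ^+ 2 by exact: sqr_ge0.
have et0 : 0 <= e * t ^+ 2 by rewrite mulr_ge0// ltW.
have et1 : e * t ^+ 2 <= 1 by rewrite mulr_ile1// ltW.
have td1' : 0 < t < d1 by rewrite t0.
have td2' : 0 < t < d2 by rewrite t0.
have := U _ td1'; have := L _ td2'.
rewrite -/(Vol (rball S2xS1 g q t)) /ball_volume -/g -/q -/Vol.
case: (Vol _) => [v| |] //=; rewrite !lee_fin => Lv Uv.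
have Uv' := le_trans Uv (volpoly_upper (ltW t0) et0 et1).
have Lv' := le_trans (volpoly_lower (ltW t0) et0 et1) Lv.
have E : 20 * pi * (e * t ^+ 2) * t ^+ 3 = 20 * pi * e * t ^+ 5 by ring.
rewrite E in Uv' Lv'.
have t5 : 0 < t ^+ 5 by rewrite exprn_gt0.
rewrite (gtr0_norm t5); apply: le_trans (_ : 20 * pi * e * t ^+ 5 <= _).
  by rewrite ler_norml -/(volpoly t); apply/andP; split; lra.
by rewrite ler_wpM2r// ltW.
Unshelve. all: by end_near.
Qed.
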